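(* Let $N\ge 1$ be an integer, let $1<p<\infty$, and let $a\in C^1(\mathbb{R}^N)$ satisfy $a(x)>0$ and $|Da(x)|\le c\,a(x)^{1/2}$ for all $x\in\mathbb{R}^N$, for some constant $c>0$. Let $A=-a(x)^2\Delta^2$ and $$D(A_p)=\{u\in W^{4,p}_{\rm loc}(\mathbb{R}^N)\cap L^p(\mathbb{R}^N):\ a^{1/2}Du,\ aD^2u,\ a^{3/2}D^3u,\ a^2D^4u\in L^p(\mathbb{R}^N)\}.$$ Then there exist $r_p>0$ and a constant $C$ depending only on $N$, $p$ and $c$ such that, for every $\lambda=re^{i\theta}$ with $r>r_p$ and $\theta\in[-\frac{\pi}{2},\frac{\pi}{2}]$ and every $u\in D(A_p)$, $$|\lambda|\,\|u\|_p\le C\,\|\lambda u-Au\|_p .$$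
   Context: Functions are complex-valued. $\|\cdot\|_p$ is the norm of $L^p(\mathbb{R}^N)$. $D^hu$ denotes the collection of all (weak) partial derivatives of $u$ of order $h$, $|D^hu|=\big(\sum_{i_1,\dots,i_h=1}^N|D_{i_1\dots i_h}u|^2\big)^{1/2}$, and $a^{h/2}D^hu\in L^p$ means $a^{h/2}|D^hu|\in L^p$. $\Delta^2=\Delta\circ\Delta$. *)

(* Defs.v *)
From HB Require Import structures.
From mathcomp Require Import all_boot all_order all_algebra.
From mathcomp Require Import all_classical all_reals all_analysis.
From mathcomp Require Export complex.
Import Order.TTheory GRing.Theory Num.Theory.
Import numFieldNormedType.Exports.

Set Implicit Arguments.
Unset Strict Implicit.
Unset Printing Implicit Defensive.

Local Open Scope classical_set_scope.
Local Open Scope ring_scope.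
Local Open Scope complex_scope.

Definition rV_display : measure_display.
Proof. exact: default_measure_display. Qed.

Section rV_measurable.
Context {R : realType} (n : nat).

Let coor (i : 'I_n) (x : 'rV[R]_n) : measurableTypeR R := x ord0 i.

Let rV0 : g_sigma_preimage coor set0.
Proof. exact: sigma_algebra0. Qed.

Let rVC A : g_sigma_preimage coor A -> g_sigma_preimage coor (~` A).
Proof. exact: sigma_algebraC. Qed.

Let rVU (F : (set 'rV[R]_n)^nat) : (forall i, g_sigma_preimage coor (F i)) ->
  g_sigma_preimage coor (\bigcup_i (F i)).
Proof. exact: sigma_algebra_bigcup. Qed.

(* generated by the coordinates; as n is finite, this is the Borel
   sigma-algebra of the normed space 'rV[R]_n *)
HB.instance Definition _ := @isMeasurable.Build rV_display
  'rV[R]_n (g_sigma_preimage coor) rV0 rVC rVU.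

Lemma measurable_coor (i : 'I_n) :
  measurable_fun [set: 'rV[R]_n] (fun x => x ord0 i : measurableTypeR R).
Proof.
move=> _ Y mY; rewrite setTI; apply: sub_sigma_algebra => /=.
rewrite -bigcup_seq/=; exists i => /=; first by rewrite mem_index_enum.
by exists Y => //; rewrite setTI.
Qed.

Lemma measurable_fun_coorP d (T : measurableType d) (f : T -> 'rV[R]_n) :
  (forall i, measurable_fun [set: T] (fun x => f x ord0 i : measurableTypeR R)) ->
  measurable_fun [set: T] f.
Proof.
move=> mf _ A mA; rewrite setTI.
apply: (mA (fun B => measurable (f @^-1` B))); split.
  split; first by rewrite preimage_set0.
  - by move=> B mB; rewrite setTD preimage_setC; exact: measurableC.
  - by move=> F mF; rewrite preimage_bigcup; exact: bigcupT_measurable.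
rewrite -bigcup_seq => B [i _ [Y mY <-]].
rewrite setTI; have := mf i measurableT _ mY; by rewrite setTI.
Qed.

End rV_measurable.

Section lebesgue_rV.
Context {R : realType}.
Implicit Types n : nat.

Definition consrV n (z : measurableTypeR R * 'rV[R]_n) : 'rV[R]_n.+1 :=
  \row_i oapp (z.2 ord0) z.1 (unlift ord0 i).

Definition unconsrV n (x : 'rV[R]_n.+1) : measurableTypeR R * 'rV[R]_n :=
  (x ord0 ord0, \row_i x ord0 (lift ord0 i)).

Lemma consrV0 n z : @consrV n z ord0 ord0 = z.1.
Proof. by rewrite mxE unlift_none. Qed.

Lemma consrVS n z i : @consrV n z ord0 (lift ord0 i) = z.2 ord0 i.
Proof. by rewrite mxE liftK. Qed.

Lemma consrVK n : cancel (@consrV n) (@unconsrV n).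
Proof.
move=> z; rewrite /unconsrV consrV0 [RHS]surjective_pairing; congr pair.
by apply/rowP => i; rewrite mxE consrVS.
Qed.

Lemma measurable_consrV n : measurable_fun setT (@consrV n).
Proof.
apply: measurable_fun_coorP => i; case: (unliftP ord0 i) => [j|] ->.
- under eq_fun do rewrite consrVS.
  by apply: (measurableT_comp (measurable_coor j)).
- under eq_fun do rewrite consrV0.
  exact: measurable_fst.
Qed.

Lemma measurable_unconsrV n : measurable_fun setT (@unconsrV n).
Proof.
apply/measurable_fun_pairP; split; first exact: measurable_coor.
apply: measurable_fun_coorP => i /=.
under eq_fun do rewrite mxE.
exact: measurable_coor.
Qed.

Section lebesgue_cons.
Context n (m : {sigma_finite_measure set 'rV[R]_n -> \bar R}).

Definition lebesgue_cons : set 'rV[R]_n.+1 -> \bar R :=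
  pushforward (lebesgue_measure \x m)%E (@consrV n).

Let lebesgue_cons0 : lebesgue_cons set0 = 0%E.
Proof. by rewrite /lebesgue_cons /pushforward preimage_set0 measure0. Qed.

Let lebesgue_cons_ge0 A : (0 <= lebesgue_cons A)%E.
Proof. by apply: integral_ge0 => x _; exact: measure_ge0. Qed.

Let lebesgue_cons_sigma_additive : semi_sigma_additive lebesgue_cons.
Proof.
move=> F mF tF mUF; rewrite /lebesgue_cons /pushforward preimage_bigcup.
apply: measure_semi_sigma_additive.
- by move=> i; rewrite -[X in measurable X]setTI; exact: measurable_consrV.
- apply/trivIsetP => /= i j _ _ ij; rewrite -preimage_setI.
  by move/trivIsetP : tF => /(_ _ _ _ _ ij) ->//; rewrite preimage_set0.
- by rewrite -preimage_bigcup -[X in measurable X]setTI; exact: measurable_consrV.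
Qed.

HB.instance Definition _ := isMeasure.Build _ _ _ lebesgue_cons
  lebesgue_cons0 lebesgue_cons_ge0 lebesgue_cons_sigma_additive.

Let lebesgue_cons_sigma_finite : sigma_finite setT lebesgue_cons.
Proof.
have [K UK mK] : sigma_finite setT (lebesgue_measure \x m)%E.
  have /sigma_finiteP[F [TF ndF Foo]] := sigma_finiteT (@lebesgue_measure R).
  have /sigma_finiteP[G [TG ndG Goo]] := sigma_finiteT m.
  exists (fun i => F i `*` G i).
    rewrite -setXTT TF TG predeqE => -[x y]; split.
      move=> [/= [i _ Fix] [k _ Gky]]; exists (maxn i k) => //; split.
      - by move: x Fix; exact/subsetPset/ndF/leq_maxl.
      - by move: y Gky; exact/subsetPset/ndG/leq_maxr.
    by move=> [i _ []/= ? ?]; split; exists i.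
  move=> k; have [? ?] := Foo k; have [? ?] := Goo k.
  split; first exact: measurableX.
  by rewrite product_measure1E// lte_mul_pinfty// ge0_fin_numE.
exists (fun i => @unconsrV n @^-1` K i).
  by rewrite -preimage_bigcup -UK preimage_setT.
move=> i; have [mKi Kioo] := mK i; split.
  by rewrite -[X in measurable X]setTI; exact: measurable_unconsrV.
rewrite /lebesgue_cons /pushforward -comp_preimage.
rewrite (_ : _ \o _ = id) ?preimage_id//.
by apply/funext => z /=; rewrite consrVK.
Qed.

HB.instance Definition _ := @Measure_isSigmaFinite.Build _ _ _ lebesgue_cons
  lebesgue_cons_sigma_finite.

End lebesgue_cons.

Fixpoint lebesgue_rV n : {sigma_finite_measure set 'rV[R]_n -> \bar R} :=
  match n with
  | 0 => \d_(0 : 'rV[R]_0)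
  | n'.+1 => lebesgue_cons (lebesgue_rV n')
  end.

Lemma lebesgue_rV_box n (a b : 'rV[R]_n) : (forall i, a ord0 i <= b ord0 i) ->
  lebesgue_rV n [set x | forall i, a ord0 i <= x ord0 i <= b ord0 i] =
  (\prod_i (b ord0 i - a ord0 i))%:E.
Proof.
elim: n a b => [|n IH] a b ab.
  rewrite big_ord0 /= diracE mem_set// => -[]//.
pose tl (x : 'rV[R]_n.+1) := \row_(i < n) x ord0 (lift ord0 i).
rewrite /= /lebesgue_cons /pushforward.
rewrite [X in product_measure1 _ _ X](_ : _ =
   `[a ord0 ord0, b ord0 ord0]%classic `*`
   [set x : 'rV[R]_n | forall i, tl a ord0 i <= x ord0 i <= tl b ord0 i]).
  rewrite product_measure1E//.
  - rewrite IH; last by move=> i; rewrite !mxE.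
    rewrite big_ord_recl EFinM; congr (_ * _)%E; last first.
      by congr EFin; apply: eq_bigr => i _; rewrite !mxE.
    transitivity (lebesgue_measure `[a ord0 ord0, b ord0 ord0]%classic) => //.
    rewrite lebesgue_measure_itv/= lte_fin.
    have := ab ord0; rewrite le_eqVlt => /predU1P[->|->].
      by rewrite ltxx subrr.
    by rewrite -EFinD.
  - rewrite (_ : mkset _ = \bigcap_(i : 'I_n)
       ((fun x : 'rV[R]_n => x ord0 i : measurableTypeR R) @^-1`
          `[tl a ord0 i, tl b ord0 i]%classic)).
      apply: fin_bigcap_measurable => // i _.
      by rewrite -[X in measurable X]setTI; exact: measurable_coor.
    apply/seteqP; split=> x /= H i; first by move=> _ /=; rewrite in_itv/=.
    by have := H i I; rewrite /= in_itv.
apply/seteqP; split=> [[x v]|[x v]] /=.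
  move=> H; split; first by have := H ord0; rewrite consrV0 in_itv.
  by move=> i; have := H (lift ord0 i); rewrite consrVS !mxE.
rewrite in_itv/= => -[xab H] i.
case: (unliftP ord0 i) => [j|] ->; last by rewrite consrV0.
by rewrite consrVS; have := H j; rewrite !mxE.
Qed.

End lebesgue_rV.

Section calculus.
Context {R : realType} {N : nat}.
Implicit Types (f phi : 'rV[R]_N -> R) (i : 'I_N) (k : nat) (s : seq 'I_N).

Definition partial i f : 'rV[R]_N -> R := fun x => 'D_(delta_mx ord0 i) f x.

Definition partials s f : 'rV[R]_N -> R := foldr partial f s.

Fixpoint Ck k f : Prop :=
  match k with
  | 0 => continuous f
  | k'.+1 => continuous f /\
      forall i, (forall x, derivable f x (delta_mx ord0 i)) /\
                Ck k' (partial i f)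
  end.

Definition test_function phi : Prop :=
  (forall k, Ck k phi) /\ compact (closure [set x | phi x != 0]).

Definition grad_norm f (x : 'rV[R]_N) : R :=
  Num.sqrt (\sum_(i < N) partial i f x ^+ 2).

End calculus.

(* The function spaces below consist of Borel measurable functions rather than
   of classes modulo almost everywhere equality. *)
Section sobolev.
Context {R : realType} {N : nat}.
Implicit Types (u v : 'rV[R]_N -> R[i]) (p : R) (s : seq 'I_N).

Local Notation mu := (@lebesgue_rV R N).

Definition modulus u : 'rV[R]_N -> R := fun x => Normc.normc (u x).

Definition cmeasurable u : Prop :=
  measurable_fun setT (fun x => complex.Re (u x) : measurableTypeR R) /\
  measurable_fun setT (fun x => complex.Im (u x) : measurableTypeR R).

Definition cintegral u : R[i] :=
  (\int[mu]_x complex.Re (u x)) +i* (\int[mu]_x complex.Im (u x)).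

Definition Lpnorm p u : \bar R := 'N[mu]_p%:E[EFin \o modulus u].

Definition Lp p u : Prop := cmeasurable u /\ (Lpnorm p u < +oo)%E.

Definition Lp_loc p u : Prop :=
  cmeasurable u /\
  forall K : set 'rV[R]_N, compact K ->
    (\int[mu]_(x in K) (modulus u x `^ p)%:E < +oo)%E.

(* v is the weak derivative D_{i_1 ... i_h} u, for s = [:: i_1; ...; i_h];
   by linearity, real-valued test functions suffice *)
Definition is_weak_derivative s u v : Prop :=
  [/\ Lp_loc 1 u, Lp_loc 1 v &
      forall phi, test_function phi ->
        cintegral (fun x => u x * (partials s phi x)%:C) =
        (-1) ^+ size s * cintegral (fun x => v x * (phi x)%:C)].

(* some representative of the weak derivative, which is unique up to almost
   everywhere equality; the junk value 0 when there is none *)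
Definition weak_derivative s u : 'rV[R]_N -> R[i] :=
  xget (fun=> 0) [set v | is_weak_derivative s u v].

Definition sobolev_loc k p u : Prop :=
  forall s, (size s <= k)%N -> exists2 v, is_weak_derivative s u v & Lp_loc p v.

Definition Dnorm h u (x : 'rV[R]_N) : R :=
  Num.sqrt (\sum_(s : h.-tuple 'I_N) modulus (weak_derivative s u) x ^+ 2).

Definition laplacian u : 'rV[R]_N -> R[i] :=
  fun x => \sum_(i < N) weak_derivative [:: i; i] u x.

Definition bilaplacian u : 'rV[R]_N -> R[i] := laplacian (laplacian u).

Definition opA (a : 'rV[R]_N -> R) u : 'rV[R]_N -> R[i] :=
  fun x => - ((a x ^+ 2)%:C * bilaplacian u x).

Definition domA (a : 'rV[R]_N -> R) p u : Prop :=
  [/\ sobolev_loc 4 p u, Lp p u &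
      forall h, (1 <= h <= 4)%N ->
        (fun x => a x `^ (h%:R / 2) * Dnorm h u x) \in Lfun mu p%:E].

End sobolev.

(* Main.v *)
(* Dividing by a^2 and freezing the coefficient at x0 turns lambda u - A u = f into
   a perturbation of (lambda / a(x0)^2 + Delta^2) u = g. The symbol of Delta^2 is
   nonnegative, so for Re lambda >= 0 this operator factors into two second-order
   resolvents k - Delta, with k = +-i (lambda / a(x0)^2)^{1/2} in a sector away
   from (-oo, 0]. They are explicit superpositions of Gaussian kernels of complex
   width, so Young's inequality bounds them and their first derivatives on every
   L^q. Testing the weak equation with eta w, where eta is a cutoff on a cube of
   half-side h = eps a(x0)^{1/2} and w solves the frozen equation for a test
   function on the right-hand side, gives by duality a bound of u in L^p on that
   cube. By |Da| <= c a^{1/2} the function a^{1/2} is Lipschitz, so the freezing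
   error is small with eps, and the commutator [Delta^2, eta] costs a factor
   |lambda|^{-1/4} / eps. Since the cubes vary slowly with their centre, integrating
   the p-th powers of the local bounds against a(x0)^{-N/2} dx0 gives the global
   bound by Tonelli's theorem, without a covering argument; the terms in u are
   absorbed for |lambda| large. *)
From HB Require Import structures.
Require Import Defs.
From mathcomp Require Import all_boot all_order all_algebra.
From mathcomp Require Import all_classical all_reals all_analysis.
From mathcomp Require Import measurable_realfun complex ring lra.
Import Order.TTheory GRing.Theory Num.Theory.
Import numFieldNormedType.Exports.

Set Implicit Arguments.
Unset Strict Implicit.
Unset Printing Implicit Defensive.

Local Open Scope classical_set_scope.
Local Open Scope ring_scope.

(** * Measure and integration on R^N *)

Section rV_borel.
Context {R : realType}.
Implicit Types n : nat.

(** Uniformity in the centre x0 comes from scaling. This fixes the order of choices: eps depends on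
    c, N and the constant of the local estimate and makes the freezing error absorbable; only
    afterwards is q taken large, to absorb the commutator. For Re lambda >= 0 the numbers k satisfy
    |Re k| <= |Im k|, but Re k may be negative, and then the Laplace transform of the heat semigroup
    along real times diverges. Rotating the time variable restores convergence. The price is a
    Gaussian of complex width, whose total mass must be shown not to vanish before one can divide by
    it. A second derivative of the fourth-order resolvent is bounded by giving one derivative to
    each of its two factors; third derivatives occur only as first derivatives of the Laplacian,
    which the equation expresses through lower orders. Complex functions and kernels are carried as
    pairs of real ones, so many pairs of real identities below are the components of a single
    complex identity. *)

Lemma ball_rVP n (x y : 'rV[R]_n) (e : R) : 0 < e ->
  ball x e y <-> forall i, `|x ord0 i - y ord0 i| < e.
Proof.
move=> e0; split.
  move=> [_ H] i; have := H ord0 i.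
  by rewrite -ball_normE.
move=> H; split=> // i j; rewrite (ord1 i) -ball_normE; exact: H.
Qed.

Lemma nbhs_rVP n (x : 'rV[R]_n) (A : set 'rV[R]_n) :
  nbhs x A <-> exists2 e : R, 0 < e &
    forall y : 'rV[R]_n, (forall i, `|x ord0 i - y ord0 i| < e) -> A y.
Proof.
split=> [/nbhs_ballP[e e0 eA]|[e e0 eA]].
  by exists e => // y xy; apply: eA; apply/ball_rVP.
by apply/nbhs_ballP; exists e => // y /ball_rVP xy; apply/eA/xy.
Qed.

(** The sigma-algebra is generated by the coordinates, so an open set is exhibited as a countable
    union: the boxes with rational centre and radius 1 / (k + 1) that it contains. *)
Lemma measurable_open_rV n (A : set 'rV[R]_n) : open A -> measurable A.
Proof.
move=> oA.
pose bx (qk : 'rV[rat]_n * nat) : set 'rV[R]_n :=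
  [set x | forall i, `|x ord0 i - ratr (qk.1 ord0 i)| < qk.2.+1%:R^-1].
have mbx qk : measurable (bx qk).
  rewrite (_ : bx qk = \bigcap_(i : 'I_n) ((fun x : 'rV[R]_n => x ord0 i : measurableTypeR R) @^-1`
     ball (ratr (qk.1 ord0 i) : R) qk.2.+1%:R^-1)).
    apply: fin_bigcap_measurable => // i _.
    rewrite -[X in measurable X]setTI; apply: measurable_coor => //.
    by apply: measurable_realfun.open_measurable; exact: ball_open.
  apply/seteqP; split=> x /= H i; first by move=> _; rewrite /= -ball_normE /ball_/= distrC.
  by have := H i I; rewrite /= -ball_normE /ball_/= distrC.
rewrite (_ : A = \bigcup_qk (if `[< bx qk `<=` A >] then bx qk else set0)).
  by apply: countable_bigcupT_measurable => // qk; case: ifP.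
apply/seteqP; split=> [x Ax|x [qk _]]; last by case: asboolP => // + ?; apply.
have /nbhs_rVP[e e0 eA] : nbhs x A by exact: open_nbhs_nbhs.
have [k ke] : exists k, k.+1%:R^-1 < e / 2.
  have [k] := near_infty_natSinv_lt (PosNum (divr_gt0 e0 (ltr0n _ 2))).
  by move=> _ /(_ k) /= h; exists k; apply: h => /=.
have hq i : exists q : rat, `|x ord0 i - ratr q| < k.+1%:R^-1.
  have [|q] := @rat_in_itvoo R (x ord0 i - k.+1%:R^-1) (x ord0 i + k.+1%:R^-1).
    by rewrite ltrBlDr -addrA ltrDl addr_gt0// invr_gt0.
  by rewrite in_itv/= => h; exists q; rewrite distrC ltr_distl.
pose q := \row_i projT1 (cid (hq i)).
exists (q, k) => //; case: asboolP => [_|].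
  by move=> i; rewrite mxE; case: cid.
case=> y bxy; apply: eA => i.
have := bxy i; rewrite /= mxE; case: cid => /= r h1 h2.
have := ler_normD (x ord0 i - ratr r) (ratr r - y ord0 i).
rewrite addrA subrK => /le_lt_trans; apply.
rewrite (splitr e); apply: ltrD; first exact: lt_trans h1 _.
by rewrite distrC; exact: lt_trans h2 _.
Qed.

Lemma continuous_measurable_rV n (f : 'rV[R]_n -> R) :
  continuous f -> measurable_fun setT (f : _ -> measurableTypeR R).
Proof.
move=> cf; apply: (measurability _ (RGenOInfty.measurableE R)) => _ [_ [a ->] <-].
rewrite setTI; apply: measurable_open_rV; apply: open_comp.
  by move=> x _; exact: cf.
exact: interval_open.
Qed.

Lemma tonelli_rV n (f : 'rV[R]_n.+1 -> \bar R) :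
  measurable_fun setT f -> (forall x, 0 <= f x)%E ->
  (\int[lebesgue_rV n.+1]_x f x =
   \int[lebesgue_measure]_t \int[lebesgue_rV n]_y f (consrV (t, y)))%E.
Proof.
move=> mf f0.
have := ge0_integral_pushforward (@measurable_consrV R n)
  (lebesgue_measure \x lebesgue_rV n)%E measurableT mf (fun x _ => f0 x).
rewrite [X in X = _ -> _](_ : _ = \int[lebesgue_rV n.+1]_x f x)%E// => ->.
rewrite preimage_setT fubini_tonelli1//.
  by apply: measurableT_comp => //; exact: measurable_consrV.
by move=> x /=.
Qed.

Lemma measurable_addrV n (z : 'rV[R]_n) : measurable_fun setT (fun x : 'rV[R]_n => x + z).
Proof.
apply: measurable_fun_coorP => i; under eq_fun do rewrite mxE.
by apply: measurable_funD => //; exact: measurable_coor.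
Qed.

(** The image of Lebesgue measure under a translation agrees with it on half-open intervals, hence
    everywhere by uniqueness. *)
Lemma ge0_integral_shift1 (a : R) (f : R -> \bar R) :
  measurable_fun setT f -> (forall x, 0 <= f x)%E ->
  (\int[lebesgue_measure]_t f (t + a)%R = \int[lebesgue_measure]_t f t)%E.
Proof.
move=> mf f0.
have ms : measurable_fun setT ((fun t => (t + a)%R) : R -> measurableTypeR R).
  exact: measurable_funD.
transitivity (\int[pushforward lebesgue_measure ((fun t => (t + a)%R) : R -> measurableTypeR R)]_x f x)%E.
  by rewrite ge0_integral_pushforward// preimage_setT.
apply: eq_measure_integral => A mA _; apply/esym.
apply: lebesgue_measure_unique => //= _ [[b c]] _ <-.
rewrite /pushforward.
have -> : ((fun t => (t + a)%R) : R -> measurableTypeR R) @^-1` `]b, c] = `]b - a, c - a]%classic.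
  by apply/seteqP; split=> t /=; rewrite !in_itv/= ltrBlDr lerBrDr.
by rewrite !lebesgue_measure_itv/= !lte_fin ltrD2r -!EFinD opprB addrA subrK.
Qed.

Lemma consrVD n (t : R) (y : 'rV[R]_n) (z : 'rV[R]_n.+1) :
  consrV (t, y) + z = consrV (t + z ord0 ord0, y + \row_i z ord0 (lift ord0 i)).
Proof.
apply/rowP => i; rewrite mxE; case: (unliftP ord0 i) => [j|] ->.
  by rewrite !consrVS/= !mxE.
by rewrite !consrV0.
Qed.

Lemma ge0_integral_shift n (z : 'rV[R]_n) (f : 'rV[R]_n -> \bar R) :
  measurable_fun setT f -> (forall x, 0 <= f x)%E ->
  (\int[lebesgue_rV n]_x f (x + z)%R = \int[lebesgue_rV n]_x f x)%E.
Proof.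
elim: n z f => [|n IH] z f mf f0.
  by apply: eq_integral => x _; congr f; apply/rowP => -[].
have mfc t : measurable_fun setT (fun y => f (consrV (t, y))).
  apply: (measurableT_comp mf); apply: (measurableT_comp (@measurable_consrV R n)).
  exact: measurable_pair1.
have mfz : measurable_fun setT (fun x : 'rV[R]_n.+1 => f (x + z)).
  by apply: (measurableT_comp mf); exact: measurable_addrV.
rewrite (tonelli_rV mfz); last by move=> x; exact: f0.
rewrite (tonelli_rV mf f0).
under eq_integral => t _ do under eq_integral => y _ do rewrite consrVD.
under eq_integral => t _ do rewrite (IH _ (fun y => f (consrV (t + z ord0 ord0, y))))//.
rewrite (@ge0_integral_shift1 (z ord0 ord0) (fun t => \int[lebesgue_rV n]_y f (consrV (t, y)))%E)//.
  apply: (measurable_fun_fubini_tonelli_F (f \o @consrV R n)) => //.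
  - by apply: (measurableT_comp mf); exact: measurable_consrV.
  - by move=> x; exact: f0.
by move=> t; apply: integral_ge0 => y _; exact: f0.
Qed.

(* dominates the Gaussian integrands, uniformly in bounded translations *)
Definition weight n (y : 'rV[R]_n) : R := \prod_i (1 + y ord0 i ^+ 2)^-1.

Lemma weight_ge0 n (y : 'rV[R]_n) : 0 <= weight y.
Proof. by apply: prodr_ge0 => i _; rewrite invr_ge0 addr_ge0// sqr_ge0. Qed.

Lemma measurable_weight n : measurable_fun setT (@weight n : _ -> measurableTypeR R).
Proof.
apply: measurable_prod => i _.
apply: (measurableT_comp (f := fun t : R => (1 + t ^+ 2)^-1)); last exact: measurable_coor.
apply: continuous_measurable_fun => t; apply: continuous_oneDsqrV.
Qed.

(** Tonelli splits off one factor 1 / (1 + t^2) at a time. The induction starts in dimension 0,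
    where the measure is a Dirac mass. *)
Lemma integrable_weight n : (@lebesgue_rV R n).-integrable setT (EFin \o @weight n).
Proof.
apply/integrableP; split; first by apply/measurable_EFinP; exact: measurable_weight.
under eq_integral do rewrite /= ger0_norm ?weight_ge0//.
elim: n => [|n IH].
  have H := @integral_dirac _ _ (0 : 'rV[R]_0) R setT measurableT (EFin \o @weight 0).
  rewrite /= H; last by apply/measurable_EFinP; exact: measurable_weight.
  by rewrite diracT mul1e ltry.
rewrite tonelli_rV; first last.
- by move=> x; rewrite lee_fin weight_ge0.
- by apply/measurable_EFinP; exact: measurable_weight.
have h t (y : 'rV[R]_n) : (weight (consrV (t, y)) = (1 + t ^+ 2)^-1 * weight y)%R.
  rewrite /weight big_ord_recl consrV0; congr (_ * _)%R.
  by apply: eq_bigr => i _; rewrite consrVS.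
under eq_integral => t _ do under eq_integral => y _ do rewrite h EFinM.
under eq_integral => t _.
  rewrite ge0_integralZl//; first over.
  - by apply/measurable_EFinP; exact: measurable_weight.
  - by move=> y _; rewrite lee_fin weight_ge0.
  - by rewrite lee_fin invr_ge0 addr_ge0 ?sqr_ge0.
rewrite ge0_integralZr//.
- apply: lte_mul_pinfty => //.
  + by apply: integral_ge0 => t _; rewrite lee_fin invr_ge0 addr_ge0 ?sqr_ge0.
  + rewrite ge0_fin_numE; last by apply: integral_ge0 => t _; rewrite lee_fin invr_ge0 addr_ge0 ?sqr_ge0.
    rewrite ge0_symfun_integralT//=.
    * rewrite (_ : [set x | _] = `[0, +oo[%classic); last first.
        by apply/seteqP; split => x/=; rewrite in_itv/= andbT.
      by rewrite integral0y_oneDsqr -EFinM ltry.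
    * by move=> x; rewrite invr_ge0 addr_ge0 ?sqr_ge0.
    * by move=> x; exact: continuous_oneDsqrV.
    * by move=> x /=; rewrite sqrrN.
- apply/measurable_EFinP; apply: measurable_realfun.continuous_measurable_fun => t; exact: continuous_oneDsqrV.
- by move=> t _; rewrite lee_fin invr_ge0 addr_ge0 ?sqr_ge0.
- by apply: integral_ge0 => y _; rewrite lee_fin weight_ge0.
Qed.

Lemma Rintegral_shift n (z : 'rV[R]_n) (f : 'rV[R]_n -> R) :
  measurable_fun setT f ->
  \int[lebesgue_rV n]_x f (x + z) = \int[lebesgue_rV n]_x f x.
Proof.
move=> mf; rewrite /Rintegral [in LHS]integralE [in RHS]integralE.
have mF : measurable_fun setT (EFin \o f) by exact/measurable_EFinP.
rewrite -[in RHS](ge0_integral_shift z (measurable_funepos mF))//.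
rewrite -[X in _ = fine (_ - X)%E](ge0_integral_shift z (measurable_funeneg mF))//.
by congr (fine (_ - _)); apply: eq_integral => x _; rewrite ?funeposE ?funenegE.
Qed.

End rV_borel.

(** * Functions with bounded derivatives *)

Section calculus_lemmas.
Context {R : realType} {N : nat}.
Implicit Types (f g : 'rV[R]_N -> R) (i : 'I_N) (k : nat).

Local Notation e_ i := (delta_mx ord0 i : 'rV[R]_N).

Lemma is_derive_line f (x v : 'rV[R]_N) (t : R) : derivable f (x + t *: v) v ->
  is_derive t 1 (fun s => f (x + s *: v)) ('D_v f (x + t *: v)).
Proof.
move=> df.
have E : (fun h : R => h^-1 *: (((fun s => f (x + s *: v)) \o shift t) (h *: 1) - f (x + t *: v)))
   = (fun h : R => h^-1 *: ((f \o shift (x + t *: v)) (h *: v) - f (x + t *: v))).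
  apply/funext => h /=; rewrite [h *: 1]mulr1; congr (_ *: (f _ - _)).
  by rewrite scalerDl addrCA.
apply: DeriveDef; first by rewrite /derivable E.
by rewrite /derive E.
Qed.

(** Converse of [is_derive_line]: it reduces a partial derivative to a one-variable one, for which
    the chain rule is at hand. *)
Lemma derive_line f (x v : 'rV[R]_N) d :
  is_derive (0 : R) 1 (fun s => f (x + s *: v)) d -> is_derive x v f d.
Proof.
move=> [df <-].
have E : (fun h : R => h^-1 *: (((fun s => f (x + s *: v)) \o shift 0) (h *: 1) - f (x + 0 *: v)))
   = (fun h : R => h^-1 *: ((f \o shift x) (h *: v) - f x)).
  apply/funext => h /=; rewrite [h *: 1]mulr1 addr0 scale0r addr0.
  by rewrite (addrC x).
apply: DeriveDef; first by rewrite /derivable -E.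
by rewrite /derive -E.
Qed.

Lemma mvt_abs (p p' : R -> R) (a b L : R) :
  (forall t : R, is_derive t 1 p (p' t)) ->
  (forall t, `|t - a| <= `|b - a| -> `|p' t| <= L) ->
  `|p b - p a| <= L * `|b - a|.
Proof.
move=> dp bp.
have cp (c d : R) : {within `[c, d], continuous p}.
  apply: derivable_within_continuous => t _; exact: ex_derive.
have [ab|/ltW ba] := leP a b.
  have [c] := MVT_segment ab (fun x _ => dp x) (cp a b).
  rewrite in_itv/= => /andP[ac cb] ->; rewrite normrM ler_wpM2r//.
  by apply: bp; rewrite !ger0_norm ?subr_ge0// lerD2r.
have [c] := MVT_segment ba (fun x _ => dp x) (cp b a).
rewrite in_itv/= => /andP[bc ca] E; rewrite distrC E normrM (distrC a) ler_wpM2r//.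
by apply: bp; rewrite !ler0_norm ?subr_le0// lerN2 lerD2r.
Qed.

(** The coordinates of x are replaced by those of y one after the other, with the one-variable mean
    value inequality on each segment. The path never leaves the box on which the partial derivatives
    are assumed bounded; this localisation is what [bCoo_taylor] exploits. *)
Lemma mvt_path f (x y : 'rV[R]_N) (L : R) :
  (forall i w, derivable f w (e_ i)) ->
  (forall i (w : 'rV[R]_N), (forall j, `|w ord0 j - x ord0 j| <= `|y ord0 j - x ord0 j|) ->
     `|partial i f w| <= L) ->
  `|f y - f x| <= L * \sum_i `|y ord0 i - x ord0 i|.
Proof.
move=> df bf.
pose z n : 'rV[R]_N := \row_i (if (i < n)%N then y ord0 i else x ord0 i).
have z0 : z 0%N = x by apply/rowP => i; rewrite mxE.
have zN : z N = y by apply/rowP => i; rewrite mxE ltn_ord.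
suff H n : (n <= N)%N -> `|f (z n) - f x| <= L * \sum_(i < N | (i < n)%N) `|y ord0 i - x ord0 i|.
  have := H N (leqnn _); rewrite zN => /le_trans; apply.
  rewrite le_eqVlt; apply/orP; left; apply/eqP; congr (_ * _).
  by apply: eq_bigl => i; rewrite ltn_ord.
elim: n => [|n IH] nN; first by rewrite z0 subrr normr0 big_pred0 ?mulr0.
pose j := Ordinal nN.
rewrite (bigD1 j)//= mulrDr.
have -> : f (z n.+1) - f x = (f (z n.+1) - f (z n)) + (f (z n) - f x) by rewrite addrA subrK.
apply: (le_trans (ler_normD _ _)); apply: lerD; last first.
  apply: (le_trans (IH (ltnW nN))); rewrite le_eqVlt; apply/orP; left; apply/eqP.
  congr (_ * _); apply: eq_bigl => i.
  by rewrite ltnS -(inj_eq val_inj)/= andbC ltn_neqAle.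
have zS : z n.+1 = z n + (y ord0 j - x ord0 j) *: e_ j.
  apply/rowP => i; rewrite !mxE eqxx/=.
  have [->|ij] := eqVneq i j; first by rewrite /= ltnS leqnn ltnn mulr1 addrC subrK.
  rewrite mulr0 addr0 ltnS leq_eqVlt.
  by have /negPf -> : (i : nat) != n by rewrite -(inj_eq val_inj) in ij.
have := @mvt_abs (fun s => f (z n + s *: e_ j)) (fun s => partial j f (z n + s *: e_ j)) 0
  (y ord0 j - x ord0 j) L (fun t => is_derive_line (df j _)).
rewrite scale0r addr0 -zS subr0; apply => t; rewrite subr0 => tb.
apply: bf => i; rewrite !mxE eqxx/=.
have [->|ij] := eqVneq i j; first by rewrite /= ltnn mulr1 addrAC subrr add0r.
by rewrite mulr0 addr0; case: ifP => // _; rewrite subrr normr0.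
Qed.

Lemma lipschitz_continuous f (L : R) :
  (forall x y, `|f y - f x| <= L * \sum_i `|y ord0 i - x ord0 i|) -> continuous f.
Proof.
move=> lf x A /nbhs_ballP[e /= e0 eA].
(* [+ 1] and [N.+1] keep the divisor positive when L <= 0 or N = 0. *)
have K0 : 0 < (`|L| + 1) * N.+1%:R by rewrite mulr_gt0// ltr_wpDl.
apply/nbhs_rVP; exists (e / ((`|L| + 1) * N.+1%:R)); first by rewrite divr_gt0.
move=> y hy; apply: eA; rewrite -ball_normE /= distrC.
apply: (le_lt_trans (lf x y)).
apply: (@le_lt_trans _ _ ((`|L| + 1) * \sum_(i < N) e / ((`|L| + 1) * N.+1%:R))).
  apply: (@le_trans _ _ ((`|L| + 1) * \sum_i `|y ord0 i - x ord0 i|)).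
    by rewrite ler_wpM2r ?sumr_ge0// (le_trans (ler_norm _))// lerDl.
  rewrite ler_wpM2l ?addr_ge0//.
  by apply: ler_sum => i _; rewrite distrC; exact/ltW/hy.
rewrite sumr_const card_ord -(mulr_natl _ N).
have L0 : `|L| + 1 != 0 by rewrite gt_eqF// ltr_wpDl.
have N0 : (N.+1%:R : R) != 0 by rewrite pnatr_eq0.
rewrite (_ : (`|L| + 1) * (N%:R * _) = e * (N%:R / N.+1%:R)); last first.
  move: N0 L0; move: (N.+1%:R : R) (`|L| + 1) => m l m0 l0; field; exact/andP.
by rewrite gtr_pMr// ltr_pdivrMr// mul1r ltr_nat.
Qed.

Lemma partialD i f g : (forall x, derivable f x (e_ i)) ->
  (forall x, derivable g x (e_ i)) ->
  partial i (fun x => f x + g x) = (fun x => partial i f x + partial i g x).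
Proof. by move=> df dg; apply/funext => x; rewrite /partial deriveD. Qed.

Lemma partialM i f g : (forall x, derivable f x (e_ i)) ->
  (forall x, derivable g x (e_ i)) ->
  partial i (fun x => f x * g x) = (fun x => f x * partial i g x + partial i f x * g x).
Proof.
move=> df dg; apply/funext => x; rewrite /partial deriveM//.
by congr (_ + _); exact: mulrC.
Qed.

Lemma partial_cst i (c : R) : partial i (fun=> c) = fun=> 0.
Proof. by apply/funext => x; rewrite /partial derive_cst. Qed.

Lemma partialZ i (c : R) f : (forall x, derivable f x (e_ i)) ->
  partial i (fun x => c * f x) = (fun x => c * partial i f x).
Proof.
by move=> df; apply/funext => x; rewrite /partial deriveZ.
Qed.

(** Continuity is not part of the definition: bounded first partial derivatives give a Lipschitz
    bound, hence continuity ([bC1_continuous]). The class is stable under products, partial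
    derivatives and averages of translates; resolvents of test functions stay in it although they
    lose compact support. *)
Fixpoint bCk k f : Prop :=
  (exists M : R, forall x, `|f x| <= M) /\
  match k with
  | 0 => True
  | k'.+1 => forall i, (forall x, derivable f x (e_ i)) /\ bCk k' (partial i f)
  end.

Definition bCoo f := forall k, bCk k f.

Lemma bCk_bounded k f : bCk k f -> exists M : R, forall x, `|f x| <= M.
Proof. by case: k => [|k] []. Qed.

Lemma bCkW k f : bCk k.+1 f -> bCk k f.
Proof.
elim: k f => [|k IH] f; first by case.
by move=> [Mf H]; split=> // i; have [? ?] := H i; split=> //; exact: IH.
Qed.

Lemma bCk_cst k (c : R) : bCk k (fun=> c).
Proof.
elim: k c => [|k IH] c; split=> //; try by exists `|c|.
by move=> i; rewrite partial_cst; split.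
Qed.

Lemma bCkD k f g : bCk k f -> bCk k g -> bCk k (fun x => f x + g x).
Proof.
elim: k f g => [|k IH] f g [[M Mf] H] [[M' Mg] H']; (split;
  first by exists (M + M') => x; rewrite (le_trans (ler_normD _ _))// lerD) => // i.
have [df Hf] := H i; have [dg Hg] := H' i.
by split; [move=> x; exact: derivableD|rewrite partialD//; exact: IH].
Qed.

Lemma bCkM k f g : bCk k f -> bCk k g -> bCk k (fun x => f x * g x).
Proof.
elim: k f g => [|k IH] f g Hf Hg.
  have [[M Mf] _] := Hf; have [[M' Mg] _] := Hg.
  by split=> //; exists (M * M') => x; rewrite normrM ler_pM.
split.
  have [M Mf] := bCk_bounded Hf; have [M' Mg] := bCk_bounded Hg.
  by exists (M * M') => x; rewrite normrM ler_pM.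
move=> i; have [df dHf] := Hf.2 i; have [dg dHg] := Hg.2 i.
split; first by move=> x; exact: derivableM.
by rewrite partialM//; apply: bCkD; apply: IH => //; exact: bCkW.
Qed.

Lemma bCoo_cst c : bCoo (fun=> c).
Proof. by move=> k; exact: bCk_cst. Qed.

Lemma bCooD f g : bCoo f -> bCoo g -> bCoo (fun x => f x + g x).
Proof. by move=> ? ? k; exact: bCkD. Qed.

Lemma bCooM f g : bCoo f -> bCoo g -> bCoo (fun x => f x * g x).
Proof. by move=> ? ? k; exact: bCkM. Qed.

Lemma bCooZ c f : bCoo f -> bCoo (fun x => c * f x).
Proof. by move=> ?; apply: bCooM => //; exact: bCoo_cst. Qed.

Lemma bCoo_sum (I : Type) (r : seq I) (F : I -> 'rV[R]_N -> R) :
  (forall j, bCoo (F j)) -> bCoo (fun x => \sum_(j <- r) F j x).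
Proof.
move=> bF; elim: r => [|j r IH].
  by under eq_fun do rewrite big_nil; exact: bCoo_cst.
by under eq_fun do rewrite big_cons; exact: bCooD.
Qed.

Lemma bCoo_prod (I : Type) (r : seq I) (F : I -> 'rV[R]_N -> R) :
  (forall j, bCoo (F j)) -> bCoo (fun x => \prod_(j <- r) F j x).
Proof.
move=> bF; elim: r => [|j r IH].
  by under eq_fun do rewrite big_nil; exact: bCoo_cst.
by under eq_fun do rewrite big_cons; exact: bCooM.
Qed.

Lemma bCoo_partial i f : bCoo f -> bCoo (partial i f).
Proof. by move=> bf k; have [_ /(_ i)[]] := bf k.+1. Qed.

Lemma bCoo_derivable i f x : bCoo f -> derivable f x (e_ i).
Proof. by move=> bf; have [_ /(_ i)[]] := bf 1%N. Qed.

Lemma bCoo_bounded f : bCoo f -> exists M : R, forall x, `|f x| <= M.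
Proof. by move=> bf; have [] := bf 0%N. Qed.

Lemma bCoo_partials s f : bCoo f -> bCoo (partials s f).
Proof. by move=> bf; elim: s => //= i s IH; exact: bCoo_partial. Qed.

Lemma bC1_lipschitz f : bCk 1 f -> exists2 L : R, 0 <= L &
  forall x y, `|f y - f x| <= L * \sum_i `|y ord0 i - x ord0 i|.
Proof.
move=> bf.
have hb i : exists M : R, forall x, `|partial i f x| <= M by exact: (bf.2 i).2.1.
pose M i := projT1 (cid (hb i)); have HM i x : `|partial i f x| <= M i.
  by rewrite /M; case: cid.
have M0 i : 0 <= M i by exact: le_trans (HM i 0).
exists (\sum_i M i); first by apply: sumr_ge0 => i _; exact: M0.
move=> x y; apply: mvt_path; first by move=> i w; have [] := bf.2 i.
move=> i w _; apply: (le_trans (HM i w)).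
by rewrite (bigD1 i)//= lerDl sumr_ge0.
Qed.

Lemma bC1_continuous f : bCk 1 f -> continuous f.
Proof. by move=> /bC1_lipschitz[L _]; exact: lipschitz_continuous. Qed.

Lemma bCoo_continuous f : bCoo f -> continuous f.
Proof. by move=> bf; exact: bC1_continuous. Qed.

Lemma bCoo_measurable f : bCoo f -> measurable_fun setT (f : _ -> measurableTypeR R).
Proof. by move=> /bCoo_continuous; exact: continuous_measurable_rV. Qed.

Lemma bCoo_Ck k f : bCoo f -> Ck k f.
Proof.
elim: k f => [|k IH] f bf /=; first exact: bCoo_continuous.
split; first exact: bCoo_continuous.
by move=> i; split; [move=> x; exact: bCoo_derivable|apply/IH/bCoo_partial].
Qed.

(** [mvt_path] is applied to f minus its linear part at x. The partial derivatives of the difference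
    vanish at x and are Lipschitz, so on the box they are of the order of its size, which gives the
    quadratic remainder. *)
Lemma bCoo_taylor f x : bCoo f -> exists2 K : R, 0 <= K & forall z,
  `|f (x + z) - f x - \sum_i z ord0 i * partial i f x| <= K * (\sum_i `|z ord0 i|) ^+ 2.
Proof.
move=> bf.
have hb i : exists2 L : R, 0 <= L &
    forall x y, `|partial i f y - partial i f x| <= L * \sum_i `|y ord0 i - x ord0 i|.
  by apply: bC1_lipschitz; exact: bCoo_partial.
pose L i := projT1 (cid2 (hb i)).
have L0 i : 0 <= L i by rewrite /L; case: cid2.
have HL i y w : `|partial i f w - partial i f y| <= L i * \sum_i `|w ord0 i - y ord0 i|.
  by rewrite /L; case: cid2.
exists (\sum_i L i); first by apply: sumr_ge0 => i _; exact: L0.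
move=> z.
pose c i := partial i f x.
pose g := fun w : 'rV[R]_N => f w - \sum_i w ord0 i * c i.
have dcoor i j (w : 'rV[R]_N) : is_derive w (e_ i) (fun w : 'rV[R]_N => w ord0 j) (i == j)%:R.
  apply: derive_line.
  rewrite (_ : (fun _ => _) = fun s => w ord0 j + s * (i == j)%:R); last first.
    by apply/funext => s; rewrite !mxE eqxx eq_sym.
  by apply: is_derive_eq; rewrite /GRing.scale/=; ring.
have dg i w : is_derive w (e_ i) g (partial i f w - c i).
  have df : is_derive w (e_ i) f (partial i f w).
    by apply: DeriveDef => //; exact: bCoo_derivable.
  have ds : is_derive w (e_ i) (fun w : 'rV[R]_N => \sum_j w ord0 j * c j) (c i).
    rewrite (_ : (fun w0 => _) = \sum_j (fun w : 'rV[R]_N => w ord0 j * c j)); last first.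
      by apply/funext => y; rewrite fct_sumE.
    have dj j : is_derive w (e_ i) (fun w : 'rV[R]_N => w ord0 j * c j) ((i == j)%:R * c j).
      by have := dcoor i j w => ?; apply: is_derive_eq; rewrite /GRing.scale/=; ring.
    apply: (is_derive_eq (is_derive_sum dj)).
    rewrite (bigD1 i)//= eqxx mul1r big1 ?addr0// => j /negPf.
    by rewrite eq_sym => ->; rewrite mul0r.
  exact: is_deriveB.
have := @mvt_path g x (x + z) ((\sum_i L i) * \sum_i `|z ord0 i|).
have -> : g (x + z) - g x = f (x + z) - f x - \sum_i z ord0 i * partial i f x.
  rewrite /g (_ : \sum_i (x + z) ord0 i * c i = \sum_i x ord0 i * c i + \sum_i z ord0 i * c i).
    by rewrite /c; ring.
  by rewrite -big_split; apply: eq_bigr => i _; rewrite mxE mulrDl.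
have xzx i : (x + z) ord0 i - x ord0 i = z ord0 i by rewrite mxE addrAC subrr add0r.
have -> : \sum_i `|(x + z) ord0 i - x ord0 i| = \sum_i `|z ord0 i|.
  by apply: eq_bigr => i _; rewrite xzx.
rewrite expr2 mulrA; apply; first by move=> i w; exact: ex_derive.
move=> i w wz; rewrite /partial derive_val.
apply: (le_trans (HL i x w)).
apply: (@le_trans _ _ (L i * \sum_i `|z ord0 i|)).
  by apply: ler_wpM2l => //; apply: ler_sum => j _; rewrite -[in leRHS]xzx; exact: wz.
by rewrite ler_wpM2r ?sumr_ge0// (bigD1 i)//= lerDl sumr_ge0.
Qed.

Lemma bCoo_is_derive f (x v : 'rV[R]_N) : bCoo f ->
  is_derive x v f (\sum_i v ord0 i * partial i f x).
Proof.
move=> /(bCoo_taylor x)[K K0 H].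
suff cv : (fun h => h^-1 *: ((f \o shift x) (h *: v) - f x)) @ (0 : R)^' -->
    (\sum_i v ord0 i * partial i f x).
  by apply: DeriveDef; [apply/cvg_ex; eexists; exact: cv|exact/cvg_lim].
apply/subr_cvg0; apply: (@cvg_to_0_linear _ _ (K * (\sum_i `|v ord0 i|) ^+ 2) 1) => // h /andP[h0 _].
rewrite normr_gt0 in h0.
have := H (h *: v).
under eq_bigr do rewrite mxE -mulrA.
under [X in _ <= K * X ^+ 2]eq_bigr do rewrite mxE normrM.
rewrite -!mulr_sumr => H'.
rewrite /= [h *: v + x]addrC.
set S := \sum_(i < N) v ord0 i * _ in H' *.
have -> : h^-1 *: (f (x + h *: v) - f x) - S = h^-1 * (f (x + h *: v) - f x - h * S).
  by rewrite mulrBr mulKf.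
rewrite normrM normfV ler_pdivrMl ?normr_gt0//.
by apply: (le_trans H'); rewrite exprMn [X in X <= _](_ : _ = `|h| * (K * (\sum_(i < N) `|v ord0 i|) ^+ 2 * `|h|)) ?lexx//; ring.
Qed.

Lemma bCoo_is_derive_line f (x v : 'rV[R]_N) (t : R) : bCoo f ->
  is_derive t 1 (fun s => f (x + s *: v)) (\sum_i v ord0 i * partial i f (x + t *: v)).
Proof.
move=> bf; have [df <-] := bCoo_is_derive (x + t *: v) v bf.
exact: is_derive_line.
Qed.

End calculus_lemmas.

(** * Test functions *)

Section bump_functions.
Context {R : realType}.

(* [flat 0] is the smooth function e^{-1/y}; its derivatives are combinations
   of the other [flat n] *)
Definition flat (n : nat) (y : R) : R := if 0 < y then y ^- n * expR (- y^-1) else 0.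

Lemma flat_ge0 n y : 0 <= flat n y.
Proof. by rewrite /flat; case: ifP => // y0; rewrite mulr_ge0 ?expR_ge0// invr_ge0 exprn_ge0// ltW. Qed.

(** With s = 1 / y the bound is s^n <= n! e^s, a single term of the exponential series. *)
Lemma flat_le n y : flat n y <= n`!%:R.
Proof.
rewrite /flat; case: ifPn => // y0.
rewrite expRN ler_pdivrMr ?expR_gt0// -exprVn.
have : 0 <= y^-1 by rewrite invr_ge0 ltW.
move: (y^-1) => s s0; case: n => [|n].
  by rewrite expr0 mul1r; apply: le_trans (expR_ge1Dx _); rewrite lerDl.
have := expR_ge1Dxn n s0; rewrite -ler_pdivrMl ?ltr0n ?fact_gt0// mulrC.
by apply: le_trans; rewrite lerDr.
Qed.

Lemma is_derive_exprn (f : R -> R) (n : nat) (x df : R) : is_derive x 1 f df ->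
  is_derive x 1 (fun t => f t ^+ n) (n%:R * f x ^+ n.-1 * df).
Proof. by move=> df'; have := is_deriveX n df'; rewrite exprfctE. Qed.

Lemma is_derive_flat n (y : R) :
  is_derive y 1 (flat n) (- n%:R * flat n.+1 y + flat n.+2 y).
Proof.
have [y0|y0|y0] := ltgtP y 0.
- apply: (near_eq_is_derive (f := cst 0)).
    near=> z; rewrite /flat ltNge ltW//.
    by near: z; exact: lt_nbhsl.
  apply: is_derive_eq.
  by rewrite /flat (lt_gtF y0) mulr0 addr0.
- apply: (near_eq_is_derive (f := fun z : R => (z^-1) ^+ n * expR (- z^-1) : R)).
    near=> z; have z0 : 0 < z by near: z; exact: lt_nbhsr.
    by rewrite /flat z0 exprVn.
  have dV : is_derive y 1 (fun z : R => z^-1) (- y ^- 2).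
    by apply: is_derive_eq (is_deriveV _ (is_derive_id _ _)) _; [rewrite gt_eqF|rewrite [LHS]mulr1].
  have dN : is_derive y 1 (fun z : R => - z^-1) (y ^- 2).
    by apply: is_derive_eq; rewrite opprK.
  have dE : is_derive y 1 (fun z : R => expR (- z^-1)) (expR (- y^-1) * y ^- 2).
    exact: (is_derive1_comp (is_derive_expR _)).
  have dX := is_derive_exprn n dV.
  apply: is_derive_eq.
  rewrite /flat y0 -!exprVn /GRing.scale /=.
  case: n {dX} => [|n] /=; first by rewrite !expr0; ring.
  by rewrite !exprS; ring.
- rewrite y0 {2 3}/flat ltxx mulr0 addr0.
  suff cv : (fun h => h^-1 *: ((flat n \o shift 0) (h *: 1) - flat n 0)) @ (0 : R)^' --> (0 : R).
    by apply: DeriveDef; [apply/cvg_ex; eexists; exact: cv|exact/cvg_lim].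
  (* For h > 0 the difference quotient at 0 is [flat n h] / h = h [flat n.+2 h], so [flat_le] bounds
     it by (n + 2)! |h|; for h < 0 it vanishes. *)
  apply: (@cvg_to_0_linear _ _ (n.+2)`!%:R 1) => // h /andP[h0 _].
  rewrite /= [h *: 1]mulr1 addr0 {2}/flat ltxx subr0.
  rewrite [`| _ |]normrM normfV -(ger0_norm (flat_ge0 n h)) normr_id.
  have := flat_le n.+2 h; rewrite /flat; case: ifPn => hp H; last by rewrite normr0 mulr0 mulr_ge0.
  rewrite normrM !gtr0_norm// ?expR_gt0 ?invr_gt0 ?exprn_gt0//.
  rewrite -ler_pdivrMr//; apply: le_trans H.
  rewrite [leLHS](_ : _ = h ^- n.+2 * expR (- h^-1)) ?lexx// -!exprVn !exprS; ring.
Unshelve. all: end_near. Qed.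

(** One-variable analogue of [bCk], with the derivative supplied as a witness: the derivatives of
    the functions in [bCk1_flat] are explicit combinations of functions of the same family. *)
Fixpoint bCk1 k (f : R -> R) : Prop :=
  (exists M : R, forall x, `|f x| <= M) /\
  match k with
  | 0 => True
  | k'.+1 => exists2 f', forall x : R, is_derive x 1 f (f' x) & bCk1 k' f'
  end.

Lemma bCk1D k f g : bCk1 k f -> bCk1 k g -> bCk1 k (fun x => f x + g x).
Proof.
elim: k f g => [|k IH] f g [[M Mf] H] [[M' Mg] H']; (split;
  first by exists (M + M') => x; rewrite (le_trans (ler_normD _ _))// lerD) => //.
have [f' df Hf] := H; have [g' dg Hg] := H'.
by exists (fun x => f' x + g' x); [move=> x; exact: is_deriveD|exact: IH].
Qed.

Lemma bCk1Z k c f : bCk1 k f -> bCk1 k (fun x => c * f x).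
Proof.
elim: k f => [|k IH] f [[M Mf] H]; (split;
  first by exists (`|c| * M) => x; rewrite normrM ler_wpM2l) => //.
have [f' df Hf] := H.
exists (fun x => c * f' x); last exact: IH.
by move=> x; have := df x => ?; apply: is_derive_eq; rewrite /GRing.scale/=; ring.
Qed.

(** The span of these functions over all j and n is stable under differentiation, because the inner
    quadratic has a derivative affine in t; this is why the power t^j is carried along. It stays
    bounded since the other factor vanishes unless t lies between a and b. *)
Lemma bCk1_flat k j n (m a b : R) : 0 < m ->
  bCk1 k (fun t => t ^+ j * flat n (m * (t - a) * (b - t))).
Proof.
move=> m0; elim: k j n => [|k IH] j n; split=> //;
    try (exists ((`|a| + `|b|) ^+ j * n`!%:R) => t).
- rewrite normrM; have [q0|q0] := ltP 0 (m * (t - a) * (b - t)).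
    apply: ler_pM => //; last by rewrite ger0_norm ?flat_ge0 ?flat_le.
    rewrite normrX lerXn2r ?nnegrE ?addr_ge0//.
    move: q0; rewrite -mulrA pmulr_rgt0// => q0.
    have := ler_normlP _ _ (lexx `|a|); have := ler_normlP _ _ (lexx `|b|).
    move=> [b1 b2] [a1 a2]; have := normr_ge0 a; have := normr_ge0 b.
    rewrite ler_norml; move: (`|a|) (`|b|) a1 a2 b1 b2 => a' b' a1 a2 b1 b2 b0 a0.
    have [ta|ta] := leP t a.
      have tb : b <= t by nra.
      by apply/andP; split; lra.
    have tb : t <= b by nra.
    by apply/andP; split; lra.
  by rewrite /flat ltNge q0/= normr0 mulr0 mulr_ge0// exprn_ge0 ?addr_ge0.
- rewrite normrM; have [q0|q0] := ltP 0 (m * (t - a) * (b - t)).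
    apply: ler_pM => //; last by rewrite ger0_norm ?flat_ge0 ?flat_le.
    rewrite normrX lerXn2r ?nnegrE ?addr_ge0//.
    move: q0; rewrite -mulrA pmulr_rgt0// => q0.
    have := ler_normlP _ _ (lexx `|a|); have := ler_normlP _ _ (lexx `|b|).
    move=> [b1 b2] [a1 a2]; have := normr_ge0 a; have := normr_ge0 b.
    rewrite ler_norml; move: (`|a|) (`|b|) a1 a2 b1 b2 => a' b' a1 a2 b1 b2 b0 a0.
    have [ta|ta] := leP t a.
      have tb : b <= t by nra.
      by apply/andP; split; lra.
    have tb : t <= b by nra.
    by apply/andP; split; lra.
  by rewrite /flat ltNge q0/= normr0 mulr0 mulr_ge0// exprn_ge0 ?addr_ge0.
- pose Q t := m * (t - a) * (b - t).
  exists (fun t => j%:R * (t ^+ j.-1 * flat n (Q t)) +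
    ((- n%:R * (m * (a + b)) * (t ^+ j * flat n.+1 (Q t))
      + 2 * n%:R * m * (t ^+ j.+1 * flat n.+1 (Q t))) +
     (m * (a + b) * (t ^+ j * flat n.+2 (Q t))
      + - 2 * m * (t ^+ j.+1 * flat n.+2 (Q t))))).
    move=> t.
    have dQ : is_derive t 1 Q (m * (a + b) - 2 * m * t).
      by apply: is_derive_eq; rewrite /GRing.scale/=; ring.
    have dX : is_derive t 1 (fun t : R => t ^+ j) (j%:R * t ^+ j.-1).
      by apply: (is_derive_eq (is_derive_exprn j (is_derive_id t 1))); rewrite mulr1.
    have dF : is_derive t 1 (fun t => flat n (m * (t - a) * (b - t)))
        ((- n%:R * flat n.+1 (Q t) + flat n.+2 (Q t)) * (m * (a + b) - 2 * m * t)).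
      exact: is_derive1_comp (is_derive_flat n (Q t)) dQ.
    apply: is_derive_eq.
    by rewrite /GRing.scale/= exprS; ring.
  do 3 ?apply: bCk1D; apply: bCk1Z; exact: IH.
Qed.

Lemma bCk_coor N k (f : R -> R) (i : 'I_N) :
  bCk1 k f -> bCk k (fun x : 'rV[R]_N => f (x ord0 i)).
Proof.
elim: k f => [|k IH] f [[M Mf] H]; (split; first by exists M => x) => //= j.
have [f' df Hf] := H.
have dj (x : 'rV[R]_N) : is_derive x (delta_mx ord0 j) (fun x : 'rV[R]_N => f (x ord0 i))
    ((i == j)%:R * f' (x ord0 i)).
  apply: derive_line.
  rewrite (_ : (fun _ => _) = f \o (fun s => x ord0 i + s * (i == j)%:R)); last first.
    by apply/funext => s; rewrite /= !mxE eqxx.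
  rewrite mulrC; apply: is_derive1_comp.
    by rewrite mul0r addr0; exact: df.
  by apply: is_derive_eq; rewrite /GRing.scale/=; ring.
split; first by move=> x; exact: ex_derive.
rewrite (_ : partial j _ = fun x => (i == j)%:R * f' (x ord0 i)); last first.
  by apply/funext => x; rewrite /partial derive_val.
by apply: bCkM; [exact: bCk_cst|exact: IH].
Qed.

Section bump.
Context {N : nat}.
Implicit Types (x a b : 'rV[R]_N).

(** The parameter m serves twice: letting it grow makes the bump tend to the indicator of the open
    box, and m = H^2 makes the bump of a cube of half-side 1 / H an exact rescaling of a fixed
    one. *)
Definition bumpf (m : R) a b x : R :=
  \prod_i flat 0 (m * (x ord0 i - a ord0 i) * (b ord0 i - x ord0 i)).

Lemma bCoo_bumpf m a b : 0 < m -> bCoo (bumpf m a b).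
Proof.
move=> m0; apply: bCoo_prod => i k; apply: (@bCk_coor _ _ (fun t => flat 0 (m * (t - a ord0 i) * (b ord0 i - t)))).
have := @bCk1_flat k 0 0 m (a ord0 i) (b ord0 i) m0.
by under eq_fun do rewrite expr0 mul1r.
Qed.

Lemma bumpf_ge0 m a b x : 0 <= bumpf m a b x.
Proof. by apply: prodr_ge0 => i _; exact: flat_ge0. Qed.

Lemma bumpf_le1 m a b x : bumpf m a b x <= 1.
Proof.
by apply: prodr_ile1 => i _; rewrite flat_ge0/= -[leRHS]/(0`!%:R) flat_le.
Qed.

Lemma bumpf_out m a b x i : 0 < m -> a ord0 i < b ord0 i ->
  ~~ (a ord0 i < x ord0 i < b ord0 i) -> bumpf m a b x = 0.
Proof.
move=> m0 ab H; rewrite /bumpf (bigD1 i)//= {1}/flat ltNge -mulrA.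
rewrite pmulr_rle0// (_ : _ <= 0) ?mul0r//.
by move: H; rewrite negb_and -!leNgt => /orP[] H; nra.
Qed.

End bump.

Section test_functions.
Context {N : nat}.
Implicit Types f g : 'rV[R]_N -> R.

Lemma bounded_box_rV (M : R) : bounded_set [set x : 'rV[R]_N | forall i, `|x ord0 i| <= M].
Proof.
exists (Num.max M 0); split; first exact: num_real.
move=> y; rewrite gt_max => /andP[My y0] x /= H.
rewrite /Num.Def.normr /= mx_normrE; apply/bigmax_leP; split; first exact: ltW.
by move=> [i j] _ /=; rewrite (ord1 i); exact: le_trans (H j) (ltW My).
Qed.

Lemma test_functionP f : bCoo f ->
  (exists M : R, forall x, f x != 0 -> forall i, `|x ord0 i| <= M) -> test_function f.
Proof.
move=> bf [M H]; split; first by move=> k; exact: bCoo_Ck.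
have cB : closed [set x : 'rV[R]_N | forall i, `|x ord0 i| <= M].
  rewrite (_ : mkset _ = \bigcap_(i in [set: 'I_N]) [set x : 'rV[R]_N | `|x ord0 i| <= M]); last first.
    by apply/seteqP; split=> x /= Hx i; [move=> _; exact: Hx|exact: Hx i I].
  apply: closed_bigI => i _.
  apply: (@closed_comp _ _ (fun x : 'rV[R]_N => `|x ord0 i|) [set y | y <= M]); last exact: closed_le.
  move=> x _; apply: (@continuous_comp _ _ _ (fun x : 'rV[R]_N => x ord0 i)).
    exact: coord_continuous.
  exact: norm_continuous.
have sub : closure [set x | f x != 0] `<=` [set x : 'rV[R]_N | forall i, `|x ord0 i| <= M].
  have /closure_id E := cB; rewrite [X in _ `<=` X]E; apply: closure_subset => x; by move/H.
exact: subclosed_compact (@closed_closure _ _) (bounded_closed_compact (bounded_box_rV M) cB) sub.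
Qed.

Lemma test_function_support f : test_function f ->
  exists M : R, forall x, f x != 0 -> forall i, `|x ord0 i| <= M.
Proof.
move=> [_ /compact_bounded[M [_ H]]].
exists (M + 1) => x fx i.
have := H (M + 1); rewrite ltrDl ltr01 => /(_ isT x).
move=> /(_ (@subset_closure _ [set x | f x != 0] x fx)); apply: le_trans.
rewrite {2}/Num.Def.normr /= mx_normrE.
exact: (le_bigmax _ (fun ij => `|x ij.1 ij.2|) (ord0, i)).
Qed.

Lemma partial_eq0 f i (O : set 'rV[R]_N) : open O -> (forall x, O x -> f x = 0) ->
  forall x, O x -> partial i f x = 0.
Proof.
move=> oO f0 x Ox.
have d0 : is_derive x (delta_mx ord0 i) f 0.
  apply: (@near_eq_is_derive _ _ _ (cst (0 : R))).
  have : nbhs x O by exact: open_nbhs_nbhs.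
  by apply: filterS => y Oy; rewrite f0.
by rewrite /partial derive_val.
Qed.

Lemma partials_eq0 f s (O : set 'rV[R]_N) : open O -> (forall x, O x -> f x = 0) ->
  forall x, O x -> partials s f x = 0.
Proof.
by move=> oO f0; elim: s => //= i s IH; exact: partial_eq0.
Qed.

Lemma open_out_box (M : R) : open [set x : 'rV[R]_N | exists i, M < `|x ord0 i|].
Proof.
rewrite (_ : mkset _ = \bigcup_(i in [set: 'I_N]) [set x : 'rV[R]_N | M < `|x ord0 i|]).
  apply: bigcup_open => i _.
  apply: (@open_comp _ _ (fun x : 'rV[R]_N => `|x ord0 i|) [set y | M < y]); last exact: open_gt.
  move=> x _; apply: (@continuous_comp _ _ _ (fun x : 'rV[R]_N => x ord0 i)).
    exact: coord_continuous.
  exact: norm_continuous.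
by apply/seteqP; split=> x /=; [move=> [i H]; exists i|move=> [i _ H]; exists i].
Qed.

(** Outside a box containing the support every derivative vanishes, as f is zero on an open set
    there; on the box, which is compact, continuity gives the bound. *)
Lemma test_function_bCoo f : test_function f -> bCoo f.
Proof.
move=> tf; have [M HM] := test_function_support tf.
have H0 x : [set x : 'rV[R]_N | exists i, M < `|x ord0 i|] x -> f x = 0.
  by move=> [i Mi]; apply/eqP; apply: contraTT Mi => /HM; rewrite -leNgt.
have bdd g : continuous g -> (forall x, [set x : 'rV[R]_N | exists i, M < `|x ord0 i|] x -> g x = 0) ->
    exists M' : R, forall x, `|g x| <= M'.
  move=> cg g0.
  pose K := [set x : 'rV[R]_N | forall i, `|x ord0 i| <= M].
  have KE : K = ~` [set x : 'rV[R]_N | exists i, M < `|x ord0 i|].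
    apply/seteqP; split=> x /=; first by move=> Kx [j Mj]; move: Mj; rewrite ltNge Kx.
    by move=> nx i; rewrite leNgt; apply/negP => Mi; apply: nx; exists i.
  have cK : compact K.
    by apply: bounded_closed_compact; [exact: bounded_box_rV|rewrite KE; apply/open_closedC/open_out_box].
  have cgK : compact (g @` K).
    by apply: continuous_compact => //; exact: continuous_subspaceT.
  have [B [_ HB]] := compact_bounded cgK.
  have [Kx|] := pselect (exists x, K x).
    exists (B + 1) => x; have [xK|] := pselect (K x).
      by apply: (HB (B + 1)); [rewrite ltrDl|exists x].
    move=> nKx; rewrite g0 ?normr0; last by apply: contrapT => h; apply: nKx; rewrite KE.
    have [y Ky] := Kx; apply: le_trans (normr_ge0 (g y)) _.
    by apply: (HB (B + 1)); [rewrite ltrDl|exists y].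
  move=> nK; exists 0 => x; rewrite g0 ?normr0//.
  by apply: contrapT => h; apply: nK; exists x; rewrite KE.
suff H k g : Ck k g -> (forall x, [set x : 'rV[R]_N | exists i, M < `|x ord0 i|] x -> g x = 0) -> bCk k g.
  by move=> k; apply: H => //; case: tf.
elim: k g => [|k IH] g /=; first by move=> cg g0; split=> //; exact: bdd.
move=> [cg H] g0; split; first exact: bdd.
move=> i; have [dg Cg] := H i; split=> //; apply: IH => //.
exact: partial_eq0 (@open_out_box M) g0.
Qed.

Lemma test_functionM f g : bCoo f -> test_function g -> test_function (fun x => g x * f x).
Proof.
move=> bf tg; apply: test_functionP.
  by apply: bCooM => //; exact: test_function_bCoo.
have [M HM] := test_function_support tg; exists M => x.
by rewrite mulf_eq0 negb_or => /andP[/HM].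
Qed.

Lemma test_functionD f g : test_function f -> test_function g ->
  test_function (fun x => f x + g x).
Proof.
move=> tf tg; apply: test_functionP.
  by apply: bCooD; exact: test_function_bCoo.
have [M HM] := test_function_support tf; have [M' HM'] := test_function_support tg.
exists (Num.max M M') => x fgx i; rewrite le_max.
have [fx|/HM/(_ i) -> //] := eqVneq (f x) 0.
by move: fgx; rewrite fx add0r => /HM'/(_ i) ->; rewrite orbT.
Qed.

Lemma test_function_partials f s : test_function f -> test_function (partials s f).
Proof.
move=> tf; apply: test_functionP.
  by apply: bCoo_partials; exact: test_function_bCoo.
have [M HM] := test_function_support tf; exists M => x fx i.
rewrite leNgt; apply: contra fx => Mi; apply/eqP.
have /(_ _ x) := @partials_eq0 f s _ (@open_out_box M); apply; last by exists i.
by move=> y [j Mj]; apply/eqP; apply: contraTT Mj => /HM; rewrite -leNgt.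
Qed.

Lemma test_function_bumpf m (a b : 'rV[R]_N) : 0 < m -> (forall i, a ord0 i < b ord0 i) ->
  test_function (bumpf m a b).
Proof.
move=> m0 ab; apply: test_functionP; first exact: bCoo_bumpf.
exists (\sum_i (`|a ord0 i| + `|b ord0 i|)) => x bx i.
rewrite (bigD1 i)//= -[leLHS]addr0 lerD ?sumr_ge0//.
have : a ord0 i < x ord0 i < b ord0 i by apply: contraNT bx => h; apply/eqP; exact: bumpf_out h.
have := ler_normlP _ _ (lexx `|a ord0 i|); have := ler_normlP _ _ (lexx `|b ord0 i|).
move=> [b1 b2] [a1 a2] /andP[xa xb]; have := normr_ge0 (a ord0 i); have := normr_ge0 (b ord0 i).
rewrite ler_norml; move: (`|a ord0 i|) (`|b ord0 i|) a1 a2 b1 b2 => a' b' a1 a2 b1 b2 b0 a0.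
by apply/andP; split; lra.
Qed.

End test_functions.

End bump_functions.

(** * Density of test functions and duality *)

Section Lnorm_lemmas.
Context d (T : measurableType d) (R : realType).
Variable mu : {measure set T -> \bar R}.
Implicit Types (f g : T -> R) (p q : R).

Local Notation "'N_ p [ f ]" := ('N[mu]_p%:E[EFin \o f])%E.

Lemma LnormE p f : 'N_p [f] = ((\int[mu]_x (`|f x| `^ p)%:E) `^ p^-1)%E.
Proof. by rewrite unlock. Qed.

Lemma Lnorm_powE p f : 0 < p -> ('N_p [f] `^ p = \int[mu]_x (`|f x| `^ p)%:E)%E.
Proof. by move=> p0; rewrite powR_Lnorm ?gt_eqF. Qed.

Lemma measurable_pow p f : measurable_fun setT f ->
  measurable_fun setT (fun x => (`|f x| `^ p)%:E).
Proof.
move=> mf; apply/measurable_EFinP.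
by apply: (measurableT_comp (measurable_powR p)); exact: measurableT_comp.
Qed.

Lemma le_Lnorm p f g : 0 < p -> measurable_fun setT f -> measurable_fun setT g ->
  (forall x, `|f x| <= `|g x|) -> ('N_p [f] <= 'N_p [g])%E.
Proof.
move=> p0 mf mg fg; rewrite !LnormE.
apply: gt0_ler_poweR; rewrite ?invr_ge0 ?(ltW p0)//.
- by rewrite in_itv/= leey integral_ge0// => x _; rewrite lee_fin powR_ge0.
- by rewrite in_itv/= leey integral_ge0// => x _; rewrite lee_fin powR_ge0.
- apply: ge0_le_integral => //.
  + exact: measurable_pow.
  + exact: measurable_pow.
  + by move=> x _; rewrite lee_fin ge0_ler_powR ?nnegrE ?(ltW p0).
Qed.

Lemma LnormZl p c f : 0 < p -> measurable_fun setT f ->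
  ('N_p [(fun x => c * f x)%R] = `|c|%:E * 'N_p [f])%E.
Proof.
move=> p0 mf; rewrite !LnormE.
under eq_integral do rewrite normrM powRM// EFinM.
rewrite ge0_integralZl//; last by exact: measurable_pow.
rewrite poweRM//.
- by rewrite -[((_ `^ _)%:E `^ _)%E]/(((`|c| `^ p) `^ p^-1)%:E) -powRrM mulfV ?gt_eqF// powRr1.
- by rewrite integral_ge0// => x _; rewrite lee_fin powR_ge0.
Qed.

Lemma Lnorm_lt p f (e : R) : 0 < p -> 0 < e ->
  (\int[mu]_x (`|f x| `^ p)%:E < (e `^ p)%:E)%E -> ('N_p [f] < e%:E)%E.
Proof.
move=> p0 e0 H; rewrite LnormE.
have i0 : (0 <= \int[mu]_x (`|f x| `^ p)%:E)%E.
  by rewrite integral_ge0// => x _; rewrite lee_fin powR_ge0.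
move: i0 H; case: (integral _ _ _) => [r| |]//=; rewrite ?lee_fin ?lte_fin => r0 H.
have -> : e = (e `^ p) `^ p^-1 by rewrite -powRrM mulfV ?gt_eqF// powRr1// ltW.
by rewrite gt0_ltr_powR ?invr_gt0// nnegrE powR_ge0.
Qed.

Lemma Lnorm_ltyP p f : 0 < p ->
  ('N_p [f] < +oo)%E <-> (\int[mu]_x (`|f x| `^ p)%:E < +oo)%E.
Proof.
move=> p0; have H := Lnorm_powE f p0; split=> h.
  by rewrite -H poweR_lty.
by rewrite LnormE poweR_lty.
Qed.

Lemma hoelder_int p q f g : measurable_fun setT f -> measurable_fun setT g ->
  0 < p -> 0 < q -> p^-1 + q^-1 = 1 ->
  (\int[mu]_x (`|f x| * `|g x|)%:E <= 'N_p [f] * 'N_q [g])%E.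
Proof.
move=> mf mg p0 q0 pq.
apply: le_trans (hoelder mu mf mg p0 q0 pq).
rewrite Lnorm1; apply: ge0_le_integral => //.
- by apply/measurable_EFinP; apply: measurable_funM; apply: measurableT_comp.
- by apply: measurableT_comp => //; apply/measurable_EFinP; exact: measurable_funM.
- by move=> x _; rewrite /= normrM.
Qed.

Lemma hoelder_integrable p q f g : measurable_fun setT f -> measurable_fun setT g ->
  0 < p -> 0 < q -> p^-1 + q^-1 = 1 -> ('N_p [f] < +oo)%E -> ('N_q [g] < +oo)%E ->
  mu.-integrable setT (EFin \o (fun x => f x * g x)).
Proof.
move=> mf mg p0 q0 pq fp gq; apply/integrableP; split.
  by apply/measurable_EFinP; exact: measurable_funM.
under eq_integral do rewrite /= normrM.
apply: le_lt_trans (hoelder_int mf mg p0 q0 pq) _.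
by rewrite lte_mul_pinfty ?Lnorm_ge0// ge0_fin_numE ?Lnorm_ge0.
Qed.

Lemma hoelder_Rintegral p q f g : measurable_fun setT f -> measurable_fun setT g ->
  0 < p -> 0 < q -> p^-1 + q^-1 = 1 -> ('N_p [f] < +oo)%E -> ('N_q [g] < +oo)%E ->
  (`|\int[mu]_x (f x * g x)|%:E <= 'N_p [f] * 'N_q [g])%E.
Proof.
move=> mf mg p0 q0 pq fp gq.
have ifg := hoelder_integrable mf mg p0 q0 pq fp gq.
rewrite EFin_normr_Rintegral//; apply: (le_trans _ (hoelder_int mf mg p0 q0 pq)).
apply: le_trans (le_abse_integral _ _ _) _ => //.
  by apply/measurable_EFinP; exact: measurable_funM.
by under eq_integral do rewrite /= normrM.
Qed.

End Lnorm_lemmas.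

Section density.
Context {R : realType} {N : nat} (q : R).
Hypothesis q1 : 1 <= q.
Let q0 : 0 < q. Proof. exact: lt_le_trans q1. Qed.
Let mu : {measure set 'rV[R]_N -> \bar R} := lebesgue_rV N.
Implicit Types f g h : 'rV[R]_N -> R.

Local Notation "'N_ p [ f ]" := ('N[mu]_p%:E[EFin \o f])%E.

Definition approximable h := measurable_fun setT h /\
  forall e : R, 0 < e -> exists2 g, test_function g & ('N_q [(fun x => h x - g x)%R] < e%:E)%E.

Lemma test_function_measurable g : test_function g ->
  measurable_fun setT (g : _ -> measurableTypeR R).
Proof. by move=> /test_function_bCoo /bCoo_measurable. Qed.

Lemma Lnorm_cst0 : 'N_q [(fun=> 0)%R] = 0%E.
Proof. by rewrite -(@Lnorm0 _ _ _ mu q%:E) ?gt_eqF. Qed.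

Lemma test_approximable g : test_function g -> approximable g.
Proof.
move=> tg; split; first exact: test_function_measurable.
move=> e e0; exists g => //; under [X in EFin \o X]eq_fun do rewrite subrr.
by rewrite Lnorm_cst0 lte_fin.
Qed.

Lemma test_function0 : test_function (fun _ : 'rV[R]_N => 0 : R).
Proof.
by apply: test_functionP; [exact: bCoo_cst|exists 0 => x; rewrite eqxx].
Qed.

Lemma approximableD h1 h2 : approximable h1 -> approximable h2 ->
  approximable (fun x => h1 x + h2 x).
Proof.
move=> [m1 H1] [m2 H2]; split; first exact: measurable_funD.
move=> e e0; have e2 : 0 < e / 2 by rewrite divr_gt0.
have [g1 t1 h1g] := H1 _ e2; have [g2 t2 h2g] := H2 _ e2.
exists (fun x => g1 x + g2 x); first exact: test_functionD.
rewrite (_ : (fun x => h1 x + h2 x - (g1 x + g2 x)) =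
  ((fun x => h1 x - g1 x) \+ (fun x => h2 x - g2 x))); last first.
  by apply/funext => x /=; ring.
apply: le_lt_trans.
  apply: minkowski => //; apply: measurable_funB => //; exact: test_function_measurable.
by rewrite (splitr e) EFinD lteD.
Qed.

Lemma approximableZ c h : approximable h -> approximable (fun x => c * h x).
Proof.
move=> [mh H]; have [->|c0] := eqVneq c 0.
  by under eq_fun do rewrite mul0r; apply: test_approximable; exact: test_function0.
split; first exact: measurable_funM.
move=> e e0; have [|g tg hg] := H (e / `|c|); first by rewrite divr_gt0// normr_gt0.
exists (fun x => c * g x).
  have := test_functionM (bCoo_cst c) tg; by under eq_fun do rewrite mulrC.
rewrite (_ : (fun x => _) = (fun x => c * (h x - g x))); last first.
  by apply/funext => x; rewrite mulrBr.
rewrite LnormZl//; last by apply: measurable_funB => //; exact: test_function_measurable.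
move: hg; rewrite -lte_pdivlMl ?normr_gt0// -EFinM mulrC//.
Qed.

(** Dominated convergence turns the pointwise limit into a limit in L^q; half of e is spent on
    [h_ n] and half on its approximation. *)
Lemma approximable_dct (h_ : nat -> 'rV[R]_N -> R) h (G : 'rV[R]_N -> R) :
  (forall n, approximable (h_ n)) ->
  measurable_fun setT h ->
  (forall x, h_ n x @[n --> \oo] --> h x) ->
  (forall n x, `|h x - h_ n x| `^ q <= G x) -> mu.-integrable setT (EFin \o G) ->
  approximable h.
Proof.
move=> ah mh hcvg hG iG; split=> // e e0.
have mhn n : measurable_fun setT (h_ n) by case: (ah n).
have e2 : 0 < e / 2 by rewrite divr_gt0.
have cv : (\int[mu]_x (`|h x - h_ n x| `^ q)%:E)%E @[n --> \oo] --> (\int[mu]_x (cst 0 x : \bar R))%E.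
  apply: (@dominated_cvg _ _ _ mu setT measurableT _ _ (EFin \o G)) => //.
  - by move=> n; apply: (measurable_pow q); exact: (measurable_funB mh (mhn n)).
  - move=> x _; apply: cvg_EFin; first exact: nearW.
    have cv0 : (fun n => h x - h_ n x) @ \oo --> (0 : R).
      by rewrite -(subrr (h x)); apply: cvgB; [exact: cvg_cst|exact: hcvg].
    (* Below 1 the q-th power is at most the identity, because q >= 1; hence the threshold
       [Num.min r 1]. *)
    apply/cvgrPdist_lt => r r0; near=> n.
    have n1 : `|h x - h_ n x| < Num.min r 1.
      by near: n; apply: cvgr0_norm_lt => //; rewrite lt_min r0 ltr01.
    rewrite /= sub0r normrN ger0_norm ?powR_ge0//.
    move: n1; rewrite lt_min => /andP[n1 n2]; apply: le_lt_trans n1.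
    have [->|t0] := eqVneq `|h x - h_ n x| 0; first by rewrite powR0// gt_eqF.
    by rewrite -[leRHS]powRr1// ger_powR// lt_def t0 normr_ge0 ltW.
  - by move=> n x _; rewrite /= ger0_norm ?powR_ge0// lee_fin.
rewrite integral0 in cv.
have eq0 : (0 < ((e / 2) `^ q)%:E)%E by rewrite lte_fin powR_gt0.
have [n _ Hn] : \forall n \near \oo, (\int[mu]_x (`|h x - h_ n x| `^ q)%:E < ((e / 2) `^ q)%:E)%E.
  apply: (@cv [set y | (y < ((e / 2) `^ q)%:E)%E]).
  by apply: (@nbhs_open_ereal_lt R 0 (cst ((e / 2) `^ q))); rewrite powR_gt0.
have hn : ('N_q [(fun x => h x - h_ n x)%R] < (e / 2)%:E)%E.
  by apply: Lnorm_lt => //; exact: Hn (leqnn n).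
have [g tg hg] := (ah n).2 _ e2.
exists g => //.
rewrite (_ : (fun x => h x - g x) =
  ((fun x => h x - h_ n x) \+ (fun x => h_ n x - g x))); last first.
  by apply/funext => x /=; ring.
apply: le_lt_trans.
  apply: minkowski => //; apply: measurable_funB => //; exact: test_function_measurable.
by rewrite (splitr e) EFinD lteD.
Unshelve. all: end_near. Qed.

Definition obox (a b : 'rV[R]_N) : set 'rV[R]_N := [set x | forall i, a ord0 i < x ord0 i < b ord0 i].

Lemma measurable_obox a b : measurable (obox a b).
Proof.
rewrite (_ : obox a b = \bigcap_(i : 'I_N)
       ((fun x : 'rV[R]_N => x ord0 i : measurableTypeR R) @^-1` `]a ord0 i, b ord0 i[%classic)).
  apply: fin_bigcap_measurable => // i _.
  by rewrite -[X in measurable X]setTI; exact: measurable_coor.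
apply/seteqP; split=> x /= H i; first by move=> _ /=; rewrite in_itv/=.
by have := H i I; rewrite /= in_itv.
Qed.

Lemma obox_finite a b : (mu (obox a b) < +oo)%E.
Proof.
have [ab|] := pselect (forall i, a ord0 i <= b ord0 i); last first.
  move=> /existsNP[i /negP]; rewrite -ltNge => ba.
  rewrite (_ : obox a b = set0) ?measure0 ?ltry//.
  by apply/seteqP; split=> x //= /(_ i)/andP[h1 h2]; have := lt_trans (lt_trans h1 h2) ba; rewrite ltxx.
pose B : set 'rV[R]_N := [set x | forall i, a ord0 i <= x ord0 i <= b ord0 i].
have HB : mu B = _ := lebesgue_rV_box ab. apply: (@le_lt_trans _ _ (mu B)); last by rewrite HB ltry.
apply: le_measure; rewrite ?inE; first exact: measurable_obox.
  rewrite (_ : B = \bigcap_(i : 'I_N)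
       ((fun x : 'rV[R]_N => x ord0 i : measurableTypeR R) @^-1` `[a ord0 i, b ord0 i]%classic)).
    apply: fin_bigcap_measurable => // i _.
    by rewrite -[X in measurable X]setTI; exact: measurable_coor.
  apply/seteqP; split=> x /= H i; first by move=> _ /=; rewrite in_itv/=.
  by have := H i I; rewrite /= in_itv.
by move=> x /= H i; have /andP[/ltW-> /ltW->] := H i.
Qed.

Lemma oboxI a b a' b' : obox a b `&` obox a' b' =
  obox (\row_i Num.max (a ord0 i) (a' ord0 i)) (\row_i Num.min (b ord0 i) (b' ord0 i)).
Proof.
apply/seteqP; split=> x /=.
  move=> [H H'] i; rewrite !mxE gt_max lt_min.
  by have /andP[-> ->] := H i; have /andP[-> ->] := H' i.
by move=> H; split=> i; have := H i; rewrite !mxE gt_max lt_min => /andP[/andP[? ?] /andP[? ?]]; apply/andP.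
Qed.

Lemma integrable_indic_obox a b : mu.-integrable setT (EFin \o \1_(obox a b)).
Proof.
apply/integrableP; split.
  by apply/measurable_EFinP/measurable_indic; exact: measurable_obox.
under eq_integral do rewrite /= ger0_norm//.
by rewrite integral_indic ?setIT; [exact: obox_finite|exact: measurableT|exact: measurable_obox].
Qed.

(** In the box the bumps with m = n + 1 are products of factors exp(- 1 / ((n + 1) t)) with t > 0,
    which tend to 1; outside they vanish. *)
Lemma approximable_obox a b : approximable (\1_(obox a b)).
Proof.
have [ab|] := pselect (forall i, a ord0 i < b ord0 i); last first.
  move=> /existsNP[i /negP]; rewrite -leNgt => ba.
  rewrite (_ : obox a b = set0).
    rewrite indic0; exact/test_approximable/test_function0.
  by apply/seteqP; split=> x //= /(_ i)/andP[h1 h2]; have := lt_le_trans (lt_trans h1 h2) ba; rewrite ltxx.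
have b0 n x : ~ obox a b x -> bumpf n.+1%:R a b x = 0.
  by move=> /existsNP[i /negP nx]; apply: bumpf_out nx.
apply: (approximable_dct (h_ := fun n => bumpf n.+1%:R a b) (G := \1_(obox a b))).
- by move=> n; apply/test_approximable/test_function_bumpf.
- by apply: measurable_indic; exact: measurable_obox.
- move=> x; rewrite indicE; have [xB|xB] := pselect (obox a b x); last first.
    by rewrite memNset//; apply: cvg_near_cst; near=> n; rewrite b0.
  rewrite mem_set//= /bumpf.
  rewrite (_ : 1%:R = \prod_(i < N) (1 : R)); last by rewrite big1.
  apply: cvg_big => [|i _]; first exact: mul_continuous.
  pose t := (x ord0 i - a ord0 i) * (b ord0 i - x ord0 i).
  have t0 : 0 < t by have /andP[? ?] := xB i; rewrite mulr_gt0 ?subr_gt0.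
  rewrite (_ : (fun n => _) = (fun n : nat => expR (- (t^-1 * n.+1%:R^-1)))); last first.
    by apply/funext => n; rewrite /flat -mulrA mulr_gt0// expr0 invr1 mul1r invfM mulrC.
  rewrite [X in _ --> X](_ : _ = expR (- (t^-1 * 0))); last by rewrite mulr0 oppr0 expR0.
  apply: continuous_cvg; first exact: continuous_expR.
  by apply: cvgN; apply: cvgMr; exact: cvg_harmonic.
- move=> n x; rewrite indicE; have [xB|xB] := pselect (obox a b x); last first.
    by rewrite memNset// b0// subrr normr0 powR0// gt_eqF.
  rewrite mem_set//= [leRHS](_ : _ = 1 `^ q); last by rewrite powR1.
  rewrite ge0_ler_powR ?nnegrE// ?(ltW q0)//.
  by rewrite ger0_norm ?subr_ge0 ?bumpf_le1// lerBlDr lerDl bumpf_ge0.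
- exact: integrable_indic_obox.
Unshelve. all: end_near. Qed.

Let G : set (set 'rV[R]_N) := [set A | exists a b, A = obox a b].

Lemma measurable_obox_gen : @measurable _ 'rV[R]_N = <<s G >>.
Proof.
apply/seteqP; split; last first.
  apply: smallest_sub; first exact: sigma_algebra_measurable.
  by move=> _ [a [b ->]]; exact: measurable_obox.
move=> A mA.
have : measurable_fun setT (id : g_sigma_algebraType G -> 'rV[R]_N).
  apply: measurable_fun_coorP => i.
  apply: (measurability _ (RGenOInfty.measurableE R)) => _ [_ [c ->] <-].
  rewrite setTI.
  rewrite (_ : _ @^-1` _ = \bigcup_n (obox (\row_j if j == i then c else - n%:R) (const_mx n%:R))).
    apply: bigcupT_measurable => n; apply: sub_sigma_algebra.
    by exists (\row_j if j == i then c else - n%:R), (const_mx n%:R).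
  apply/seteqP; split=> x /=.
    rewrite in_itv/= andbT => cx.
    have [n Hn] : exists n : nat, forall j, `|x ord0 j| < n%:R.
      exists (Num.truncn (\sum_j `|x ord0 j|)).+1 => j.
      apply: le_lt_trans (truncnS_gt _).
      by rewrite (bigD1 j)//= lerDl sumr_ge0.
    exists n => // j; rewrite !mxE; have := Hn j; rewrite ltr_norml => /andP[h1 h2].
    by case: eqVneq => [ji|_]; [rewrite ji in h2 *; rewrite cx h2|rewrite h1 h2].
  by move=> [n _ /(_ i)]; rewrite !mxE eqxx in_itv/= andbT => /andP[].
by move=> /(_ measurableT A mA); rewrite setTI.
Qed.

(** A pi-lambda argument over the open boxes. Intersecting with one fixed box provides the
    integrable majorant that countable unions require. *)
Lemma approximable_sub_obox (a b : 'rV[R]_N) S : measurable S ->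
  approximable (\1_(S `&` obox a b)).
Proof.
move=> mS; have : <<s G >> S by rewrite -measurable_obox_gen.
have mB := measurable_obox a b.
apply: (dynkin_induction (G := G) (P := fun S => approximable (\1_(S `&` obox a b)))).
- exact: measurable_obox_gen.
- by move=> _ _ [a1 [b1 ->]] [a2 [b2 ->]]; rewrite oboxI; do 2 eexists.
- by rewrite setTI; exact: approximable_obox.
- by move=> _ [a1 [b1 ->]]; rewrite oboxI; exact: approximable_obox.
- move=> {}S {}mS aS.
  rewrite (_ : \1_(~` S `&` obox a b) = fun x => \1_(obox a b) x + (- 1) * \1_(S `&` obox a b) x).
    by apply: approximableD; [exact: approximable_obox|exact: approximableZ].
  apply/funext => x; rewrite !indicE !in_setI in_setC.
  by case: (x \in S); case: (x \in obox a b) => /=; ring.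
- move=> F mF tF aF.
  have aUF n : approximable (\1_((\big[setU/set0]_(k < n) F k) `&` obox a b)).
    elim: n => [|n IH].
      rewrite big_ord0 set0I indic0; exact/test_approximable/test_function0.
    rewrite big_ord_recr/=.
    rewrite (_ : \1_ _ = fun x => \1_((\big[setU/set0]_(k < n) F k) `&` obox a b) x + \1_(F n `&` obox a b) x).
      exact: approximableD.
    apply/funext => x; rewrite !indicE !in_setI in_setU.
    case: (boolP (x \in F n)) => xFn; last by rewrite orbF /= addr0.
    rewrite orbT (_ : (x \in \big[setU/set0]_(k < n) F k) = false) ?add0r//.
    apply: memNset; rewrite -bigcup_mkord => -[k /= kn Fkx].
    have := tF k n I I; move=> /(_ (ex_intro _ x (conj Fkx (set_mem xFn)))) kE.
    by rewrite kE ltnn in kn.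
  apply: (approximable_dct (h_ := fun n => \1_((\big[setU/set0]_(k < n) F k) `&` obox a b)) (G := \1_(obox a b))).
  + exact: aUF.
  + by apply: measurable_indic; apply: measurableI => //; exact: bigcupT_measurable.
  + move=> x; have [[k _ Fkx]|nF] := pselect ((\bigcup_k F k) x).
      apply: cvg_near_cst; near=> n.
      rewrite !indicE !in_setI (_ : (x \in \bigcup_k F k) = true); last by apply/mem_set; exists k.
      rewrite (_ : (x \in \big[setU/set0]_(k < n) F k) = true)//.
      by apply/mem_set; rewrite -bigcup_mkord; exists k => //=; near: n; exact: nbhs_infty_gt.
    apply: cvg_near_cst; near=> n.
    rewrite !indicE !in_setI (_ : (x \in \bigcup_k F k) = false); last exact: memNset.
    rewrite (_ : (x \in \big[setU/set0]_(k < n) F k) = false)//.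
    by apply: memNset; rewrite -bigcup_mkord => -[j _ Fjx]; apply: nF; exists j.
  + move=> n x; rewrite !indicE !in_setI.
    case: (x \in obox a b); rewrite ?andbF ?andbT/= ?subrr ?normr0 ?powR0 ?gt_eqF//.
    case: (x \in _) (x \in _) => [] [] /=; rewrite ?subrr ?subr0 ?sub0r ?normrN ?normr1 ?normr0 ?powR1 ?powR0 ?gt_eqF//.
  + exact: integrable_indic_obox.
Unshelve. all: end_near. Qed.

Lemma approximable_sum n (F : 'I_n -> 'rV[R]_N -> R) :
  (forall i, approximable (F i)) -> approximable (fun x => \sum_i F i x).
Proof.
elim: n F => [|n IH] F aF.
  by under eq_fun do rewrite big_ord0; exact/test_approximable/test_function0.
under eq_fun do rewrite big_ord_recr /=.
by apply: approximableD => //; exact: IH.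
Qed.

Import HBNNSimple.

(** Simple functions increasing to h are multiplied by indicators of growing boxes, so that each
    level set falls under [approximable_sub_obox]; |h|^q is the majorant. *)
Lemma approximable_nonneg h : measurable_fun setT h -> (forall x, 0 <= h x) ->
  ('N_q [h] < +oo)%E -> approximable h.
Proof.
move=> mh h0 /Lnorm_ltyP hq; have {hq} hq := hq q0.
have mhE : measurable_fun setT (EFin \o h) by exact/measurable_EFinP.
pose g := nnsfun_approx measurableT mhE.
have gh n x : g n x <= h x.
  by rewrite -lee_fin nnsfun_approxE; apply: le_approx => // y _; rewrite lee_fin.
have g0 n x : 0 <= g n x by exact: fun_ge0.
pose B n := obox (const_mx (- n%:R)) (const_mx n%:R).
apply: (approximable_dct (h_ := fun n x => g n x * \1_(B n) x) (G := fun x => `|h x| `^ q)) => //.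
- move=> n.
  under eq_fun do rewrite fimfunEord mulr_suml.
  apply: approximable_sum => i.
  under eq_fun do rewrite -mulrA.
  apply: approximableZ.
  rewrite (_ : (fun x => _) = \1_(g n @^-1` [set (finmap.enum_fset (fset_set (range (g n))))`_i] `&` B n)).
    apply: approximable_sub_obox; rewrite -[X in measurable X]setTI.
    exact: measurable_funP.
  by apply/funext => x; rewrite indicI.
- move=> x.
  have gx : g n x @[n --> \oo] --> h x.
    have f0 (y : 'rV[R]_N) : setT y -> (0 <= (EFin \o h) y)%E by rewrite lee_fin.
    exact: (fine_cvg (cvg_nnsfun_approx measurableT mhE f0 I)).
  apply: cvg_trans gx; apply: near_eq_cvg; near=> n.
  rewrite indicE mem_set ?mulr1// => i; rewrite !mxE -ltr_norml.
  apply: (@le_lt_trans _ _ (\sum_j `|x ord0 j|)).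
    by rewrite (bigD1 i)//= lerDl sumr_ge0.
  by near: n; exact: nbhs_infty_gtr.
- move=> n x; rewrite ge0_ler_powR ?nnegrE ?(ltW q0)//.
  have i0 : 0 <= \1_(B n) x :> R by rewrite indicE ler0n.
  have i1 : \1_(B n) x <= 1 :> R by rewrite indicE lern1 leq_b1.
  have gB : g n x * \1_(B n) x <= h x by apply: le_trans (gh n x); rewrite ler_piMr.
  by rewrite !ger0_norm ?subr_ge0// lerBlDr lerDl mulr_ge0.
- apply/integrableP; split; first exact: measurable_pow.
  by under eq_integral do rewrite /= ger0_norm ?powR_ge0//.
Unshelve. all: end_near. Qed.

Lemma approximable_Lnorm h : measurable_fun setT h -> ('N_q [h] < +oo)%E -> approximable h.
Proof.
move=> mh hq.
have mM (f : 'rV[R]_N -> R) : measurable_fun setT f -> measurable_fun setT (fun x => Num.max (f x) 0).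
  by move=> mf; apply: measurable_maxr.
have mN : measurable_fun setT (fun x => - h x) by exact: measurableT_comp.
rewrite (_ : h = fun x => Num.max (h x) 0 + (- 1) * Num.max (- h x) 0); last first.
  by apply/funext => x; case: (leP (h x) 0) => hx; case: (leP (- h x) 0) => hx'; lra.
have le1 x : `|Num.max (h x) 0| <= `|h x| by case: (leP (h x) 0); rewrite ?normr0.
have le2 x : `|Num.max (- h x) 0| <= `|h x| by case: (leP (- h x) 0); rewrite ?normr0// normrN.
apply: approximableD; [|apply: approximableZ]; apply: approximable_nonneg.
- exact: mM.
- by move=> x; rewrite le_max lexx orbT.
- by apply: le_lt_trans hq; apply: le_Lnorm => //; exact: mM.
- exact: mM.
- by move=> x; rewrite le_max lexx orbT.
- by apply: le_lt_trans hq; apply: le_Lnorm => //; exact: mM.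
Qed.

End density.

Section duality.
Context {R : realType} {N : nat} (p q : R).
Hypothesis p1 : 1 < p.
Hypothesis q1 : 1 < q.
Hypothesis pq : p^-1 + q^-1 = 1.
Let p0 : 0 < p. Proof. exact: lt_trans p1. Qed.
Let q0 : 0 < q. Proof. exact: lt_trans q1. Qed.
Let mu : {measure set 'rV[R]_N -> \bar R} := lebesgue_rV N.

Local Notation "'N_ p [ f ]" := ('N[mu]_p%:E[EFin \o f])%E.

(** The extremal function v |v|^{p-2} has |h|^q = |v|^p = v h, but is not a test function; it is
    approximated in L^q. The norm A of v is known to be finite, so the factor A^{p-1} can be divided
    out at the end. *)
Lemma Lnorm_duality (v : 'rV[R]_N -> R) (M : R) : measurable_fun setT v ->
  ('N_p [v] < +oo)%E -> 0 <= M ->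
  (forall g, test_function g ->
     (`|\int[mu]_x (v x * g x)|%:E <= M%:E * 'N_q [g])%E) ->
  ('N_p [v] <= M%:E)%E.
Proof.
move=> mv vp M0 H.
pose h x := v x * `|v x| `^ (p - 2).
have p10 : 0 < p - 1 by rewrite subr_gt0.
have nhE x : `|h x| = `|v x| `^ (p - 1).
  rewrite /h normrM (ger0_norm (powR_ge0 _ _)).
  have [v0|v0] := eqVneq (v x) 0; first by rewrite v0 normr0 mul0r powR0// gt_eqF.
  rewrite -{1}[`|v x|]powRr1// -powRD ?normr_eq0 ?v0 ?implybT//.
  by congr (_ `^ _); ring.
have hE x : `|h x| `^ q = `|v x| `^ p.
  rewrite nhE -powRrM; congr (_ `^ _).
  have p0' : p != 0 by rewrite gt_eqF.
  have q0' : q != 0 by rewrite gt_eqF.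
  have : q + p = p * q by rewrite -[RHS]mulr1 -pq; field; exact/andP.
  by move=> E; rewrite mulrBl mul1r -E addrC addKr.
have vh x : v x * h x = `|v x| `^ p.
  rewrite /h mulrA -expr2 -real_normK ?num_real//.
  have [v0|v0] := eqVneq (v x) 0; first by rewrite v0 normr0 expr2 !mul0r powR0// gt_eqF.
  rewrite -powR_mulrn// -powRD ?normr_eq0 ?v0 ?implybT//.
  by congr (_ `^ _); ring.
have mh : measurable_fun setT h.
  apply: measurable_funM => //.
  by apply: (measurableT_comp (measurable_powR _)); exact: measurableT_comp.
pose A := fine ('N_p [v])%E.
have AE : ('N_p [v] = A%:E)%E by rewrite fineK// ge0_fin_numE// Lnorm_ge0.
have A0 : 0 <= A by rewrite fine_ge0// Lnorm_ge0.
rewrite AE lee_fin; have [->//|Aneq0] := eqVneq A 0.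
have Agt0 : 0 < A by rewrite lt_def Aneq0.
have IA : (\int[mu]_x (`|v x| `^ p)%:E = (A `^ p)%:E)%E.
  by rewrite -(Lnorm_powE mu v p0) AE.
have hA : ('N_q [h] = (A `^ (p - 1))%:E)%E.
  rewrite LnormE; under eq_integral do rewrite hE.
  rewrite IA /= -powRrM; congr ((_ `^ _)%:E).
  have -> : q^-1 = 1 - p^-1 by rewrite -pq addrC addKr.
  by rewrite mulrBr mulr1 mulfV// gt_eqF.
pose a := A `^ (p - 1).
have a0 : 0 < a by rewrite powR_gt0.
suff : A * a <= M * a by rewrite ler_pM2r.
apply/ler_addgt0Pr => e e0.
have K0 : 0 < M + A + 1 by lra.
have hq : ('N_q [h] < +oo)%E by rewrite hA ltry.
(* The error d enters once with factor M, from the norm of g, and once with factor A, from pairing v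
   with h - g; this accuracy makes (M + A) d at most e. *)
have [g tg hg] := (approximable_Lnorm (ltW q1) mh hq).2 (e / (M + A + 1)) (divr_gt0 e0 K0).
have mg := test_function_measurable tg.
have mhg : measurable_fun setT (fun x => h x - g x) by exact: measurable_funB.
pose d := fine ('N_q [(fun x => h x - g x)%R])%E.
have dE : ('N_q [(fun x => h x - g x)%R] = d%:E)%E.
  by rewrite fineK// ge0_fin_numE ?Lnorm_ge0// (lt_trans hg) ?ltry.
have hgy : ('N_q [(fun x => h x - g x)%R] < +oo)%E by rewrite dE ltry.
have d0 : 0 <= d by rewrite fine_ge0// Lnorm_ge0.
have de : d <= e / (M + A + 1) by rewrite -lee_fin -dE ltW.
have gle : ('N_q [g] <= (a + d)%:E)%E.
  rewrite (_ : g = (h \+ (fun x => (- 1) * (h x - g x)))); last first.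
    by apply/funext => x /=; ring.
  apply: le_trans; first by apply: minkowski; rewrite ?(ltW q1)//; exact: measurable_funM.
  by rewrite hA LnormZl// normrN1 mul1e dE.
have gfin : ('N_q [g] < +oo)%E by apply: le_lt_trans gle (ltry _).
have ivg : mu.-integrable setT (EFin \o (fun x => v x * g x)).
  exact: (hoelder_integrable mv mg p0 q0).
have ivhg : mu.-integrable setT (EFin \o (fun x => v x * (h x - g x))).
  by apply: (hoelder_integrable mv mhg p0 q0) => //; rewrite dE ltry.
have IE : A * a = \int[mu]_x (v x * g x) + \int[mu]_x (v x * (h x - g x)).
  rewrite -RintegralD//.
  rewrite (_ : A * a = A `^ p); last first.
    by rewrite /a -{1}[A]powRr1// -powRD ?Aneq0 ?implybT// addrC subrK.
  rewrite -[LHS]/(fine (A `^ p)%:E) -IA; congr fine; apply: eq_integral => x _.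
  by rewrite -vh; congr EFin; ring.
have b1 : \int[mu]_x (v x * g x) <= M * (a + d).
  rewrite -lee_fin; apply: (@le_trans _ _ (M%:E * 'N_q [g])%E).
    by apply: le_trans (H _ tg); rewrite lee_fin ler_norm.
  by rewrite EFinM lee_wpmul2l.
have b2 : \int[mu]_x (v x * (h x - g x)) <= A * d.
  apply: (le_trans (ler_norm _)).
  have := hoelder_Rintegral mv mhg p0 q0 pq vp hgy.
  by rewrite AE dE -EFinM lee_fin.
rewrite IE mulrDr in b1 *; apply: (@le_trans _ _ (M * a + (M + A) * d)); first lra.
rewrite lerD2l; apply: (@le_trans _ _ ((M + A) * (e / (M + A + 1)))).
  by rewrite ler_wpM2l// addr_ge0.
by rewrite mulrCA ger_pMr// ler_pdivrMr// mul1r lerDl.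
Qed.

End duality.

Lemma integrable_dom d (T : measurableType d) (R : realType)
    (mu : {measure set T -> \bar R}) (f g : T -> R) (C : R) :
  measurable_fun setT f -> (forall x, `|f x| <= C * `|g x|) ->
  mu.-integrable setT (EFin \o g) -> mu.-integrable setT (EFin \o f).
Proof.
move=> mf fg ig.
apply: (@le_integrable _ _ _ _ _ measurableT _ (fun z => C%:E * (g z)%:E)%E) => //.
- exact/measurable_EFinP.
- move=> x _; rewrite /= lee_fin normrM; apply: le_trans (fg x) _.
  by rewrite ler_wpM2r// ler_norm.
- exact: integrableZl.
Qed.

(** * Weighted averages of translates: smoothness and Young's inequality *)

Section translation_average.
Context {R : realType} {N : nat} d (O : measurableType d).
Variable m : {sigma_finite_measure set O -> \bar R}.
Variables (K : O -> R) (th : O -> 'rV[R]_N).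
Hypothesis iK : m.-integrable setT (EFin \o K).
Hypothesis mth : measurable_fun setT th.
Implicit Types (f : 'rV[R]_N -> R) (x : 'rV[R]_N) (i : 'I_N).

Local Notation e_ i := (delta_mx ord0 i : 'rV[R]_N).
Let mK : measurable_fun setT K.
Proof. by have /integrableP[/measurable_EFinP] := iK. Qed.

(** The parameter space is abstract so that one theory covers a single Gaussian (parameters in R^N)
    and a superposition of Gaussians over scales (parameters in R times R^N). *)
Definition transavg f x : R := \int[m]_z (K z * f (x + th z)).

Lemma measurable_translate f x : measurable_fun setT f ->
  measurable_fun setT (fun z => f (x + th z)).
Proof.
move=> mf; apply: (measurableT_comp mf).
under eq_fun do rewrite addrC.
by apply: (measurableT_comp (measurable_addrV x)).
Qed.

Lemma integrable_transavg f x : bCoo f ->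
  m.-integrable setT (EFin \o (fun z => K z * f (x + th z))).
Proof.
move=> bf; have [M fM] := bCoo_bounded bf.
have mf := bCoo_measurable bf.
apply: (integrable_dom (C := M) _ _ iK).
- by apply: measurable_funM => //; exact: measurable_translate.
- by move=> z; rewrite normrM mulrC ler_wpM2r.
Qed.

Lemma is_derive_transavg f x i : bCoo f ->
  is_derive x (e_ i) (transavg f) (transavg (partial i f) x).
Proof.
move=> bf; have bpf := bCoo_partial i bf.
have [M fM] := bCoo_bounded bpf.
pose F := fun (t : R) (z : O) => K z * f (x + t *: e_ i + th z).
have dF (t : R) z : is_derive t 1 (F ^~ z) (K z * partial i f (x + t *: e_ i + th z)).
  have -> : F^~ z = fun s => K z * f ((x + th z) + s *: e_ i).
    by apply/funext => s; rewrite /F addrAC.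
  rewrite [x + t *: _ + _]addrAC.
  have := @is_derive_line _ _ f (x + th z) (e_ i) t (bCoo_derivable bf) => dl.
  by apply: is_derive_eq.
have H0 : (`]-1, 1[%classic : set R) 0 by rewrite /= in_itv/= ltrN10 ltr01.
have i0 (t : R) : `]-1, 1[%classic t -> m.-integrable setT (EFin \o F t).
  by move=> _; exact: integrable_transavg.
have d0 (t : R) z : `]-1, 1[%classic t -> setT z -> derivable (F ^~ z) t 1.
  by move=> _ _; have [] := dF t z.
have G0 z : 0 <= `|K z| * M.
  by rewrite mulr_ge0// (le_trans (normr_ge0 _) (fM 0)).
have iG : m.-integrable setT (EFin \o (fun z => `|K z| * M)).
  apply: (integrable_dom (C := `|M|) _ _ iK).
    by apply: measurable_funM => //; exact: measurableT_comp.
  by move=> z; rewrite normrM normr_id mulrC.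
have GF (t : R) z : `]-1, 1[%classic t -> setT z -> `|partial1of2 F t z| <= `|K z| * M.
  move=> _ _; rewrite partial1of2E; have [_ ->] := dF t z.
  by rewrite normrM ler_wpM2l.
have := differentiation_under_integral measurableT H0 i0 d0 G0 iG GF.
have := derivable_under_integral measurableT H0 i0 d0 G0 iG GF.
move=> dT ET; apply: derive_line; apply: DeriveDef => //.
rewrite derive1E in ET; rewrite /transavg ET; apply: eq_Rintegral => z _.
by rewrite partial1of2E; have [_ ->] := dF 0 z; rewrite scale0r addr0.
Qed.

Lemma partial_transavg f i : bCoo f ->
  partial i (transavg f) = transavg (partial i f).
Proof.
move=> bf; apply/funext => x; rewrite /partial.
by have [_ ->] := is_derive_transavg x i bf.
Qed.

Lemma bCoo_transavg f : bCoo f -> bCoo (transavg f).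
Proof.
have bT g : bCoo g -> exists M : R, forall x, `|transavg g x| <= M.
  move=> bg; have [M gM] := bCoo_bounded bg.
  have iKM : m.-integrable setT (EFin \o (fun z => `|K z| * M)).
    apply: (integrable_dom (C := `|M|) _ _ iK).
      by apply: measurable_funM => //; exact: measurableT_comp.
    by move=> z; rewrite normrM normr_id mulrC.
  exists (\int[m]_z (`|K z| * M)) => x.
  have iT := integrable_transavg x bg.
  apply: le_trans (le_normr_Rintegral _ _) _ => //.
  apply: le_Rintegral => //; first exact: integrable_norm iT.
  by move=> z _; rewrite normrM ler_wpM2l.
move=> + k; elim: k f => [|k IH] f bf; (split; first exact: bT) => // i.
split; first by move=> x; have [] := is_derive_transavg x i bf.
by rewrite partial_transavg//; apply/IH/bCoo_partial.
Qed.

Let mu : {sigma_finite_measure set 'rV[R]_N -> \bar R} := lebesgue_rV N.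
Local Notation "'N_ p [ f ]" := ('N[mu]_p%:E[EFin \o f])%E.

(* Young's inequality: Jensen for the finite measure |K| dm, then Tonelli and
   translation invariance *)
Lemma Lnorm_transavg q f : 1 < q -> bCoo f ->
  ('N_q [transavg f] <= (\int[m]_z `|K z|)%:E * 'N_q [f])%E.
Proof.
move=> q1 bf; have q0 : 0 < q by exact: lt_trans q1.
have mf := bCoo_measurable bf.
pose k := \int[m]_z `|K z|.
have k0 : 0 <= k by apply: Rintegral_ge0.
have kE : (\int[m]_z `|K z|%:E = k%:E)%E.
  rewrite /k /Rintegral fineK//.
  by have := integrable_fin_num measurableT (integrable_norm iK).
pose p := (1 - q^-1)^-1.
have p0 : 0 < p by rewrite invr_gt0 subr_gt0 invf_lt1.
have pq : p^-1 + q^-1 = 1 by rewrite invrK subrK.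
have pt x : ((`|transavg f x| `^ q)%:E <=
    (k `^ (q - 1))%:E * \int[m]_z (`|K z| * `|f (x + th z)| `^ q)%:E)%E.
  (* The weight |K| is split as |K|^{1/p} |K|^{1/q} before Hoelder's inequality, so that its total
     mass comes out with the power q - 1 and one factor |K| remains inside. *)
  pose f1 z := `|K z| `^ p^-1; pose f2 z := `|K z| `^ q^-1 * `|f (x + th z)|.
  have mf1 : measurable_fun setT f1.
    by apply: (measurableT_comp (measurable_powR _)); exact: measurableT_comp.
  have mf2 : measurable_fun setT f2.
    apply: measurable_funM.
      by apply: (measurableT_comp (measurable_powR _)); exact: measurableT_comp.
    by apply: measurableT_comp => //; exact: measurable_translate.
  have f12 z : `|f1 z| * `|f2 z| = `|K z * f (x + th z)|.
    rewrite [`|f1 z|]ger0_norm ?powR_ge0// [`|f2 z|]ger0_norm ?mulr_ge0 ?powR_ge0//.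
    rewrite normrM mulrA; congr (_ * _).
    rewrite /f1; have [->|K0] := eqVneq (K z) 0; first by rewrite normr0 powR0 ?mul0r// gt_eqF// invr_gt0.
    by rewrite -powRD ?pq ?powRr1// normr_eq0 K0 implybT.
  have := hoelder_int m mf1 mf2 p0 q0 pq.
  under eq_integral do rewrite f12.
  have -> : ('N[m]_p%:E[EFin \o f1] = (k `^ p^-1)%:E)%E.
    rewrite LnormE (_ : (\int[m]_z _ = k%:E)%E)// -kE.
    apply: eq_integral => z _; congr EFin.
    by rewrite ger0_norm ?powR_ge0// -powRrM mulVf ?gt_eqF// powRr1.
  rewrite (LnormE m q f2).
  rewrite (_ : (\int[m]_z (`|f2 z| `^ q)%:E = \int[m]_z (`|K z| * `|f (x + th z)| `^ q)%:E)%E); last first.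
    apply: eq_integral => z _; congr EFin.
    rewrite ger0_norm ?mulr_ge0 ?powR_ge0// powRM ?powR_ge0//.
    by rewrite -powRrM mulVf ?gt_eqF// powRr1.
  set J := (\int[m]_z (`|K z| * _)%:E)%E.
  have J0 : (0 <= J)%E by apply: integral_ge0 => z _; rewrite lee_fin mulr_ge0 ?powR_ge0.
  move=> Hh.
  have : (`|transavg f x|%:E <= (k `^ p^-1)%:E * J `^ q^-1)%E.
    apply: le_trans Hh; rewrite /transavg EFin_normr_Rintegral//; last exact: integrable_transavg.
    apply: le_trans (le_abse_integral _ _ _) _ => //.
    by apply/measurable_EFinP; apply: measurable_funM => //; exact: measurable_translate.
  move=> /(gt0_ler_poweR (ltW q0)) H.
  rewrite -[X in (X <= _)%E]/((`|transavg f x|%:E `^ q)%E).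
  apply: le_trans (H _ _) _.
  - by rewrite in_itv/= leey lee_fin normr_ge0.
  - by rewrite in_itv/= leey mule_ge0 ?poweR_ge0// lee_fin powR_ge0.
  rewrite poweRM ?poweR_ge0 ?lee_fin ?powR_ge0//.
  rewrite -poweRrM mulVf ?gt_eqF// poweRe1//.
  rewrite -[((_ `^ _)%:E `^ _)%E]/(((k `^ p^-1) `^ q)%:E) -powRrM.
  by rewrite /p invrK mulrBl mul1r mulVf ?gt_eqF.
have mJ : measurable_fun setT (fun xz : 'rV[R]_N * O => (`|K xz.2| * `|f (xz.1 + th xz.2)| `^ q)%:E).
  apply/measurable_EFinP; apply: measurable_funM.
    by apply: measurableT_comp => //; exact: measurableT_comp.
  apply: (measurableT_comp (measurable_powR _)); apply: measurableT_comp => //.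
  apply: (measurableT_comp mf); apply: measurable_fun_coorP => i.
  under eq_fun do rewrite mxE; apply: measurable_funD.
    by apply: (measurableT_comp (measurable_coor i)); exact: measurable_fst.
  by apply: (measurableT_comp (measurable_coor i)); exact: measurableT_comp.
have J0 (xz : 'rV[R]_N * O) : (0 <= (`|K xz.2| * `|f (xz.1 + th xz.2)| `^ q)%:E)%E.
  by rewrite lee_fin mulr_ge0 ?powR_ge0.
have mfq : measurable_fun setT (fun x => (`|f x| `^ q)%:E) by exact: measurable_pow.
have fq0 x : (0 <= (`|f x| `^ q)%:E)%E by rewrite lee_fin powR_ge0.
have mT : measurable_fun setT (transavg f) by apply: bCoo_measurable; exact: bCoo_transavg.
have H : (\int[mu]_x (`|transavg f x| `^ q)%:E <= (k `^ q)%:E * \int[mu]_x (`|f x| `^ q)%:E)%E.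
  apply: (@le_trans _ _ (\int[mu]_x ((k `^ (q - 1))%:E * \int[m]_z (`|K z| * `|f (x + th z)| `^ q)%:E))%E).
    apply: ge0_le_integral => //.
    - exact: measurable_pow.
    - apply: measurable_funeM; exact: (measurable_fun_fubini_tonelli_F (m2 := m) _ mJ J0).
  rewrite ge0_integralZl//; last 3 first.
  - exact: (measurable_fun_fubini_tonelli_F (m2 := m) _ mJ J0).
  - by move=> x _; apply: integral_ge0 => z _; exact: J0 (x, z).
  - by rewrite lee_fin powR_ge0.
  rewrite (fubini_tonelli _ mJ J0).
  under eq_integral => z _ /=.
    under eq_integral => x _ do rewrite EFinM.
    rewrite ge0_integralZl//; last first.
      by apply: (measurableT_comp mfq); exact: measurable_addrV.
    rewrite (ge0_integral_shift (th z) mfq fq0).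
    over.
  rewrite ge0_integralZr//; last 2 first.
  - by apply/measurable_EFinP; exact: measurableT_comp.
  - exact: integral_ge0.
  rewrite kE muleA -EFinM.
  have [->|kn0] := eqVneq k 0; first by rewrite mulr0 powR0 ?gt_eqF.
  by rewrite -{2}[k]powRr1// -powRD ?kn0 ?implybT// subrK.
rewrite !LnormE -/k.
 have -> : (k%:E * (\int[mu]_x (`|f x| `^ q)%:E) `^ q^-1)%E =
    (((k `^ q)%:E * (\int[mu]_x (`|f x| `^ q)%:E)) `^ q^-1)%E.
  rewrite poweRM ?lee_fin ?powR_ge0//; last exact: integral_ge0.
  by rewrite -[((_ `^ _)%:E `^ _)%E]/(((k `^ q) `^ q^-1)%:E) -powRrM mulfV ?gt_eqF// powRr1.
apply: gt0_ler_poweR; rewrite ?invr_ge0 ?(ltW q0)//.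
- by rewrite in_itv/= leey integral_ge0// => x _; rewrite lee_fin powR_ge0.
- by rewrite in_itv/= leey mule_ge0 ?lee_fin ?powR_ge0 ?integral_ge0.
Qed.

End translation_average.

Lemma integrableRD d (T : measurableType d) (R : realType) (mu : {measure set T -> \bar R})
    (f g : T -> R) : mu.-integrable setT (EFin \o f) -> mu.-integrable setT (EFin \o g) ->
  mu.-integrable setT (EFin \o (fun x => f x + g x)).
Proof.
by move=> i1 i2; apply: (eq_integrable measurableT _ _ _ (integrableD measurableT i1 i2)).
Qed.

Lemma integrableRZ d (T : measurableType d) (R : realType) (mu : {measure set T -> \bar R})
    (c : R) (f : T -> R) : mu.-integrable setT (EFin \o f) ->
  mu.-integrable setT (EFin \o (fun x => c * f x)).
Proof.
by move=> i1; apply: (eq_integrable measurableT _ _ _ (integrableZl measurableT c i1)).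
Qed.

(** * Complex Gaussian kernels *)

Section gaussians.
Context {R : realType} {N : nat}.
Implicit Types (f g h k : 'rV[R]_N -> R) (x y : 'rV[R]_N) (i : 'I_N) (s t tau : R).

Local Notation e_ i := (delta_mx ord0 i : 'rV[R]_N).
Local Notation mu := (@lebesgue_rV R N).

Lemma weight_shift i t y : `|t| <= 1 -> weight (y + t *: e_ i) <= 3 * weight y.
Proof.
move=> t1; rewrite /weight (bigD1 i)//= [X in 3 * X](bigD1 i)//= mulrA.
have -> : \prod_(j < N | j != i) (1 + (y + t *: e_ i) ord0 j ^+ 2)^-1
   = \prod_(j < N | j != i) (1 + y ord0 j ^+ 2)^-1.
  by apply: eq_bigr => j ji; rewrite !mxE eqxx (negPf ji) mulr0 addr0.
apply: ler_wpM2r; first by apply: prodr_ge0 => j _; rewrite invr_ge0 addr_ge0 ?sqr_ge0.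
rewrite !mxE !eqxx mulr1.
have a0 : 0 < 1 + (y ord0 i + t) ^+ 2 by rewrite ltr_wpDr ?sqr_ge0.
have b0 : 0 < 1 + y ord0 i ^+ 2 by rewrite ltr_wpDr ?sqr_ge0.
(* The claim becomes 1 + y^2 <= 3 (1 + (y + t)^2), true since y^2 <= 2 (y + t)^2 + 2 t^2 and t^2 <=
   1. *)
rewrite -[leLHS]mul1r ler_pdivrMr// mulrAC ler_pdivlMr// mul1r.
have : t ^+ 2 <= 1 by rewrite -real_normK ?num_real// exprn_ile1.
have := sqr_ge0 (y ord0 i + 2 * t); have := sqr_ge0 (y ord0 i + t).
by rewrite !expr2; nra.
Qed.

(* the integral of a partial derivative vanishes: differentiate the constant
   function t |-> \int F(y + t e_i) dy at 0 *)
Lemma Rintegral_partial i (F F' : 'rV[R]_N -> R) (C : R) :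
  measurable_fun setT F ->
  (forall y, is_derive y (e_ i) F (F' y)) ->
  (forall y, `|F y| <= C * weight y) -> (forall y, `|F' y| <= C * weight y) ->
  \int[mu]_y F' y = 0.
Proof.
move=> mF dF bF bF'.
have C0 y : 0 <= C * weight y by exact: le_trans (bF y).
pose G t y := F (y + t *: e_ i).
have dG t y : is_derive t 1 (G ^~ y) (F' (y + t *: e_ i)).
  by have [d <-] := dF (y + t *: e_ i); exact: is_derive_line.
have mG t : measurable_fun setT (G t).
  by apply: (measurableT_comp mF); exact: measurable_addrV.
have H0 : (`]-1, 1[%classic : set R) 0 by rewrite /= in_itv/= ltrN10 ltr01.
have bt t : `]-1, 1[%classic t -> `|t| <= 1.
  by rewrite /= in_itv/= ler_norml => /andP[/ltW -> /ltW ->].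
have iG (t : R) : `]-1, 1[%classic t -> mu.-integrable setT (EFin \o G t).
  move=> t1; apply: (integrable_dom (C := 3 * C) _ _ (@integrable_weight R N)) => //.
  move=> y; apply: le_trans (bF _) _; rewrite (ger0_norm (weight_ge0 y)).
  have C0' : 0 <= C.
    have := C0 0; rewrite pmulr_lge0//; apply: prodr_gt0 => j _.
    by rewrite invr_gt0 ltr_wpDr ?sqr_ge0.
  by rewrite mulrAC [X in _ <= X]mulrC ler_wpM2l// weight_shift// bt.
have d0 (t : R) y : `]-1, 1[%classic t -> setT y -> derivable (G ^~ y) t 1.
  by move=> _ _; have [] := dG t y.
have W0 y : 0 <= 3 * (C * weight y) by rewrite mulr_ge0.
have iW : mu.-integrable setT (EFin \o (fun y => 3 * (C * weight y))).
  apply: (integrable_dom (C := `|3 * C|) _ _ (@integrable_weight R N)).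
    by do 2 apply: measurable_funM => //; exact: measurable_weight.
  by move=> y; rewrite mulrA normrM.
have GF (t : R) y : `]-1, 1[%classic t -> setT y -> `|partial1of2 G t y| <= 3 * (C * weight y).
  move=> t1 _; rewrite partial1of2E; have [_ ->] := dG t y.
  apply: le_trans (bF' _) _.
  have C0' : 0 <= C.
    have := C0 0; rewrite pmulr_lge0//; apply: prodr_gt0 => j _.
    by rewrite invr_gt0 ltr_wpDr ?sqr_ge0.
  by rewrite mulrCA ler_wpM2l// weight_shift// bt.
have := differentiation_under_integral measurableT H0 iG d0 W0 iW GF.
rewrite (_ : (fun t => _) = cst (\int[mu]_y F y)); last first.
  by apply/funext => t; rewrite /G Rintegral_shift.
rewrite derive1E derive_cst => H; rewrite [RHS]H.
apply: eq_Rintegral => y _; rewrite partial1of2E; have [_ ->] := dG 0 y.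
by rewrite scale0r addr0.
Qed.

Definition rho y : R := \sum_i y ord0 i ^+ 2.

(** [gc] + i [gs] is e^{-(1 - i tau) r}, and the two derivative lemmas below are the components of
    its derivative -(1 - i tau) e^{-(1 - i tau) r}. *)
Definition gc tau r : R := expR (- r) * cos (tau * r).
Definition gs tau r : R := expR (- r) * sin (tau * r).

Lemma is_derive_gc tau (r : R) : is_derive r 1 (gc tau) (- gc tau r - tau * gs tau r).
Proof.
rewrite /gc /gs.
have d1 : is_derive r 1 (fun r : R => expR (- r)) (- expR (- r)).
  rewrite -mulrN1; apply: (is_derive1_comp (is_derive_expR (- r))).
have d2 : is_derive r 1 (fun r : R => cos (tau * r)) (- sin (tau * r) * tau).
  apply: (is_derive1_comp (is_derive_cos (tau * r))).
  by apply: is_derive_eq; rewrite /GRing.scale/=; ring.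
by apply: is_derive_eq; rewrite /GRing.scale/=; ring.
Qed.

Lemma is_derive_gs tau (r : R) : is_derive r 1 (gs tau) (- gs tau r + tau * gc tau r).
Proof.
rewrite /gc /gs.
have d1 : is_derive r 1 (fun r : R => expR (- r)) (- expR (- r)).
  rewrite -mulrN1; apply: (is_derive1_comp (is_derive_expR (- r))).
have d2 : is_derive r 1 (fun r : R => sin (tau * r)) (cos (tau * r) * tau).
  apply: (is_derive1_comp (is_derive_sin (tau * r))).
  by apply: is_derive_eq; rewrite /GRing.scale/=; ring.
by apply: is_derive_eq; rewrite /GRing.scale/=; ring.
Qed.

Lemma is_derive_rho (G G' : R -> R) y i :
  (forall r : R, is_derive r 1 G (G' r)) ->
  is_derive y (e_ i) (fun y => G (rho y)) (2 * y ord0 i * G' (rho y)).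
Proof.
move=> dG; apply: derive_line.
have rE s : rho (y + s *: e_ i) = rho y + (2 * y ord0 i * s + s ^+ 2).
  rewrite /rho (bigD1 i)//= [in RHS](bigD1 i)//= !mxE !eqxx mulr1.
  have -> : \sum_(j < N | j != i) (y + s *: e_ i) ord0 j ^+ 2 = \sum_(j < N | j != i) y ord0 j ^+ 2.
    by apply: eq_bigr => j ji; rewrite !mxE eqxx (negPf ji) mulr0 addr0.
  by rewrite sqrrD; ring.
under eq_fun do rewrite rE.
rewrite [2 * _ * G' _]mulrC; apply: (is_derive1_comp (f := G) (g := fun s => rho y + (2 * y ord0 i * s + s ^+ 2))).
  by rewrite mulr0 expr0n/= !addr0.
have dX := is_derive_exprn 2 (is_derive_id (0 : R) 1).
by apply: is_derive_eq; rewrite /GRing.scale/=; ring.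
Qed.

Lemma expR_rho_weight y : expR (- rho y) <= weight y.
Proof.
rewrite /rho -sumrN expR_sum; apply: ler_prod => i _; rewrite expR_ge0/=.
by rewrite expRN lef_pV2 ?posrE ?expR_gt0 ?ltr_wpDr ?sqr_ge0// expR_ge1Dx.
Qed.

(** The i-th coordinate pays for the extra factor through (1 + r)^2 <= 4 e^r; every other coordinate
    uses 1 + r <= e^r. *)
Lemma rho_weight y i : (1 + y ord0 i ^+ 2) * expR (- rho y) <= 4 * weight y.
Proof.
have E2 (r : R) : 0 <= r -> (1 + r) * expR (- r) <= 4 * (1 + r)^-1.
  move=> r0; have r1 : 0 < 1 + r by rewrite ltr_wpDr.
  rewrite ler_pdivlMr// mulrAC expRN ler_pdivrMr ?expR_gt0//.
  have := expR_ge1Dxn 1 r0; have := expR_ge1Dx r; rewrite !expr2 (_ : 2`!%:R = 2)//.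
  by nra.
have := @expR_rho_weight; rewrite /rho /weight (bigD1 i)//= [X in 4 * X](bigD1 i)//= => _.
rewrite opprD expRD mulrA [X in _ <= X]mulrA; apply: ler_pM.
- by rewrite mulr_ge0 ?expR_ge0// addr_ge0 ?sqr_ge0.
- exact: expR_ge0.
- by apply: E2; exact: sqr_ge0.
- rewrite -sumrN expR_sum; apply: ler_prod => j _; rewrite expR_ge0/=.
  by rewrite expRN lef_pV2 ?posrE ?expR_gt0 ?ltr_wpDr ?sqr_ge0// expR_ge1Dx.
Qed.

Lemma measurable_rho : measurable_fun setT (rho : _ -> measurableTypeR R).
Proof.
apply: measurable_sum => i; apply: measurable_funX; exact: measurable_coor.
Qed.

Lemma measurable_rho_comp (G G' : R -> R) : (forall r : R, is_derive r 1 G (G' r)) ->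
  measurable_fun setT (fun y => G (rho y)).
Proof.
move=> dG; apply: (measurableT_comp _ measurable_rho).
apply: measurable_realfun.continuous_measurable_fun => r.
by apply: differentiable_continuous; apply/derivable1_diffP; exact: ex_derive.
Qed.

Definition kc tau y := gc tau (rho y).
Definition ks tau y := gs tau (rho y).

Lemma is_derive_kc tau y i :
  is_derive y (e_ i) (kc tau) (2 * y ord0 i * (- kc tau y - tau * ks tau y)).
Proof. exact: (is_derive_rho y i (is_derive_gc tau)). Qed.

Lemma is_derive_ks tau y i :
  is_derive y (e_ i) (ks tau) (2 * y ord0 i * (- ks tau y + tau * kc tau y)).
Proof. exact: (is_derive_rho y i (is_derive_gs tau)). Qed.

Lemma partial_kc tau i : partial i (kc tau) = fun y => 2 * y ord0 i * (- kc tau y - tau * ks tau y).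
Proof. by apply/funext => y; rewrite /partial; have [_ ->] := is_derive_kc tau y i. Qed.

Lemma partial_ks tau i : partial i (ks tau) = fun y => 2 * y ord0 i * (- ks tau y + tau * kc tau y).
Proof. by apply/funext => y; rewrite /partial; have [_ ->] := is_derive_ks tau y i. Qed.

Lemma measurable_kc tau : measurable_fun setT (kc tau).
Proof. exact: (measurable_rho_comp (is_derive_gc tau)). Qed.

Lemma measurable_ks tau : measurable_fun setT (ks tau).
Proof. exact: (measurable_rho_comp (is_derive_gs tau)). Qed.

Lemma kc_le tau y : `|kc tau y| <= expR (- rho y).
Proof. by rewrite /kc /gc normrM gtr0_norm ?expR_gt0// ler_piMr ?expR_ge0// cos_max. Qed.

Lemma ks_le tau y : `|ks tau y| <= expR (- rho y).
Proof. by rewrite /ks /gs normrM gtr0_norm ?expR_gt0// ler_piMr ?expR_ge0// sin_max. Qed.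

(** An admissible convolution kernel: a common majorant for k and its first partial derivatives
    justifies both integration by parts and differentiation under the integral, and bounds all the
    L^1 norms by one constant. *)
Definition profile (C : R) k := [/\ measurable_fun setT k,
  forall y, `|k y| <= C * weight y,
  forall i, measurable_fun setT (partial i k),
  forall i y, derivable k y (e_ i) &
  forall i y, `|partial i k y| <= C * weight y].

Lemma profile_bound tau y i (u v c : R) : `|u| <= expR (- rho y) -> `|v| <= expR (- rho y) ->
  `|2 * y ord0 i * (u + c * v)| <= 4 * (1 + `|c|) * weight y.
Proof.
move=> hu hv.
have e0 : 0 <= expR (- rho y) := expR_ge0 _.
have huv : `|u + c * v| <= (1 + `|c|) * expR (- rho y).
  by rewrite mulrDl mul1r (le_trans (ler_normD _ _))// lerD// normrM ler_wpM2l.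
have y2 : `|2 * y ord0 i| <= 1 + y ord0 i ^+ 2.
  rewrite normrM ger0_norm// -[y ord0 i ^+ 2]real_normK ?num_real//.
  by have := sqr_ge0 (`|y ord0 i| - 1); rewrite !expr2; nra.
rewrite normrM; apply: (@le_trans _ _ ((1 + y ord0 i ^+ 2) * ((1 + `|c|) * expR (- rho y)))).
  by apply: ler_pM.
by rewrite mulrCA -mulrA [leRHS]mulrCA ler_wpM2l ?addr_ge0// rho_weight.
Qed.

Lemma profile_kc tau : profile (4 * (1 + `|tau|)) (kc tau).
Proof.
have c1 : 1 <= 4 * (1 + `|tau|) by have := normr_ge0 tau; lra.
split; first exact: measurable_kc.
- move=> y; apply: le_trans (kc_le tau y) _; apply: le_trans (expR_rho_weight y) _.
  by rewrite ler_peMl// weight_ge0.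
- move=> i; rewrite partial_kc; apply: measurable_funM.
    by apply: measurable_funM => //; exact: measurable_coor.
  apply: measurable_funB; first by apply: measurableT_comp => //; exact: measurable_kc.
  by apply: measurable_funM => //; exact: measurable_ks.
- by move=> i y; have [] := is_derive_kc tau y i.
- move=> i y; rewrite partial_kc -(mulNr tau) -[`|tau|]normrN.
  by apply: profile_bound; rewrite ?normrN ?kc_le ?ks_le.
Qed.

Lemma profile_ks tau : profile (4 * (1 + `|tau|)) (ks tau).
Proof.
have c1 : 1 <= 4 * (1 + `|tau|) by have := normr_ge0 tau; lra.
split; first exact: measurable_ks.
- move=> y; apply: le_trans (ks_le tau y) _; apply: le_trans (expR_rho_weight y) _.
  by rewrite ler_peMl// weight_ge0.
- move=> i; rewrite partial_ks; apply: measurable_funM.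
    by apply: measurable_funM => //; exact: measurable_coor.
  apply: measurable_funD; first by apply: measurableT_comp => //; exact: measurable_ks.
  by apply: measurable_funM => //; exact: measurable_kc.
- by move=> i y; have [] := is_derive_ks tau y i.
- move=> i y; rewrite partial_ks.
  by apply: profile_bound; rewrite ?normrN ?kc_le ?ks_le.
Qed.

Lemma profile_integrable C k : profile C k -> mu.-integrable setT (EFin \o k).
Proof.
move=> [mk bk _ _ _]; apply: (integrable_dom (C := C) _ _ (@integrable_weight R N)) => //.
by move=> y; rewrite (ger0_norm (weight_ge0 y)).
Qed.

Lemma profile_partial_integrable C k i : profile C k -> mu.-integrable setT (EFin \o partial i k).
Proof.
move=> [_ _ mk _ bk]; apply: (integrable_dom (C := C) _ _ (@integrable_weight R N)) => //.
by move=> y; rewrite (ger0_norm (weight_ge0 y)).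
Qed.

(** A convolution with the dilated kernel, evaluated at x. For the kernel e^{-(1 - 2i)|y|^2} the
    quantity s^2 / (4 (1 - 2i)) plays the role of the time in the heat flow. *)
Definition Phi k f x s := transavg mu k (fun y => - s *: y) f x.

Lemma measurable_scalerV s : measurable_fun setT (fun y : 'rV[R]_N => s *: y).
Proof.
apply: measurable_fun_coorP => i; under eq_fun do rewrite mxE.
by apply: measurable_funM => //; exact: measurable_coor.
Qed.

(** The y-integral of the i-th partial derivative of k(y) f(x - s y) vanishes, and the derivative
    falling on f brings out -s. A derivative thus passes between function and kernel at the price of
    one factor s. *)
Lemma Phi_partial C k f x s i : profile C k -> bCoo f ->
  Phi (partial i k) f x s = s * Phi k (partial i f) x s.
Proof.
move=> pk bf; have [mk bk mk' dk bk'] := pk.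
have ik := profile_integrable pk; have ik' := profile_partial_integrable i pk.
have mth := measurable_scalerV (- s).
have i1 := integrable_transavg ik' mth x bf.
have i2 := integrable_transavg ik mth x (bCoo_partial i bf).
have [M fM] := bCoo_bounded bf; have [M' fM'] := bCoo_bounded (bCoo_partial i bf).
have i2s := integrableRZ s i2.
rewrite /Phi /transavg -RintegralZl//; apply/eqP; rewrite -subr_eq0 -RintegralB//; apply/eqP.
apply: (@Rintegral_partial i (fun y => k y * f (x + - s *: y)) _ (`|C| * (M + `|s| * M'))).
- by apply/measurable_EFinP; apply: (measurable_int mu); exact: (integrable_transavg ik mth x bf).
- move=> y.
  have d1 : is_derive y (e_ i) k (partial i k y) by apply: DeriveDef.
  have d2 : is_derive y (e_ i) (fun y => f (x + - s *: y)) (- s * partial i f (x + - s *: y)).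
    apply: derive_line.
    rewrite (_ : (fun s0 => _) = (fun u => f ((x + - s *: y) + u *: e_ i)) \o (fun t => - s * t)); last first.
      by apply/funext => t; rewrite /= scalerDr scalerA addrA.
    rewrite mulrC; apply: is_derive1_comp.
      rewrite mulr0; have := @is_derive_line _ _ f (x + - s *: y) (e_ i) 0 (bCoo_derivable bf).
      by rewrite scale0r addr0.
    by apply: is_derive_eq; rewrite /GRing.scale/=; ring.
  by apply: is_derive_eq; rewrite /GRing.scale/=; ring.
- move=> y; rewrite normrM mulrAC.
  apply: ler_pM => //; first by apply: le_trans (bk y) _; rewrite ler_wpM2r ?weight_ge0// ler_norm.
  by apply: le_trans (fM _) _; rewrite lerDl mulr_ge0// (le_trans (normr_ge0 _) (fM' 0)).
- move=> y; apply: (le_trans (ler_normB _ _)); rewrite mulrAC mulrDr; apply: lerD.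
    rewrite normrM; apply: ler_pM => //.
    by apply: le_trans (bk' i y) _; rewrite ler_wpM2r ?weight_ge0// ler_norm.
  rewrite normrM [leRHS]mulrCA ler_wpM2l// normrM; apply: ler_pM => //.
  by apply: le_trans (bk y) _; rewrite ler_wpM2r ?weight_ge0// ler_norm.
Qed.

Lemma Rintegral_sum d (T : measurableType d) (m : {measure set T -> \bar R})
    (I : Type) (r : seq I) (F : I -> T -> R) :
  (forall j, m.-integrable setT (EFin \o F j)) ->
  m.-integrable setT (EFin \o (fun z => \sum_(j <- r) F j z)) /\
  \int[m]_z (\sum_(j <- r) F j z) = \sum_(j <- r) \int[m]_z F j z.
Proof.
move=> iF; elim: r => [|j r [IH1 IH2]].
  rewrite big_nil; under eq_fun do rewrite big_nil.
  by split; [exact: integrable0|rewrite Rintegral_cst ?mul0r].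
have E : (fun z => \sum_(j <- j :: r) F j z) = (fun z => F j z + \sum_(j <- r) F j z).
  by apply/funext => z; rewrite big_cons.
rewrite E big_cons; split; last by rewrite RintegralD// IH2.
exact: integrableRD.
Qed.

Lemma is_derive_Phi C k f x s : profile C k -> bCoo f ->
  (forall i y, `|y ord0 i * k y| <= C * weight y) ->
  is_derive s 1 (Phi k f x)
    (- \sum_i \int[mu]_y (y ord0 i * k y * partial i f (x + - s *: y))).
Proof.
move=> pk bf byk; have [mk bk mk' dk bk'] := pk.
have ik := profile_integrable pk.
have C0 : 0 <= C.
  have := le_trans (normr_ge0 _) (bk 0); rewrite pmulr_lge0//; apply: prodr_gt0 => j _.
  by rewrite invr_gt0 ltr_wpDr ?sqr_ge0.
have hM i : exists M : R, forall x, `|partial i f x| <= M by exact/bCoo_bounded/bCoo_partial.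
pose M i := projT1 (cid (hM i)).
have HM i z : `|partial i f z| <= M i by rewrite /M; case: cid.
have dF (t : R) y : is_derive t 1 (fun t => k y * f (x + - t *: y))
    (k y * - \sum_i y ord0 i * partial i f (x + - t *: y)).
  have dl := bCoo_is_derive_line x (- y) t bf.
  have E : (fun t => f (x + - t *: y)) = (fun t => f (x + t *: - y)).
    by apply/funext => u; rewrite scalerN scaleNr.
  have -> : - \sum_i y ord0 i * partial i f (x + - t *: y) =
      \sum_i (- y) ord0 i * partial i f (x + t *: - y).
    by rewrite -sumrN; apply: eq_bigr => i _; rewrite mxE mulNr scalerN scaleNr.
  have dl' : is_derive t 1 (fun t => f (x + - t *: y)) (\sum_i (- y) ord0 i * partial i f (x + t *: - y)).
    by rewrite E.
  by apply: is_derive_eq.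
have H0 : (`]s - 1, s + 1[%classic : set R) s by rewrite /= in_itv/= ltrBlDr ltrDl ltr01.
have i0 (t : R) : `]s - 1, s + 1[%classic t -> mu.-integrable setT (EFin \o (fun y => k y * f (x + - t *: y))).
  by move=> _; apply: integrable_transavg => //; exact: measurable_scalerV.
have d0 (t : R) y : `]s - 1, s + 1[%classic t -> setT y -> derivable (fun t => k y * f (x + - t *: y)) t 1.
  by move=> _ _; have [] := dF t y.
pose G y := (C * \sum_i M i) * weight y.
have SM0 : 0 <= \sum_i M i.
  by apply: sumr_ge0 => i _; exact: le_trans (normr_ge0 _) (HM i 0).
have G0 y : 0 <= G y by rewrite mulr_ge0 ?weight_ge0// mulr_ge0.
have iG : mu.-integrable setT (EFin \o G).
  apply: (integrable_dom (C := `|C * \sum_i M i|) _ _ (@integrable_weight R N)).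
    by apply: measurable_funM => //; exact: measurable_weight.
  by move=> y; rewrite normrM.
have GF (t : R) y : `]s - 1, s + 1[%classic t -> setT y ->
    `|partial1of2 (fun t y => k y * f (x + - t *: y)) t y| <= G y.
  move=> _ _; rewrite partial1of2E; have [_ ->] := dF t y.
  rewrite mulrN normrN mulr_sumr; apply: le_trans (ler_norm_sum _ _ _) _.
  rewrite /G mulrAC mulr_sumr; apply: ler_sum => i _.
  by rewrite mulrA normrM [k y * _]mulrC ler_pM.
have ET := differentiation_under_integral measurableT H0 i0 d0 G0 iG GF.
have dT := derivable_under_integral measurableT H0 i0 d0 G0 iG GF.
apply: DeriveDef; first exact: dT.
rewrite derive1E in ET; rewrite /Phi /transavg ET.
have iS i : mu.-integrable setT (EFin \o (fun y => y ord0 i * k y * partial i f (x + - s *: y))).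
  apply: (integrable_dom (C := C * M i) _ _ (@integrable_weight R N)).
    apply: measurable_funM; first by apply: measurable_funM => //; exact: measurable_coor.
    apply: (@measurable_translate _ _ _ _ _ (measurable_scalerV (- s))).
    by apply: bCoo_measurable; exact: bCoo_partial.
  move=> y; rewrite normrM (ger0_norm (weight_ge0 y)) mulrAC.
  by apply: ler_pM.
have [iSS <-] := Rintegral_sum (index_enum _) iS.
rewrite -mulN1r -RintegralZl//.
apply: eq_Rintegral => y _; rewrite partial1of2E; have [_ ->] := dF s y.
by rewrite mulN1r mulrN mulr_sumr; congr (- _); apply: eq_bigr => i _; ring.
Qed.

Definition lap f x : R := \sum_i partial i (partial i f) x.

Lemma bCoo_lap f : bCoo f -> bCoo (lap f).
Proof. by move=> bf; apply: bCoo_sum => i; do 2 apply: bCoo_partial. Qed.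

Lemma transavg_sum d (O : measurableType d) (m : {sigma_finite_measure set O -> \bar R}) (K : O -> R)
    (th : O -> 'rV[R]_N) (I : Type) (r : seq I) (F : I -> 'rV[R]_N -> R) x :
  m.-integrable setT (EFin \o K) -> measurable_fun setT th -> (forall j, bCoo (F j)) ->
  transavg m K th (fun x => \sum_(j <- r) F j x) x = \sum_(j <- r) transavg m K th (F j) x.
Proof.
move=> iK mth bF; rewrite /transavg.
rewrite -(Rintegral_sum r (fun j => integrable_transavg iK mth x (bF j))).2.
by apply: eq_Rintegral => z _; rewrite mulr_sumr.
Qed.

Section complex_gaussian.
Variables (f : 'rV[R]_N -> R) (x : 'rV[R]_N).
Hypothesis bf : bCoo f.

(** [partial_kc] and [partial_ks] form a linear system for y_i [kc 2] and y_i [ks 2], with 2 (1 +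
    2^2) = 10 in the denominator of its inverse. The factor y_i produced by differentiating in s
    thereby becomes a derivative of the kernel, which [Phi_partial] can move to f. *)
Lemma kc2E y i : y ord0 i * kc 2 y = - 10^-1 * (partial i (kc 2) y - 2 * partial i (ks 2) y).
Proof. by rewrite partial_kc partial_ks; field. Qed.

Lemma ks2E y i : y ord0 i * ks 2 y = - 10^-1 * (partial i (ks 2) y + 2 * partial i (kc 2) y).
Proof. by rewrite partial_kc partial_ks; field. Qed.

Let pc := profile_kc 2.
Let ps := profile_ks 2.

Lemma yk2_bound i y : `|y ord0 i * kc 2 y| <= 4 * (1 + `|2|) * weight y /\
  `|y ord0 i * ks 2 y| <= 4 * (1 + `|2|) * weight y.
Proof.
have [_ _ _ _ /(_ i y) h1] := pc; have [_ _ _ _ /(_ i y) h2] := ps.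
rewrite kc2E ks2E; move: h1 h2; set w := _ * weight y; rewrite !ler_norml.
by move=> /andP[? ?] /andP[? ?]; split; apply/andP; split; lra.
Qed.

Let PhiB k1 k2 (c : R) g : profile (4 * (1 + `|2|)) k1 -> profile (4 * (1 + `|2|)) k2 -> bCoo g -> forall s i,
  \int[mu]_y (- 10^-1 * (partial i k1 y + c * partial i k2 y) * g (x + - s *: y)) =
  - 10^-1 * (s * Phi k1 (partial i g) x s + c * (s * Phi k2 (partial i g) x s)).
Proof.
move=> p1 p2 bg s i; have mth := measurable_scalerV (- s).
rewrite -(Phi_partial _ _ _ p1 bg) -(Phi_partial _ _ _ p2 bg).
have i1 := integrable_transavg (profile_partial_integrable i p1) mth x bg.
have i2 := integrable_transavg (profile_partial_integrable i p2) mth x bg.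
have i2c := integrableRZ c i2.
rewrite /Phi /transavg -[c * _]RintegralZl// -RintegralD// -RintegralZl//.
  by apply: eq_Rintegral => y _; ring.
exact: integrableRD.
Qed.

(** Real part of the heat equation Phi' = s / (2 (1 - 2i)) Phi(lap f), since 1 / (2 (1 - 2i)) = (1 +
    2i) / 10; [is_derive_Phis] is the imaginary part. *)
Lemma is_derive_Phic s : is_derive s 1 (Phi (kc 2) f x)
  (s / 10 * (Phi (kc 2) (lap f) x s - 2 * Phi (ks 2) (lap f) x s)).
Proof.
apply: is_derive_eq (is_derive_Phi _ _ pc bf (fun i y => (yk2_bound i y).1)) _.
under eq_bigr => i _.
  under eq_Rintegral => y _ do rewrite kc2E -mulNr.
  rewrite PhiB//; last exact: bCoo_partial.
  over.
rewrite /Phi !transavg_sum//; try exact: measurable_scalerV;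
  try (by move=> i; do 2 apply: bCoo_partial);
  try exact: (profile_integrable pc); try exact: (profile_integrable ps).
rewrite mulr_sumr -sumrB mulr_sumr -sumrN; apply: eq_bigr => i _; by field.
Qed.

Lemma is_derive_Phis s : is_derive s 1 (Phi (ks 2) f x)
  (s / 10 * (Phi (ks 2) (lap f) x s + 2 * Phi (kc 2) (lap f) x s)).
Proof.
apply: is_derive_eq (is_derive_Phi _ _ ps bf (fun i y => (yk2_bound i y).2)) _.
under eq_bigr => i _.
  under eq_Rintegral => y _ do rewrite ks2E.
  rewrite PhiB//; last exact: bCoo_partial.
  over.
rewrite /Phi !transavg_sum//; try exact: measurable_scalerV;
  try (by move=> i; do 2 apply: bCoo_partial);
  try exact: (profile_integrable pc); try exact: (profile_integrable ps).
rewrite mulr_sumr -big_split mulr_sumr -sumrN; apply: eq_bigr => i _ /=; by field.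
Qed.

End complex_gaussian.

End gaussians.

(** * The integral of the complex Gaussian is not zero *)

Section gaussian_integral.
Context {R : realType} {N : nat}.
Implicit Types (x y : 'rV[R]_N) (i : 'I_N) (tau : R).

Local Notation e_ i := (delta_mx ord0 i : 'rV[R]_N).
Local Notation mu := (@lebesgue_rV R N).

Definition Zc tau := \int[mu]_y kc tau y.
Definition Zs tau := \int[mu]_y ks tau y.
Let Wc tau := \int[mu]_y (rho y * kc tau y).
Let Ws tau := \int[mu]_y (rho y * ks tau y).

Lemma rho_ge0 y : 0 <= rho y.
Proof. by apply: sumr_ge0 => i _; exact: sqr_ge0. Qed.

Lemma rho_expR_weight y : rho y * expR (- rho y) <= N%:R * 4 * weight y.
Proof.
rewrite [X in X * _]/rho mulr_suml.
apply: (@le_trans _ _ (\sum_(i < N) 4 * weight y)).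
  apply: ler_sum => i _; apply: le_trans (rho_weight y i).
  by rewrite ler_wpM2r ?expR_ge0// lerDr.
by rewrite sumr_const card_ord -[leLHS]mulr_natl mulrA.
Qed.

Let mrk tau : measurable_fun setT (fun y => rho y * kc tau y).
Proof. by apply: measurable_funM; [exact: measurable_rho|exact: measurable_kc]. Qed.
Let mrs tau : measurable_fun setT (fun y => rho y * ks tau y).
Proof. by apply: measurable_funM; [exact: measurable_rho|exact: measurable_ks]. Qed.
Let brk tau y : `|rho y * kc tau y| <= N%:R * 4 * weight y.
Proof.
rewrite normrM (ger0_norm (rho_ge0 y)); apply: le_trans (rho_expR_weight y).
by rewrite ler_wpM2l ?rho_ge0// kc_le.
Qed.
Let brs tau y : `|rho y * ks tau y| <= N%:R * 4 * weight y.
Proof.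
rewrite normrM (ger0_norm (rho_ge0 y)); apply: le_trans (rho_expR_weight y).
by rewrite ler_wpM2l ?rho_ge0// ks_le.
Qed.
Let irk tau : mu.-integrable setT (EFin \o (fun y => rho y * kc tau y)).
Proof.
apply: (integrable_dom (C := N%:R * 4) _ _ (@integrable_weight R N)) => // y.
by rewrite (ger0_norm (weight_ge0 y)).
Qed.
Let irs tau : mu.-integrable setT (EFin \o (fun y => rho y * ks tau y)).
Proof.
apply: (integrable_dom (C := N%:R * 4) _ _ (@integrable_weight R N)) => // y.
by rewrite (ger0_norm (weight_ge0 y)).
Qed.
Let ikc tau : mu.-integrable setT (EFin \o kc tau) := profile_integrable (profile_kc tau).
Let iks tau : mu.-integrable setT (EFin \o ks tau) := profile_integrable (profile_ks tau).

(** The integrand is the i-th partial derivative of y_i k(y). *)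
Let coor_ibp (k k' : 'rV[R]_N -> R) (c : R) tau i : measurable_fun setT k ->
  (forall y, `|k y| <= expR (- rho y)) -> (forall y, `|k' y| <= (1 + `|tau|) * expR (- rho y)) ->
  (forall y, is_derive y (e_ i) k (2 * y ord0 i * k' y)) ->
  \int[mu]_y (k y + 2 * (y ord0 i ^+ 2 * k' y)) = 0.
Proof.
move=> mk bk bk' dk.
apply: (@Rintegral_partial _ _ i (fun y => y ord0 i * k y) _ (12 * (1 + `|tau|))).
- by apply: measurable_funM => //; exact: measurable_coor.
- move=> y.
  have dy : is_derive y (e_ i) (fun y : 'rV[R]_N => y ord0 i) 1.
    apply: derive_line; under eq_fun do rewrite !mxE !eqxx.
    by apply: is_derive_eq; rewrite /GRing.scale/=; ring.
  by apply: is_derive_eq; rewrite /GRing.scale/=; ring.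
- move=> y; have := rho_weight y i; have := bk y; have := weight_ge0 y.
  have := expR_ge0 (- rho y); have : `|y ord0 i| <= 1 + y ord0 i ^+ 2.
    rewrite -[y ord0 i ^+ 2]real_normK ?num_real//.
    by have := sqr_ge0 (`|y ord0 i| - 1); rewrite !expr2; nra.
  rewrite normrM => h1 h2 h3 h4 h5.
  apply: (@le_trans _ _ ((1 + y ord0 i ^+ 2) * expR (- rho y))); first exact: ler_pM.
  by apply: le_trans h5 _; rewrite ler_wpM2r//; have := normr_ge0 tau; lra.
- move=> y; apply: le_trans (ler_normD _ _) _.
  rewrite normrM [`|2|]ger0_norm// normrM [`|_ ^+ 2|]ger0_norm ?sqr_ge0//.
  have h5 := rho_weight y i; have h4 := bk y; have h4' := bk' y; have h3 := weight_ge0 y.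
  have h2 := expR_ge0 (- rho y); have t0 := normr_ge0 tau; have y0 := sqr_ge0 (y ord0 i).
  have h6 : y ord0 i ^+ 2 * `|k' y| <= (1 + `|tau|) * (4 * weight y).
    apply: (@le_trans _ _ (y ord0 i ^+ 2 * ((1 + `|tau|) * expR (- rho y)))).
      by rewrite ler_wpM2l.
    rewrite mulrCA ler_wpM2l ?addr_ge0//; apply: le_trans h5.
    by rewrite ler_wpM2r// lerDr.
  have h7 : expR (- rho y) <= 4 * weight y.
    by apply: le_trans h5; rewrite ler_peMl// lerDl.
  have tw : 0 <= `|tau| * weight y by rewrite mulr_ge0.
  by apply: (@le_trans _ _ (4 * weight y + 2 * ((1 + `|tau|) * (4 * weight y)))); nra.
Qed.

(** In complex form N Z = 2 (1 - i tau) W, with Z = [Zc] + i [Zs] and W = [Wc] + i [Ws]: the sum of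
    [coor_ibp] over the coordinates. Combined with Z' = i W, it is a linear differential equation
    for Z. *)
Let ZW tau : N%:R * Zc tau = 2 * (Wc tau + tau * Ws tau) /\
             N%:R * Zs tau = 2 * (Ws tau - tau * Wc tau).
Proof.
have H (k k' : 'rV[R]_N -> R) : mu.-integrable setT (EFin \o k) ->
    (forall i, measurable_fun setT (fun y => y ord0 i ^+ 2 * k' y)) ->
    (forall y, `|k' y| <= (1 + `|tau|) * expR (- rho y)) ->
    (forall i, \int[mu]_y (k y + 2 * (y ord0 i ^+ 2 * k' y)) = 0) ->
    N%:R * \int[mu]_y k y = - 2 * \int[mu]_y (rho y * k' y).
  move=> ik mk bk Hk.
  have ii i : mu.-integrable setT (EFin \o (fun y => y ord0 i ^+ 2 * k' y)).
    apply: (integrable_dom (C := 4 * (1 + `|tau|)) _ _ (@integrable_weight R N)) => // y.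
    rewrite (ger0_norm (weight_ge0 y)) normrM [`|_ ^+ 2|]ger0_norm ?sqr_ge0//.
    have t0 := normr_ge0 tau.
    apply: (@le_trans _ _ (y ord0 i ^+ 2 * ((1 + `|tau|) * expR (- rho y)))).
      by rewrite ler_wpM2l ?sqr_ge0.
    rewrite [leLHS]mulrCA (_ : 4 * (1 + `|tau|) * weight y = (1 + `|tau|) * (4 * weight y)); last by ring.
    rewrite ler_wpM2l ?addr_ge0//; apply: le_trans (rho_weight y i).
    by rewrite ler_wpM2r ?expR_ge0// lerDr.
  have E i : \int[mu]_y k y = - 2 * \int[mu]_y (y ord0 i ^+ 2 * k' y).
    have := Hk i; rewrite RintegralD//; last exact: integrableRZ.
    by rewrite RintegralZl// => h; lra.
  transitivity (\sum_(i < N) \int[mu]_y k y); first by rewrite sumr_const card_ord -[RHS]mulr_natl.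
  rewrite (eq_bigr (fun i : 'I_N => - 2 * \int[mu]_y (y ord0 i ^+ 2 * k' y))); last by move=> i _; exact: E.
  rewrite -mulr_sumr -(Rintegral_sum _ ii).2; congr (_ * _).
  by apply: eq_Rintegral => y _; rewrite /rho mulr_suml.
have bl (u v c : R) y : `|c| = `|tau| -> `|u| <= expR (- rho y) -> `|v| <= expR (- rho y) ->
    `|u + c * v| <= (1 + `|tau|) * expR (- rho y).
  move=> ct hu hv; apply: le_trans (ler_normD _ _) _; rewrite mulrDl mul1r lerD//.
  by rewrite normrM ct ler_wpM2l.
have mks := @measurable_ks R N tau; have mkc := @measurable_kc R N tau.
have mc i : measurable_fun setT (fun y : 'rV[R]_N => y ord0 i ^+ 2).
  by apply: measurable_funX; exact: measurable_coor.
split.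
- have := H (kc tau) (fun y => - kc tau y + (- tau) * ks tau y) (ikc tau) => ->.
  + rewrite (@eq_Rintegral _ _ _ mu _ (fun y => (-1) * (rho y * kc tau y + tau * (rho y * ks tau y)))); last first.
      by move=> y _; ring.
    rewrite RintegralZl//; last by apply: integrableRD => //; exact: integrableRZ.
    rewrite RintegralD//; last exact: integrableRZ.
    by rewrite RintegralZl// /Wc /Ws; ring.
  + move=> i; apply: measurable_funM => //; apply: measurable_funD.
      by apply: measurableT_comp.
    exact: measurable_funM.
  + by move=> y; apply: bl; rewrite ?normrN// ?kc_le ?ks_le.
  + move=> i; apply: (@coor_ibp _ _ 0 tau) => //.
    * by move=> y; exact: kc_le.
    * by move=> y; apply: bl; rewrite ?normrN// ?kc_le ?ks_le.
    * by move=> y; have := is_derive_kc tau y i; rewrite mulNr.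
- have := H (ks tau) (fun y => - ks tau y + tau * kc tau y) (iks tau) => ->.
  + rewrite (@eq_Rintegral _ _ _ mu _ (fun y => (-1) * (rho y * ks tau y + (- tau) * (rho y * kc tau y)))); last first.
      by move=> y _; ring.
    rewrite RintegralZl//; last by apply: integrableRD => //; exact: integrableRZ.
    rewrite RintegralD//; last exact: integrableRZ.
    by rewrite RintegralZl// /Wc /Ws; ring.
  + move=> i; apply: measurable_funM => //; apply: measurable_funD.
      by apply: measurableT_comp.
    exact: measurable_funM.
  + by move=> y; apply: bl; rewrite ?normrN// ?kc_le ?ks_le.
  + move=> i; apply: (@coor_ibp _ _ 0 tau) => //.
    * by move=> y; exact: ks_le.
    * by move=> y; apply: bl; rewrite ?normrN// ?kc_le ?ks_le.
    * by move=> y; exact: is_derive_ks tau y i.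
Qed.

Let is_derive_Z (k k' : R -> 'rV[R]_N -> R) tau :
  (forall t, mu.-integrable setT (EFin \o k t)) ->
  (forall (t : R) y, is_derive t 1 (k ^~ y) (k' t y)) ->
  (forall t y, `|k' t y| <= N%:R * 4 * weight y) ->
  is_derive tau 1 (fun t => \int[mu]_y k t y) (\int[mu]_y k' tau y).
Proof.
move=> ik dk bk.
have H0 : (`]tau - 1, tau + 1[%classic : set R) tau by rewrite /= in_itv/= ltrBlDr ltrDl ltr01.
have i0 (t : R) : `]tau - 1, tau + 1[%classic t -> mu.-integrable setT (EFin \o k t) by [].
have d0 (t : R) y : `]tau - 1, tau + 1[%classic t -> setT y -> derivable (k ^~ y) t 1.
  by move=> _ _; have [] := dk t y.
have G0 y : 0 <= N%:R * 4 * weight y by rewrite mulr_ge0 ?weight_ge0.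
have iG : mu.-integrable setT (EFin \o (fun y => N%:R * 4 * weight y)).
  exact: integrableRZ (@integrable_weight R N).
have GF (t : R) y : `]tau - 1, tau + 1[%classic t -> setT y ->
    `|partial1of2 k t y| <= N%:R * 4 * weight y.
  by move=> _ _; rewrite partial1of2E; have [_ ->] := dk t y.
have ET := differentiation_under_integral measurableT H0 i0 d0 G0 iG GF.
have dT := derivable_under_integral measurableT H0 i0 d0 G0 iG GF.
apply: DeriveDef; first exact: dT.
rewrite derive1E in ET; rewrite ET.
by apply: eq_Rintegral => y _; rewrite partial1of2E; have [_ ->] := dk tau y.
Qed.

Let is_derive_Zc tau : is_derive tau 1 Zc (- Ws tau).
Proof.
have d (t : R) y : is_derive t 1 ((fun t y => kc t y) ^~ y) (- (rho y * ks t y)).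
  have dc : is_derive t 1 (fun t : R => cos (t * rho y)) (- sin (t * rho y) * rho y).
    apply: (@is_derive1_comp _ cos (fun t : R => t * rho y)).
    by apply: is_derive_eq; rewrite /GRing.scale/=; ring.
  by rewrite /kc /ks /gc /gs; apply: is_derive_eq; rewrite /GRing.scale/=; ring.
have := @is_derive_Z _ _ tau ikc d; rewrite (_ : \int[mu]_y _ = - Ws tau); last first.
  rewrite (@eq_Rintegral _ _ _ mu _ (fun y => (-1) * (rho y * ks tau y))); last by move=> y _; ring.
  by rewrite RintegralZl// mulN1r.
by apply=> t y; rewrite normrN.
Qed.

Let is_derive_Zs tau : is_derive tau 1 Zs (Wc tau).
Proof.
have d (t : R) y : is_derive t 1 ((fun t y => ks t y) ^~ y) (rho y * kc t y).
  have dc : is_derive t 1 (fun t : R => sin (t * rho y)) (cos (t * rho y) * rho y).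
    apply: (@is_derive1_comp _ sin (fun t : R => t * rho y)).
    by apply: is_derive_eq; rewrite /GRing.scale/=; ring.
  by rewrite /kc /ks /gc /gs; apply: is_derive_eq; rewrite /GRing.scale/=; ring.
exact: (@is_derive_Z _ _ tau iks d).
Qed.

(** At tau = 0 the integrand is e^{-|y|^2}, which is at least e^{-N} on the cube [-1, 1]^N. *)
Let Zc0 : 0 < Zc 0.
Proof.
pose B : set 'rV[R]_N := [set y | forall i, (const_mx (-1) : 'rV[R]_N) ord0 i <= y ord0 i <= (const_mx 1 : 'rV[R]_N) ord0 i].
have mB : measurable B.
  rewrite (_ : B = \bigcap_(i : 'I_N)
     ((fun x : 'rV[R]_N => x ord0 i : measurableTypeR R) @^-1` `[(-1 : R), 1]%classic)).
    apply: fin_bigcap_measurable => // i _.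
    by rewrite -[X in measurable X]setTI; exact: measurable_coor.
  apply/seteqP; split=> x /= H i; first by move=> _ /=; have := H i; rewrite !mxE in_itv.
  by have := H i I; rewrite /= in_itv !mxE.
have HB : mu B = (\prod_(i < N) (1 - (-1 : R)))%:E.
  have := @lebesgue_rV_box R N (const_mx (-1)) (const_mx 1).
  move=> ->; last by move=> i; rewrite !mxE; lra.
  by congr EFin; apply: eq_bigr => i _; rewrite !mxE.
have iB : mu.-integrable setT (EFin \o (fun y => expR (- N%:R) * \1_B y)).
  apply: integrableRZ; apply/integrableP; split; first exact/measurable_EFinP/measurable_indic.
  under eq_integral do rewrite /= ger0_norm//.
  by rewrite integral_indic ?setIT// [X in (X < _)%E]HB ltry.
apply: (@lt_le_trans _ _ (\int[mu]_y (expR (- N%:R) * \1_B y))).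
  rewrite /Rintegral; under eq_integral do rewrite EFinM.
  rewrite ge0_integralZl//; last exact/measurable_EFinP/measurable_indic.
  rewrite integral_indic// setIT [X in (_ * X)%E]HB /= mulr_gt0 ?expR_gt0// prodr_gt0// => i _.
apply: le_Rintegral => // y _.
rewrite /kc /gc mul0r cos0 mulr1 indicE.
have [yB|yB] := pselect (B y); last by rewrite memNset// mulr0 expR_ge0.
rewrite mem_set// mulr1 ler_expR lerN2 /rho.
apply: (@le_trans _ _ (\sum_(i < N) 1)); last by rewrite sumr_const card_ord.
apply: ler_sum => i _; have := yB i; rewrite !mxE => /andP[? ?].
by rewrite -real_normK ?num_real// exprn_ile1// ler_norml; apply/andP.
Qed.

(* |Z|^2 for Z(tau) = \int e^{-(1 + i tau)|y|^2} satisfies a linear equation,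
   (1 + tau^2)(|Z|^2)' = - N tau |Z|^2 *)
Lemma gaussian_integral_neq0 tau : 0 < Zc tau ^+ 2 + Zs tau ^+ 2.
Proof.
pose E t := Zc t ^+ 2 + Zs t ^+ 2.
(* The integrating factor for E would be (1 + t^2)^{N/2}; squaring keeps the exponent an integer. *)
pose Q t := (1 + t ^+ 2) ^+ N * E t ^+ 2.
have dQ (t : R) : is_derive t 1 Q 0.
  have d1 := is_derive_exprn 2 (is_derive_Zc t).
  have d2 := is_derive_exprn 2 (is_derive_Zs t).
  have dE : is_derive t 1 E (2 * (Zs t * Wc t - Zc t * Ws t)).
    by apply: is_derive_eq; rewrite /=; ring.
  have dE2 := is_derive_exprn 2 dE.
  have dt2 := is_derive_exprn 2 (is_derive_id t 1).
  have d3 : is_derive t 1 (fun t => 1 + t ^+ 2) (2 * t).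
    by apply: is_derive_eq; rewrite /=; ring.
  have d4 := is_derive_exprn N d3.
  apply: is_derive_eq; rewrite /GRing.scale/=.
  have t1 : 1 + t ^+ 2 != 0 by rewrite gt_eqF// ltr_wpDr ?sqr_ge0.
  have [ZW1 ZW2] := ZW t.
  have q1 : 2 * (1 + t ^+ 2) != 0 by rewrite mulf_neq0.
  have WcE : Wc t = N%:R * (Zc t - t * Zs t) / (2 * (1 + t ^+ 2)).
    apply: (mulIf q1); rewrite divfK//.
    rewrite (_ : N%:R * (Zc t - t * Zs t) = N%:R * Zc t - t * (N%:R * Zs t)); last by ring.
    by rewrite ZW1 ZW2; ring.
  have WsE : Ws t = N%:R * (Zs t + t * Zc t) / (2 * (1 + t ^+ 2)).
    apply: (mulIf q1); rewrite divfK//.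
    rewrite (_ : N%:R * (Zs t + t * Zc t) = N%:R * Zs t + t * (N%:R * Zc t)); last by ring.
    by rewrite ZW1 ZW2; ring.
  rewrite WcE WsE /E.
  case: (N) => [|n] /=; first by rewrite !mul0r; ring.
  by rewrite exprS; field.
have Qtau : Q tau = Q 0.
  apply/eqP; rewrite -subr_eq0 -normr_le0 -[leRHS](mul0r `|tau - 0|).
  by apply: (mvt_abs dQ) => t _; rewrite normr0.
have E0 : 0 <= E tau by rewrite addr_ge0 ?sqr_ge0.
rewrite lt_def E0 andbT; apply/eqP => Etau.
have : Q tau = 0 by rewrite /Q /E Etau expr0n/= mulr0.
rewrite Qtau /Q expr0n/= addr0 expr1n mul1r => /eqP; rewrite expf_eq0/= /E.
rewrite gt_eqF// ltr_wpDr ?sqr_ge0// exprn_gt0//.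
Qed.

End gaussian_integral.

(** * Gaussians and the fundamental theorem of calculus on the half-line *)

Section half_line.
Context {R : realType}.
Implicit Types (A C s t : R) (F h H : R -> R).

Local Notation lam := (@lebesgue_measure R).
Local Notation D := (`[0, +oo[%classic : set R).

Lemma is_derive_continuous F h : (forall t : R, is_derive t 1 F (h t)) -> continuous F.
Proof.
move=> dF t; apply: differentiable_continuous; apply/derivable1_diffP.
by have [] := dF t.
Qed.

Lemma half_line_FTC_ge0 F h (l : R) : (forall t : R, is_derive t 1 F (h t)) ->
  continuous h -> (forall s, 0 <= s -> 0 <= h s) -> F s @[s --> +oo] --> l ->
  lam.-integrable D (EFin \o h) /\ \int[lam]_(s in D) h s = l - F 0.
Proof.
move=> dF ch h0 Fl; have cF := is_derive_continuous dF.
have E : (\int[lam]_(s in D) (h s)%:E = l%:E - (F 0)%:E)%E.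
  apply: ge0_continuous_FTC2y => //.
  - by apply: continuous_subspaceT => s; exact: ch.
  - by apply: cvg_at_right_filter; exact: cF.
  - by move=> s _; rewrite derive1E; have [_ ->] := dF s.
split; last by rewrite /Rintegral E.
apply/integrableP; split.
  by apply/measurable_EFinP; apply: measurable_funTS; exact: measurable_realfun.continuous_measurable_fun.
rewrite (@eq_integral _ _ _ lam D (fun s => (h s)%:E)) ?E ?ltry// => s.
by rewrite inE/= in_itv/= andbT => s0; rewrite ger0_norm// h0.
Qed.

Definition gau A s := expR (- A * s ^+ 2).

Lemma is_derive_gau A s : is_derive s 1 (gau A) (- 2 * A * (s * gau A s)).
Proof.
have d2 := is_derive_exprn 2 (is_derive_id s 1).
have : is_derive s 1 (fun t => - A * t ^+ 2) (- 2 * A * s).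
  by apply: is_derive_eq; rewrite /GRing.scale/=; ring.
move=> d1; apply: is_derive_eq.
by rewrite /gau; ring.
Qed.

Lemma gau_le A s : 0 < A -> gau A s <= (1 + A * s ^+ 2)^-1.
Proof.
move=> A0; rewrite /gau mulNr expRN lef_pV2 ?posrE ?expR_gt0 ?expR_ge1Dx//.
by rewrite ltr_wpDr// mulr_ge0 ?(ltW A0) ?sqr_ge0.
Qed.

Lemma cvgy_gau A : 0 < A -> gau A s @[s --> +oo] --> (0 : R).
Proof.
have key (e B s : R) : 0 < B -> 0 < e -> s <= s ^+ 2 -> 1 <= B * e * s -> 1 <= e * (1 + B * s ^+ 2).
  move=> B0 e0 h1 h2; have Be : 0 <= B * e by rewrite mulr_ge0 ?ltW.
  by apply: (le_trans h2); have := ler_wpM2l Be h1; lra.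
move=> A0; apply/cvgrPdist_le => e e0; near=> s.
rewrite sub0r normrN ger0_norm ?expR_ge0//; apply: le_trans (gau_le s A0) _.
have s1 : 1 <= s by near: s; apply: nbhs_pinfty_ge; rewrite num_real.
have se : (A * e)^-1 <= s by near: s; apply: nbhs_pinfty_ge; rewrite num_real.
have As : 0 < A * s ^+ 2 by rewrite mulr_gt0// exprn_gt0// (lt_le_trans ltr01).
have : 1 <= A * e * s by rewrite -ler_pdivrMl ?mulr_gt0// mulr1.
have : s <= s ^+ 2 by rewrite expr2 ler_peMl// (le_trans ler01).
move=> h1 h2; rewrite -[leLHS]mul1r ler_pdivrMr ?addr_gt0//.
exact: key.
Unshelve. all: by end_near. Qed.

Lemma integral_sgau A : 0 < A -> lam.-integrable D (EFin \o (fun s => s * gau A s)) /\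
  \int[lam]_(s in D) (s * gau A s) = (2 * A)^-1.
Proof.
move=> A0; have A2 : 2 * A != 0 by rewrite mulf_neq0// gt_eqF.
have dF (t : R) : is_derive t 1 (fun s => - (2 * A)^-1 * gau A s) (t * gau A t).
  have := is_derive_gau A t => dg; apply: is_derive_eq; rewrite /GRing.scale/=.
  by field; rewrite gt_eqF.
have [] := half_line_FTC_ge0 dF (l := - (2 * A)^-1 * 0).
- move=> s; apply: continuousM; first exact: cvg_id.
  exact: (is_derive_continuous (is_derive_gau A)).
- by move=> s s0; rewrite mulr_ge0// expR_ge0.
- by apply: cvgM; [exact: cvg_cst|exact: cvgy_gau].
move=> -> ->; split=> //.
by rewrite mulr0 sub0r /gau expr0n/= mulr0 expR0 mulr1 opprK.
Qed.

(** The majorant 1 / (1 + A s^2) has an arctangent as primitive; what matters later is the order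
    A^{-1/2}. *)
Lemma integral_gau A : 0 < A -> lam.-integrable D (EFin \o gau A) /\
  \int[lam]_(s in D) gau A s <= pi / 2 / Num.sqrt A.
Proof.
move=> A0; have q0 : 0 < Num.sqrt A by rewrite sqrtr_gt0.
have qq : Num.sqrt A ^+ 2 = A by rewrite sqr_sqrtr// ltW.
have n0 s : 1 + A * s ^+ 2 != 0.
  by rewrite gt_eqF// ltr_wpDr// mulr_ge0 ?(ltW A0) ?sqr_ge0.
have dF (t : R) : is_derive t 1 (fun s => (Num.sqrt A)^-1 * atan (Num.sqrt A * s)) (1 + A * t ^+ 2)^-1.
  have d1 : is_derive t 1 (fun s => Num.sqrt A * s) (Num.sqrt A).
    by apply: is_derive_eq; rewrite /GRing.scale/=; ring.
  have d2 := is_derive1_comp (is_derive1_atan (Num.sqrt A * t)) d1.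
  apply: is_derive_eq; rewrite /GRing.scale/= exprMn qq.
  by field; rewrite n0 gt_eqF.
have q1 s : 0 <= (1 + A * s ^+ 2)^-1.
  by rewrite invr_ge0 addr_ge0// mulr_ge0 ?(ltW A0) ?sqr_ge0.
have cq : continuous (fun s => (1 + A * s ^+ 2)^-1).
  move=> s; apply: cvgV; first exact: n0.
  apply: cvgD; first exact: cvg_cst.
  by apply: cvgM; [exact: cvg_cst|exact: exprn_continuous].
have cl : (Num.sqrt A)^-1 * atan (Num.sqrt A * s) @[s --> +oo] --> (Num.sqrt A)^-1 * (pi / 2).
  apply: cvgM; first exact: cvg_cst.
  apply: (cvg_comp _ _ _ (@cvgy_atan R)).
  by apply: gt0_cvgMlNy || (apply/cvgryPge => M; near=> s; rewrite -ler_pdivrMl//; near: s; apply: nbhs_pinfty_ge; rewrite num_real).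
have [i1 E1] := half_line_FTC_ge0 dF cq (fun s _ => q1 s) cl.
have i0 : lam.-integrable D (EFin \o gau A).
  apply: le_integrable i1 => //.
    apply/measurable_EFinP; apply: measurable_funTS; apply: measurable_realfun.continuous_measurable_fun.
    exact: (is_derive_continuous (is_derive_gau A)).
  move=> s _; rewrite /= lee_fin ger0_norm ?expR_ge0//; apply: le_trans (ler_norm _).
  exact: gau_le.
split=> //; apply: le_trans (_ : \int[lam]_(s in D) (1 + A * s ^+ 2)^-1 <= _).
  by apply: le_Rintegral => // s _; exact: gau_le.
by rewrite E1 mulr0 atan0 mulr0 subr0 mulrC.
Unshelve. all: by end_near.
Qed.

(** Here h may change sign. Adding C s [gau A s], whose primitive and integral are explicit, makes
    it nonnegative, so that [half_line_FTC_ge0] applies to the sum. *)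
Lemma half_line_FTC H h A C : 0 < A -> (forall t : R, is_derive t 1 H (h t)) ->
  continuous h -> (forall s, `|H s| <= C * gau A s) ->
  (forall s, 0 <= s -> `|h s| <= C * (s * gau A s)) ->
  lam.-integrable D (EFin \o h) /\ \int[lam]_(s in D) h s = - H 0.
Proof.
move=> A0 dH ch bH bh; have A2 : 2 * A != 0 by rewrite mulf_neq0// gt_eqF.
have [ig Eg] := integral_sgau A0.
have dF (t : R) : is_derive t 1 (fun s => H s + - (2 * A)^-1 * C * gau A s) (h t + C * (t * gau A t)).
  have := is_derive_gau A t => dg; apply: is_derive_eq; rewrite /GRing.scale/=.
  by field; rewrite gt_eqF.
have H0 : H s @[s --> +oo] --> (0 : R).
  apply/cvgr0Pnorm_le => /=.
  have : C * gau A s @[s --> +oo] --> (C * 0 : R) by apply: cvgM; [exact: cvg_cst|exact: cvgy_gau].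
  rewrite mulr0 => /cvgr0Pnorm_le He e e0; have := He _ e0; apply: filterS => s hs.
  by apply: le_trans (bH s) _; apply: le_trans (ler_norm _) hs.
have [] := half_line_FTC_ge0 dF (l := 0 + - (2 * A)^-1 * C * 0).
- move=> s; apply: cvgD; first exact: ch.
  apply: cvgM; first exact: cvg_cst.
  apply: cvgM; first exact: cvg_id.
  exact: (is_derive_continuous (is_derive_gau A)).
- by move=> s s0; have := bh s s0; rewrite ler_norml => /andP[? _]; lra.
- by apply: cvgD => //; apply: cvgM; [exact: cvg_cst|exact: cvgy_gau].
move=> i1 E1.
have iC : lam.-integrable D (EFin \o (fun s => C * (s * gau A s))).
  rewrite (_ : EFin \o _ = (fun s => C%:E * (s * gau A s)%:E)%E)//.
  by apply: integrableZl.
have ih : lam.-integrable D (EFin \o h).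
  rewrite (_ : EFin \o h = (fun s => (h s + C * (s * gau A s))%:E - (C * (s * gau A s))%:E)%E).
    by apply: integrableB.
  by apply/funext => s; rewrite -EFinB addrK.
have g0 : gau A 0 = 1 by rewrite /gau expr0n/= mulr0 expR0.
split=> //; move: E1; rewrite RintegralD// RintegralZl// Eg g0.
by move=> E1; lra.
Qed.

End half_line.

Section sigma_finite_product.
Context d1 d2 (T1 : measurableType d1) (T2 : measurableType d2) (R : realType).
Variable m1 : {sigma_finite_measure set T1 -> \bar R}.
Variable m2 : {sigma_finite_measure set T2 -> \bar R}.

(** A named copy of the product measure that can carry the sigma-finite structure required by
    [transavg]. *)
Definition prodm : set (T1 * T2) -> \bar R := (m1 \x m2)%E.

HB.instance Definition _ := Measure.on prodm.

Let prodm_sigma_finite : sigma_finite setT prodm.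
Proof.
have /sigma_finiteP[F [TF ndF Foo]] := sigma_finiteT m1.
have /sigma_finiteP[G [TG ndG Goo]] := sigma_finiteT m2.
exists (fun n => F n `*` G n).
  rewrite -setXTT TF TG predeqE => -[x y]; split=> /= [[[i _ Fi] [j _ Gj]]|[k _ [Fk Gk]]].
    exists (maxn i j) => //; split.
      by move: x Fi; exact/subsetPset/ndF/leq_maxl.
    by move: y Gj; exact/subsetPset/ndG/leq_maxr.
  by split; exists k.
move=> n; have [mF Fn] := Foo n; have [mG Gn] := Goo n; split; first exact: measurableX.
by rewrite /prodm product_measure1E// lte_mul_pinfty// ge0_fin_numE.
Qed.

HB.instance Definition _ := @Measure_isSigmaFinite.Build _ _ _ prodm prodm_sigma_finite.

End sigma_finite_product.

(** * Superpositions of Gaussians over all scales *)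

Section half_space_average.
Context {R : realType} {N : nat}.
Implicit Types (f g k : 'rV[R]_N -> R) (x y : 'rV[R]_N) (i : 'I_N) (s t tau : R) (phi : R -> R).

Local Notation e_ i := (delta_mx ord0 i : 'rV[R]_N).
Local Notation mu := (@lebesgue_rV R N).
Local Notation lam := (@lebesgue_measure R).
Local Notation D := (`[0, +oo[%classic : set R).

Definition ttK phi k (z : measurableTypeR R * 'rV[R]_N) : R := phi z.1 * k z.2.
Definition ttdir (z : measurableTypeR R * 'rV[R]_N) : 'rV[R]_N := - z.1 *: z.2.
Definition ttop phi k f := transavg (prodm lam mu) (ttK phi k) ttdir f.

Lemma measurable_ttdir : measurable_fun setT ttdir.
Proof.
apply: measurable_fun_coorP => i; under eq_fun do rewrite mxE.
apply: measurable_funM; first by apply: measurableT_comp => //; exact: measurable_fst.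
by apply: (measurableT_comp (measurable_coor i)); exact: measurable_snd.
Qed.

Lemma integrable_ttK phi k : lam.-integrable setT (EFin \o phi) ->
  mu.-integrable setT (EFin \o k) ->
  (prodm lam mu).-integrable setT (EFin \o ttK phi k) /\
  \int[(prodm lam mu)]_z `|ttK phi k z| = (\int[lam]_s `|phi s|) * \int[mu]_y `|k y|.
Proof.
move=> ip ik; have /integrableP[/measurable_EFinP mp _] := ip.
have /integrableP[/measurable_EFinP mk _] := ik.
have mK : measurable_fun setT (EFin \o ttK phi k).
  apply/measurable_EFinP; apply: measurable_funM.
    by apply: (measurableT_comp mp); exact: measurable_fst.
  by apply: (measurableT_comp mk); exact: measurable_snd.
have E1 : (\int[lam]_s `|phi s|%:E = (\int[lam]_s `|phi s|)%:E)%E.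
  by rewrite /Rintegral fineK//; exact: integrable_fin_num (integrable_norm ip).
have E2 : (\int[mu]_y `|k y|%:E = (\int[mu]_y `|k y|)%:E)%E.
  by rewrite /Rintegral fineK//; exact: integrable_fin_num (integrable_norm ik).
have E : (\int[lam]_s \int[mu]_y `|(ttK phi k (s, y))%:E| =
    ((\int[lam]_s `|phi s|) * \int[mu]_y `|k y|)%:E)%E.
  under eq_integral => s _.
    under eq_integral => y _ do rewrite /ttK abse_EFin normrM EFinM.
    rewrite /= ge0_integralZl//; last by apply/measurable_EFinP; exact: measurableT_comp.
    rewrite E2; over.
  rewrite ge0_integralZr//; last 2 first.
  - by apply/measurable_EFinP; exact: measurableT_comp.
  - by rewrite lee_fin Rintegral_ge0.
  by rewrite E1.
have iK : (prodm lam mu).-integrable setT (EFin \o ttK phi k).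
  by apply/(integrable12ltyP lam mu mK); rewrite E ltry.
split=> //; rewrite /Rintegral.
have := integral12_prod_meas1 (m1 := lam) (m2 := mu) (integrable_abse iK).
by move=> /= <-; rewrite E.
Qed.

Lemma ttE phi k f x : lam.-integrable setT (EFin \o phi) ->
  mu.-integrable setT (EFin \o k) -> bCoo f ->
  lam.-integrable setT (EFin \o (fun s => phi s * Phi k f x s)) /\
  ttop phi k f x = \int[lam]_s (phi s * Phi k f x s).
Proof.
move=> ip ik bf; have [iK _] := integrable_ttK ip ik.
have iT := integrable_transavg iK measurable_ttdir x bf.
have E s : (\int[mu]_y (ttK phi k (s, y) * f (x + ttdir (s, y)))%:E = (phi s * Phi k f x s)%:E)%E.
  have iP := integrable_transavg ik (measurable_scalerV (- s)) x bf.
  rewrite /ttK /ttdir /=; under eq_integral do rewrite -mulrA EFinM.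
  rewrite integralZl// EFinM; congr (_ * _)%E.
  by rewrite /Phi /transavg /Rintegral fineK//; exact: integrable_fin_num iP.
split.
  have := integrable_fubini_F (m1 := lam) (m2 := mu) iT.
  by rewrite /fubini_F /=; under eq_fun do rewrite E.
rewrite /ttop /transavg /Rintegral -(integral12_prod_meas1 (m1 := lam) (m2 := mu) iT).
by congr fine; apply: eq_integral => s _; rewrite /fubini_F /= -E.
Qed.

(** [Phi_partial] under the integral over scales: a derivative on f uses up the factor s of the
    scale weight. For Gaussian weights the L^1 norm then passes from order 1 / A to order A^{-1/2},
    which is the gain of one derivative. *)
Lemma tt_partial C phi k f i : lam.-integrable setT (EFin \o phi) ->
  lam.-integrable setT (EFin \o (fun s => s * phi s)) -> profile C k -> bCoo f ->
  ttop (fun s => s * phi s) k (partial i f) = ttop phi (partial i k) f.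
Proof.
move=> ip isp pk bf; apply/funext => x.
rewrite (ttE x isp (profile_integrable pk) (bCoo_partial i bf)).2.
rewrite (ttE x ip (profile_partial_integrable i pk) bf).2.
by apply: eq_Rintegral => s _; rewrite (Phi_partial x s i pk bf); ring.
Qed.

End half_space_average.

Section integral_value.
Context d (T : measurableType d) (R : realType) (m : {measure set T -> \bar R}).

Definition integral_is (F : T -> R) (v : R) :=
  m.-integrable setT (EFin \o F) /\ \int[m]_x F x = v.

Lemma integral_isD F G u v : integral_is F u -> integral_is G v ->
  integral_is (fun x => F x + G x) (u + v).
Proof.
by move=> [iF <-] [iG <-]; split; [exact: integrableRD|rewrite RintegralD].
Qed.

Lemma integral_isZ c F u : integral_is F u -> integral_is (fun x => c * F x) (c * u).
Proof. by move=> [iF <-]; split; [exact: integrableRZ|rewrite RintegralZl]. Qed.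

End integral_value.

(** * Resolvents of the Laplacian and the bi-Laplacian *)

Section second_order_resolvent.
Context {R : realType} {N : nat}.
Implicit Types (f g k : 'rV[R]_N -> R) (x y : 'rV[R]_N) (i : 'I_N) (s t : R) (phi : R -> R).

Local Notation e_ i := (delta_mx ord0 i : 'rV[R]_N).
Local Notation mu := (@lebesgue_rV R N).
Local Notation lam := (@lebesgue_measure R).
Local Notation D := (`[0, +oo[%classic : set R).
Local Notation "'N_ p [ f ]" := ('N[mu]_p%:E[EFin \o f])%E.

Let continuousM' (F G : R -> R) : continuous F -> continuous G -> continuous (fun s => F s * G s).
Proof. by move=> cF cG s; apply: cvgM; [exact: cF|exact: cG]. Qed.
Let continuousD' (F G : R -> R) : continuous F -> continuous G -> continuous (fun s => F s + G s).
Proof. by move=> cF cG s; apply: cvgD; [exact: cF|exact: cG]. Qed.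
Let continuous_id' : continuous (fun s : R => s).
Proof. by move=> s; exact: cvg_id. Qed.
Let continuous_cst' (c : R) : continuous (fun _ : R => c).
Proof. by move=> s; exact: cvg_cst. Qed.

Definition gcos (A B s : R) := gau A s * cos (B * s ^+ 2).
Definition gsin (A B s : R) := gau A s * sin (B * s ^+ 2).

Lemma is_derive_gcos A B s :
  is_derive s 1 (gcos A B) (s * (- 2 * A * gcos A B s - 2 * B * gsin A B s)).
Proof.
have d2 : is_derive s 1 (fun s => B * s ^+ 2) (2 * B * s).
  have := is_derive_exprn 2 (is_derive_id s 1) => d2.
  by apply: is_derive_eq; rewrite /GRing.scale/=; ring.
have dg := is_derive_gau A s.
have dc : is_derive s 1 (fun s => cos (B * s ^+ 2)) (- sin (B * s ^+ 2) * (2 * B * s)).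
  exact: (@is_derive1_comp _ cos (fun s => B * s ^+ 2)).
by rewrite /gcos /gsin; apply: is_derive_eq; rewrite /GRing.scale/=; ring.
Qed.

Lemma is_derive_gsin A B s :
  is_derive s 1 (gsin A B) (s * (- 2 * A * gsin A B s + 2 * B * gcos A B s)).
Proof.
have d2 : is_derive s 1 (fun s => B * s ^+ 2) (2 * B * s).
  have := is_derive_exprn 2 (is_derive_id s 1) => d2.
  by apply: is_derive_eq; rewrite /GRing.scale/=; ring.
have dg := is_derive_gau A s.
have dc : is_derive s 1 (fun s => sin (B * s ^+ 2)) (cos (B * s ^+ 2) * (2 * B * s)).
  exact: (@is_derive1_comp _ sin (fun s => B * s ^+ 2)).
by rewrite /gcos /gsin; apply: is_derive_eq; rewrite /GRing.scale/=; ring.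
Qed.

Lemma gcos_le A B s : `|gcos A B s| <= gau A s.
Proof. by rewrite normrM ger0_norm ?expR_ge0// ler_piMr ?expR_ge0// cos_max. Qed.

Lemma gsin_le A B s : `|gsin A B s| <= gau A s.
Proof. by rewrite normrM ger0_norm ?expR_ge0// ler_piMr ?expR_ge0// sin_max. Qed.

Lemma cutoff_integrable A (c : R -> R) : 0 < A -> continuous c -> (forall s, `|c s| <= gau A s) ->
  [/\ lam.-integrable setT (EFin \o (c \_ D)),
      lam.-integrable setT (EFin \o (fun s => s * (c \_ D) s)),
      \int[lam]_s `|(c \_ D) s| <= pi / 2 / Num.sqrt A &
      \int[lam]_s `|s * (c \_ D) s| <= (2 * A)^-1].
Proof.
move=> A0 cc bc; have [ig ig2] := integral_gau A0; have [isg Esg] := integral_sgau A0.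
have mD : measurable (D : set (g_sigma_algebraType R.-ocitv.-measurable)) by [].
have mc : measurable_fun D c.
  by apply: measurable_funTS; exact: measurable_realfun.continuous_measurable_fun.
have E1 : EFin \o (c \_ D) = (EFin \o c) \_ D by rewrite restrict_EFin.
have E2 : (fun s => s * (c \_ D) s) = (fun s => s * c s) \_ D.
  by apply/funext => s; rewrite /patch; case: ifP => //; rewrite mulr0.
have i1 : lam.-integrable D (EFin \o c).
  apply: le_integrable ig => //; first exact/measurable_EFinP.
  by move=> s _; rewrite /= lee_fin; apply: le_trans (ler_norm _); exact: bc.
have b2 s : D s -> `|s * c s| <= s * gau A s.
  by rewrite /= in_itv/= andbT => s0; rewrite normrM ger0_norm// ler_wpM2l.
have i2 : lam.-integrable D (EFin \o (fun s => s * c s)).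
  apply: le_integrable isg => //; first by apply/measurable_EFinP; exact: measurable_funM.
  by move=> s Ds; rewrite /= lee_fin; apply: le_trans (ler_norm _); exact: b2.
rewrite E2; split.
- by rewrite E1; have [+ _] := @integrable_mkcond _ _ _ lam D (EFin \o c) mD; apply.
- by rewrite -restrict_EFin; have [+ _] := @integrable_mkcond _ _ _ lam D (EFin \o (fun s => s * c s)) mD; apply.
- apply: le_trans ig2; rewrite (_ : (fun s => `|(c \_ D) s|) = (fun s => `|c s|) \_ D); last first.
    by apply/funext => s; rewrite /patch; case: ifP => //; rewrite normr0.
  rewrite -Rintegral_mkcond; apply: le_Rintegral => //; first exact: (integrable_norm i1).
- rewrite -Esg (_ : (fun s => `|s * (c \_ D) s|) = (fun s => `|s * c s|) \_ D); last first.
    by apply/funext => s; rewrite /patch; case: ifP => //; rewrite mulr0 normr0.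
  rewrite -Rintegral_mkcond; apply: le_Rintegral => //; first exact: (integrable_norm i2).
Qed.

Lemma Phi_bound C k f x s (M : R) : profile C k -> bCoo f -> (forall x, `|f x| <= M) ->
  `|Phi k f x s| <= (\int[mu]_y `|k y|) * M.
Proof.
move=> pk bf fM; have ik := profile_integrable pk.
have iP := integrable_transavg ik (measurable_scalerV (- s)) x bf.
have M0 : 0 <= M by exact: le_trans (fM 0).
apply: (le_trans (le_normr_Rintegral _ iP)) => //.
rewrite mulrC -RintegralZl//; last exact: (integrable_norm ik).
apply: le_Rintegral => //.
- exact: (integrable_norm iP).
- by apply: integrableRZ; exact: (integrable_norm ik).
- by move=> y _; rewrite normrM mulrC ler_wpM2r.
Qed.

Local Notation ppc := (profile_kc 2).
Local Notation pps := (profile_ks 2).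

Lemma continuous_Phic f x : bCoo f -> continuous (Phi (kc 2) f x).
Proof. by move=> bf; exact: (is_derive_continuous (is_derive_Phic x bf)). Qed.
Lemma continuous_Phis f x : bCoo f -> continuous (Phi (ks 2) f x).
Proof. by move=> bf; exact: (is_derive_continuous (is_derive_Phis x bf)). Qed.

Lemma continuous_gcos A B : continuous (gcos A B).
Proof. exact: (is_derive_continuous (is_derive_gcos A B)). Qed.
Lemma continuous_gsin A B : continuous (gsin A B).
Proof. exact: (is_derive_continuous (is_derive_gsin A B)). Qed.

Section kernel.
Variables (A B : R).
Hypothesis A0 : 0 < A.

(* P + iQ = \int_0^oo s e^{-(A - iB) s^2} \int e^{-(1 - 2i)|y|^2} f(x - s y) dy ds
   inverts a multiple of k - Laplacian, for k a multiple of A - iB; the complex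
   direction 1 - 2i makes the rotated integral in s converge *)
Definition scos s := s * (gcos A B \_ D) s.
Definition ssin s := s * (gsin A B \_ D) s.

Definition resP f x := ttop scos (kc 2) f x - ttop ssin (ks 2) f x.
Definition resQ f x := ttop ssin (kc 2) f x + ttop scos (ks 2) f x.

Let ic := cutoff_integrable A0 (@continuous_gcos A B) (gcos_le A B).
Let is_ := cutoff_integrable A0 (@continuous_gsin A B) (gsin_le A B).

(** Integrate over s > 0 the derivative of e^{-(A - iB) s^2} Phi(s), with Phi = [Phi (kc 2) f x] + i
    [Phi (ks 2) f x]. The boundary term at 0 is Z f(x) with Z = [Zc 2] + i [Zs 2], and the heat
    equation for Phi gives 2 (A - iB) T f - (1 + 2i) / 10 T(lap f) = Z f for T = [resP] + i [resQ].
    The two equations are its components. *)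
Lemma res_eq f x : bCoo f ->
  2 * A * resP f x + 2 * B * resQ f x - 10^-1 * (resP (lap f) x - 2 * resQ (lap f) x)
    = Zc (N := N) 2 * f x /\
  2 * A * resQ f x - 2 * B * resP f x - 10^-1 * (resQ (lap f) x + 2 * resP (lap f) x)
    = Zs (N := N) 2 * f x.
Proof.
have lin1 (P Q P' Q' Z : R) : - 2 * A * P + - 2 * B * Q + 10^-1 * (1 * P' + -2 * Q') = - Z ->
    2 * A * P + 2 * B * Q - 10^-1 * (P' - 2 * Q') = Z by lra.
have lin2 (P Q P' Q' Z : R) : - 2 * (- B) * P + - 2 * A * Q + 10^-1 * (2 * P' + 1 * Q') = - Z ->
    2 * A * Q - 2 * B * P - 10^-1 * (Q' + 2 * P') = Z by lra.
move=> bf; have bl := bCoo_lap bf.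
have [_ isc _ _] := ic; have [_ iss _ _] := is_.
have ipc := @profile_integrable R N _ _ ppc; have ips := @profile_integrable R N _ _ pps.
have [M fM] := bCoo_bounded bf; have [L lL] := bCoo_bounded bl.
pose Ic := \int[mu]_y `|kc 2 y|; pose Is := \int[mu]_y `|ks 2 y|.
have Ic0 : 0 <= Ic by exact: Rintegral_ge0.
have Is0 : 0 <= Is by exact: Rintegral_ge0.
have M0 : 0 <= M by exact: le_trans (fM 0).
have L0 : 0 <= L by exact: le_trans (lL 0).
pose W := (Ic + Is) * (M + L).
have W0 : 0 <= W by rewrite mulr_ge0// addr_ge0.
have bd g (K : R) s : bCoo g -> (forall x, `|g x| <= K) -> K <= M + L ->
    `|Phi (kc 2) g x s| <= W /\ `|Phi (ks 2) g x s| <= W.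
  move=> bg gK KML; have K0 : 0 <= K by exact: le_trans (gK 0).
  split; [apply: le_trans (Phi_bound x s ppc bg gK) _|apply: le_trans (Phi_bound x s pps bg gK) _];
  by apply: ler_pM; rewrite ?lerDl ?lerDr.
have [b1 b2] : (forall s, `|Phi (kc 2) f x s| <= W) /\ (forall s, `|Phi (ks 2) f x s| <= W).
  by split=> s; have [] := bd f M s bf fM _; rewrite ?lerDl.
have [b3 b4] : (forall s, `|Phi (kc 2) (lap f) x s| <= W) /\ (forall s, `|Phi (ks 2) (lap f) x s| <= W).
  by split=> s; have [] := bd _ L s bl lL _; rewrite ?lerDr.
have bp (u v w z : R) s : `|u| <= gau A s -> `|w| <= gau A s -> `|v| <= W -> `|z| <= W ->
    `|u * v + w * z| <= 2 * W * gau A s.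
  move=> hu hw hv hz; apply: le_trans (ler_normD _ _) _; rewrite !normrM.
  have h1 : `|u| * `|v| <= gau A s * W by exact: ler_pM.
  have h2 : `|w| * `|z| <= gau A s * W by exact: ler_pM.
  by lra.
have gc0 := @continuous_gcos A B; have gs0 := @continuous_gsin A B.
have [cp1 cp2] := (continuous_Phic (x := x) bf, continuous_Phis (x := x) bf).
have [cp3 cp4] := (continuous_Phic (x := x) bl, continuous_Phis (x := x) bl).
have bc := gcos_le A B; have bs := gsin_le A B.
have bN (u w : R) : `|u| <= w -> `|- u| <= w by rewrite normrN.
have A1 := ltW A0; have B1 := normr_ge0 B.
have Bn : B <= `|B| := ler_norm B.
have Bn' : - `|B| <= B by rewrite lerNl -normrN ler_norm.
(* One statement serves both components: the real part takes (B', c1, c2) = (B, 1, -2), the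
   imaginary part takes (-B, 2, 1) with the first two functions exchanged. *)
have key (H1 H2 G1 G2 : R -> R) :
   (forall s, `|H1 s| <= 2 * W * gau A s) -> (forall s, `|H2 s| <= 2 * W * gau A s) ->
   (forall s, `|G1 s| <= 2 * W * gau A s) -> (forall s, `|G2 s| <= 2 * W * gau A s) ->
   continuous H1 -> continuous H2 -> continuous G1 -> continuous G2 -> forall (B' c1 c2 : R),
   `|B'| = `|B| -> `|c1| <= 2 -> `|c2| <= 2 ->
   (forall t : R, is_derive t 1 H1
     (t * (- 2 * A * H1 t + - 2 * B' * H2 t + 10^-1 * (c1 * G1 t + c2 * G2 t)))) ->
   \int[lam]_(s in D) (s * (- 2 * A * H1 s + - 2 * B' * H2 s + 10^-1 * (c1 * G1 s + c2 * G2 s))) = - H1 0.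
  move=> h1 h2 g1 g2 cH1 cH2 cG1 cG2 B' c1 c2 BB n1 n2 dH.
  pose C := (2 * A + 2 * `|B| + 1) * (2 * W) + 2 * W.
  have [] // := @half_line_FTC _ H1 _ A C A0 dH.
  - apply: continuousM' => //; apply: continuousD'.
      by apply: continuousD'; (apply: continuousM'; [exact: continuous_cst'|]).
    by apply: continuousM'; [exact: continuous_cst'|apply: continuousD'; (apply: continuousM'; [exact: continuous_cst'|])].
  - move=> s; apply: le_trans (h1 s) _; rewrite ler_wpM2r ?expR_ge0//.
    by rewrite lerDr mulr_ge0 ?mulr_ge0 ?addr_ge0 ?mulr_ge0.
  - move=> s s0; rewrite normrM (ger0_norm s0) mulrCA ler_wpM2l//.
    apply: le_trans (ler_normD _ _) _; rewrite /C mulrDl; apply: lerD; last first.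
      rewrite normrM ger0_norm//.
      have : `|c1 * G1 s + c2 * G2 s| <= 4 * (2 * W * gau A s).
        apply: le_trans (ler_normD _ _) _; rewrite !normrM.
        have k1 : `|c1| * `|G1 s| <= 2 * (2 * W * gau A s) by exact: ler_pM.
        have k2 : `|c2| * `|G2 s| <= 2 * (2 * W * gau A s) by exact: ler_pM.
        by apply: le_trans (lerD k1 k2) _; rewrite -mulrDl -natrD.
      have : 0 <= 2 * W * gau A s by exact: le_trans (h1 s).
      by rewrite [_^-1 * _]mulrC ler_pdivrMr//; lra.
    apply: le_trans (ler_normD _ _) _; rewrite !normrM BB normrN (ger0_norm A1) (@ger0_norm _ 2)//.
    have k1 := ler_wpM2l (mulr_ge0 (ler0n R 2) A1) (h1 s).
    have k2 := ler_wpM2l (mulr_ge0 (ler0n R 2) B1) (h2 s).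
    have : 0 <= 2 * W * gau A s by exact: le_trans (h1 s).
    by lra.
pose P g s := gcos A B s * Phi (kc 2) g x s + - gsin A B s * Phi (ks 2) g x s.
pose Q g s := gsin A B s * Phi (kc 2) g x s + gcos A B s * Phi (ks 2) g x s.
have cP g : continuous (Phi (kc 2) g x) -> continuous (Phi (ks 2) g x) -> continuous (P g) /\ continuous (Q g).
  move=> c1 c2; split; apply: continuousD'; apply: continuousM' => //.
  by move=> s; apply: cvgN; exact: gs0.
have [cP1 cQ1] := cP f cp1 cp2; have [cP2 cQ2] := cP (lap f) cp3 cp4.
have bP1 s : `|P f s| <= 2 * W * gau A s by exact: bp (bc s) (bN _ _ (bs s)) (b1 s) (b2 s).
have bQ1 s : `|Q f s| <= 2 * W * gau A s by exact: bp (bs s) (bc s) (b1 s) (b2 s).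
have bP2 s : `|P (lap f) s| <= 2 * W * gau A s by exact: bp (bc s) (bN _ _ (bs s)) (b3 s) (b4 s).
have bQ2 s : `|Q (lap f) s| <= 2 * W * gau A s by exact: bp (bs s) (bc s) (b3 s) (b4 s).
have D0 s (c : R -> R) v : s * (c \_ D) s * v = ((fun s => s * (c s * v)) \_ D) s.
  by rewrite /patch; case: ifP; rewrite ?mulr0 ?mul0r// mulrA.
have tE c k g : lam.-integrable setT (EFin \o (fun s => s * (c \_ D) s)) -> 
    mu.-integrable setT (EFin \o k) -> bCoo g ->
    integral_is lam (fun s => s * (c \_ D) s * Phi k g x s) (ttop (fun s => s * (c \_ D) s) k g x).
  by move=> i1 i2 bg; have [? ->] := ttE x i1 i2 bg.
have PE g : bCoo g -> integral_is lam (fun s => scos s * Phi (kc 2) g x s + (-1) * (ssin s * Phi (ks 2) g x s)) (resP g x).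
  by move=> bg; have := integral_isD (tE _ _ _ isc ipc bg) (integral_isZ (-1) (tE _ _ _ iss ips bg)); rewrite [X in integral_is _ _ (_ + X)]mulN1r.
have QE g : bCoo g -> integral_is lam (fun s => ssin s * Phi (kc 2) g x s + scos s * Phi (ks 2) g x s) (resQ g x).
  by move=> bg; exact: (integral_isD (tE _ _ _ iss ipc bg) (tE _ _ _ isc ips bg)).
have comb (c1 c2 c3 c4 : R) : \int[lam]_(s in D) (s * (c1 * P f s + c2 * Q f s + 10^-1 * (c3 * P (lap f) s + c4 * Q (lap f) s))) =
   c1 * resP f x + c2 * resQ f x + 10^-1 * (c3 * resP (lap f) x + c4 * resQ (lap f) x).
  have [_ <-] := integral_isD (integral_isD (integral_isZ c1 (PE f bf)) (integral_isZ c2 (QE f bf)))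
    (integral_isZ 10^-1 (integral_isD (integral_isZ c3 (PE _ bl)) (integral_isZ c4 (QE _ bl)))).
  rewrite Rintegral_mkcond; apply: eq_Rintegral => s _; move: s.
  have pt (s : R) (b : bool) (u v w z u' v' : R) : (if b then s * (c1 * (u * w + - v * z) + c2 * (v * w + u * z)
       + 10^-1 * (c3 * (u * u' + - v * v') + c4 * (v * u' + u * v'))) else 0) =
    c1 * (s * (if b then u else 0) * w + -1 * (s * (if b then v else 0) * z)) +
    c2 * (s * (if b then v else 0) * w + s * (if b then u else 0) * z) +
    10^-1 * (c3 * (s * (if b then u else 0) * u' + -1 * (s * (if b then v else 0) * v')) +
      c4 * (s * (if b then v else 0) * u' + s * (if b then u else 0) * v')).
    by case: b; ring.
  by move=> s; rewrite /P /Q /scos /ssin /patch; exact: pt.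
have Z0 k : mu.-integrable setT (EFin \o k) -> Phi k f x 0 = (\int[mu]_y k y) * f x.
  move=> ik; rewrite -RintegralZr//; apply: eq_Rintegral => y _.
  by rewrite oppr0 scale0r addr0.
have g00 : gcos A B 0 = 1 by rewrite /gcos /gau expr0n/= !mulr0 expR0 cos0 mulr1.
have g01 : gsin A B 0 = 0 by rewrite /gsin /gau expr0n/= !mulr0 expR0 sin0 mulr0.
split.
- have := key (P f) (Q f) (P (lap f)) (Q (lap f)).
  move=> /(_ _ _ _ _ _ _ _ _ B 1 (- 2)); rewrite comb.
  have -> : P f 0 = Zc (N := N) 2 * f x by rewrite /P g00 g01 Z0// mul1r oppr0 mul0r addr0.
  move=> K; suff : - 2 * A * resP f x + - 2 * B * resQ f x + 10^-1 * (1 * resP (lap f) x + -2 * resQ (lap f) x) = - (Zc (N := N) 2 * f x) by exact: lin1.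
  apply: (K bP1 bQ1 bP2 bQ2 cP1 cQ1 cP2 cQ2).
  + by [].
  + by rewrite normr1 ler1n.
  + by rewrite normrN ger0_norm.
  + move=> t; have d1 := is_derive_gcos A B t; have d2 := is_derive_gsin A B t.
    have d3 := is_derive_Phic x bf t; have d4 := is_derive_Phis x bf t.
    by rewrite /P; apply: is_derive_eq; rewrite /Q /GRing.scale/=; field.
- have := key (Q f) (P f) (P (lap f)) (Q (lap f)).
  move=> /(_ _ _ _ _ _ _ _ _ (- B) 2 1) K.
  have E : \int[lam]_(s in D) (s * (- 2 * A * Q f s + - 2 * (- B) * P f s + 10^-1 * (2 * P (lap f) s + 1 * Q (lap f) s))) =
     \int[lam]_(s in D) (s * (- 2 * (- B) * P f s + - 2 * A * Q f s + 10^-1 * (2 * P (lap f) s + 1 * Q (lap f) s))).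
    by apply: eq_Rintegral => s _; ring.
  rewrite E comb in K.
  have Q0 : Q f 0 = Zs (N := N) 2 * f x by rewrite /Q g00 g01 mul0r add0r mul1r Z0//.
  rewrite Q0 in K.
  suff : - 2 * (- B) * resP f x + - 2 * A * resQ f x + 10^-1 * (2 * resP (lap f) x + 1 * resQ (lap f) x) = - (Zs (N := N) 2 * f x) by exact: lin2.
  apply: (K bQ1 bP1 bP2 bQ2 cQ1 cP1 cP2 cQ2).
  + by rewrite normrN.
  + by rewrite ger0_norm.
  + by rewrite normr1 ler1n.
  + move=> t; have d1 := is_derive_gcos A B t; have d2 := is_derive_gsin A B t.
    have d3 := is_derive_Phic x bf t; have d4 := is_derive_Phis x bf t.
    by rewrite /Q; apply: is_derive_eq; rewrite /P /GRing.scale/=; field.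
Qed.

End kernel.

Lemma LnormD q f g : 1 < q -> measurable_fun setT f -> measurable_fun setT g ->
  ('N_q [(fun x => f x + g x)%R] <= 'N_q [f] + 'N_q [g])%E.
Proof.
by move=> q1 mf mg; apply: minkowski_EFin => //; exact: ltW.
Qed.

Lemma partial_lin i (c1 c2 : R) u v : bCoo u -> bCoo v ->
  partial i (fun x => c1 * u x + c2 * v x) = fun x => c1 * partial i u x + c2 * partial i v x.
Proof.
have dz (c : R) w : bCoo w -> forall x, derivable (fun x => c * w x) x (e_ i).
  by move=> bw x; apply: bCoo_derivable; exact: bCooZ.
move=> bu bv; rewrite (partialD (dz c1 u bu) (dz c2 v bv)).
by rewrite !partialZ// => x; exact: bCoo_derivable.
Qed.

(** b stands for the imaginary part of a spectral parameter whose real part it dominates, so 1 / b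
    and b^{-1/2} are the natural sizes for no derivative and for one. The last clause is put on T
    (partial i f), so that in a product of two such operators a derivative can be passed inward and
    spent on either factor. *)
Definition half_resolvent (K b : R) (T : ('rV[R]_N -> R) -> 'rV[R]_N -> R) : Prop :=
  [/\ forall f, bCoo f -> bCoo (T f),
      forall f i, bCoo f -> partial i (T f) = T (partial i f),
      forall q f, 1 < q -> bCoo f -> ('N_q [T f] <= (K / b)%:E * 'N_q [f])%E &
      forall q f i, 1 < q -> bCoo f ->
        ('N_q [T (partial i f)] <= (K / Num.sqrt b)%:E * 'N_q [f])%E].

Lemma half_resolvent_lin K1 K2 b (c1 c2 : R) T1 T2 : 0 < b -> 0 <= K1 -> 0 <= K2 ->
  half_resolvent K1 b T1 -> half_resolvent K2 b T2 ->
  half_resolvent (`|c1| * K1 + `|c2| * K2) b (fun f x => c1 * T1 f x + c2 * T2 f x).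
Proof.
move=> b0 K10 K20 [B1 D1 E1 F1] [B2 D2 E2 F2].
have key q (u v : 'rV[R]_N -> R) (h : 'rV[R]_N -> R) (b1 b2 : R) : 0 <= b1 -> 0 <= b2 -> 1 < q -> bCoo u -> bCoo v ->
    ('N_q [u] <= b1%:E * 'N_q [h])%E -> ('N_q [v] <= b2%:E * 'N_q [h])%E ->
    ('N_q [(fun x => c1 * u x + c2 * v x)%R] <= (`|c1| * b1 + `|c2| * b2)%:E * 'N_q [h])%E.
  move=> b10 b20 q1 bu bv Hu Hv; have q0 : 0 < q by exact: lt_trans q1.
  have mu' := bCoo_measurable bu; have mv := bCoo_measurable bv.
  apply: le_trans (LnormD q1 _ _) _; [exact: measurable_funM|exact: measurable_funM|].
  rewrite !LnormZl// EFinD ge0_muleDl ?lee_fin ?mulr_ge0// !EFinM -!muleA.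
  by apply: leeD; apply: lee_wpmul2l.
split.
- by move=> f bf; apply: bCooD; apply: bCooZ; auto.
- move=> f i bf; apply/funext => x.
  by rewrite partial_lin ?D1 ?D2//; auto.
- by move=> q f q1 bf; rewrite mulrDl -!mulrA; apply: key; rewrite ?divr_ge0 ?(ltW b0)//; auto.
- move=> q f i q1 bf; rewrite mulrDl -!mulrA; have bpf := bCoo_partial i bf.
  by apply: key; rewrite ?divr_ge0 ?sqrtr_ge0//; auto.
Qed.

Lemma ttop_half_resolvent A (c : R -> R) k : 0 < A -> continuous c ->
  (forall s, `|c s| <= gau A s) -> profile (4 * (1 + `|2|)) k ->
  half_resolvent (8 * (4 * (1 + `|2|)) * \int[mu]_y weight y) A (ttop (fun s => s * (c \_ D) s) k).
Proof.
move=> A0 cc bc pk; have [i1 i2 n1 n2] := cutoff_integrable A0 cc bc.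
have ik := profile_integrable pk; have [iK nK] := integrable_ttK i2 ik.
pose W := \int[mu]_y @weight R N y.
have W0 : 0 <= W by apply: Rintegral_ge0 => y _; exact: weight_ge0.
have kW (h : 'rV[R]_N -> R) : mu.-integrable setT (EFin \o h) ->
    (forall y, `|h y| <= 4 * (1 + `|2|) * weight y) -> \int[mu]_y `|h y| <= 4 * (1 + `|2|) * W.
  move=> ih bh; rewrite -RintegralZl//; last exact: integrable_weight.
  apply: le_Rintegral => //; first exact: (integrable_norm ih).
  by apply: integrableRZ; exact: integrable_weight.
have Q0 : 0 <= 4 * (1 + `|2|) * W by rewrite mulr_ge0// mulr_ge0// addr_ge0.
split.
- by move=> f bf; apply: bCoo_transavg => //; exact: measurable_ttdir.
- by move=> f i bf; apply: partial_transavg => //; exact: measurable_ttdir.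
- move=> q f q1 bf; apply: le_trans (Lnorm_transavg iK measurable_ttdir q1 bf) _.
  rewrite lee_wpmul2r ?Lnorm_ge0// lee_fin nK.
  apply: (@le_trans _ _ ((2 * A)^-1 * (4 * (1 + `|2|) * W))).
    apply: ler_pM => //; try exact: Rintegral_ge0.
    by have [_ bk _ _ _] := pk; exact: kW.
  rewrite -/W invfM mulrC -!mulrA [8 * _]mulrC -!mulrA.
  by rewrite !ler_wpM2l ?addr_ge0//; rewrite mulrC ler_wpM2r ?invr_ge0 ?(ltW A0)//; lra.
- move=> q f i q1 bf; rewrite (tt_partial i i1 i2 pk bf).
  have ik' := profile_partial_integrable i pk; have [iK' nK'] := integrable_ttK i1 ik'.
  apply: le_trans (Lnorm_transavg iK' measurable_ttdir q1 bf) _.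
  rewrite lee_wpmul2r ?Lnorm_ge0// lee_fin nK'.
  have sA : 0 < Num.sqrt A by rewrite sqrtr_gt0.
  apply: (@le_trans _ _ (pi / 2 / Num.sqrt A * (4 * (1 + `|2|) * W))).
    apply: ler_pM => //; try exact: Rintegral_ge0.
    by have [_ _ _ _ bk] := pk; exact: kW.
  (* The factor 8 is one bound for the two constants 1 / 2 and pi / 2 in the L^1 norms of the scale
     weights. *)
  have pi8 : pi / 2 <= 8 :> R.
    by apply: (le_trans (ltW (pihalf_lt2 R))); lra.
  rewrite (_ : 8 * (4 * (1 + `|2|)) * _ / _ = 8 / Num.sqrt A * (4 * (1 + `|2|) * W)); last by rewrite /W; ring.
  by rewrite ler_wpM2r// ler_wpM2r// invr_ge0 ltW.
Qed.

(** U + i V inverts (a + i b) - Laplacian. In complex form [res_eq] reads (a - i b) T f - T(lap f) =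
    (al - i be) f with T = P + i Q; its conjugate, divided by al + i be, gives U + i V = (P - i
    Q)(al - i be) / dn. *)
Lemma second_order_resolvent : exists K : R, 0 <= K /\ forall a b : R, 0 < b -> `|a| <= b ->
  exists U V : ('rV[R]_N -> R) -> 'rV[R]_N -> R,
  [/\ half_resolvent K b U, half_resolvent K b V,
     forall f x, bCoo f -> a * U f x - b * V f x - lap (U f) x = f x &
     forall f x, bCoo f -> a * V f x + b * U f x - lap (V f) x = 0].
Proof.
(* al - i be is 2 (1 - 2i) Z with Z = [Zc 2] + i [Zs 2], and dn is its squared modulus. *)
pose al : R := 2 * (Zc (N := N) 2 + 2 * Zs (N := N) 2); pose be : R := 2 * (2 * Zc (N := N) 2 - Zs (N := N) 2).
pose dn := al ^+ 2 + be ^+ 2; have Z0 := @gaussian_integral_neq0 R N 2.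
have dn0 : 0 < dn.
  rewrite (_ : dn = 20 * (Zc (N := N) 2 ^+ 2 + Zs (N := N) 2 ^+ 2)) ?mulr_gt0//.
  by rewrite /dn /al /be; ring.
have dn1 : dn != 0 by rewrite gt_eqF.
pose W := \int[mu]_y @weight R N y.
have W0 : 0 <= W by apply: Rintegral_ge0 => y _; exact: weight_ge0.
pose K0 := 8 * (4 * (1 + `|2|)) * W.
have K00 : 0 <= K0 by rewrite mulr_ge0// mulr_ge0// mulr_ge0// addr_ge0.
have K200 : 0 <= 2 * K0 by rewrite mulr_ge0.
pose K := (`|al / dn| + `|be / dn|) * (2 * K0) * 20.
have Kge0 : 0 <= K by rewrite !mulr_ge0 ?addr_ge0.
exists K; split=> // a b b0 ab.
(* A - i B = (a - i b)(1 + 2i) / 20. Width parameter tau in place of 2 would make the real part a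
   multiple of a + tau b: positive throughout |a| <= b for any tau > 1, but zero at a = -b for tau =
   1. *)
pose A := (a + 2 * b) / 20; pose B := (b - 2 * a) / 20.
have Ab : b / 20 <= A.
  by rewrite /A ler_pM2r ?invr_gt0//; move: ab; rewrite ler_norml => /andP[? _]; lra.
have A0 : 0 < A by apply: lt_le_trans Ab; rewrite divr_gt0.
have gc0 := @continuous_gcos A B; have gs0 := @continuous_gsin A B.
have bc := gcos_le A B; have bs := gsin_le A B.
have hcc := ttop_half_resolvent A0 gc0 bc ppc; have hss := ttop_half_resolvent A0 gs0 bs pps.
have hcs := ttop_half_resolvent A0 gc0 bc pps; have hsc := ttop_half_resolvent A0 gs0 bs ppc.
have hP : half_resolvent (2 * K0) A (resP A B).
  have := half_resolvent_lin 1 (-1) A0 K00 K00 hcc hss; rewrite normrN normr1 -/W -/K0.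
  rewrite (_ : 1 * K0 + 1 * K0 = 2 * K0); last by ring.
  by congr half_resolvent; apply/funext => f; apply/funext => x; rewrite mul1r mulN1r.
have hQ : half_resolvent (2 * K0) A (resQ A B).
  have := half_resolvent_lin 1 1 A0 K00 K00 hsc hcs; rewrite normr1 -/W -/K0.
  rewrite (_ : 1 * K0 + 1 * K0 = 2 * K0); last by ring.
  by congr half_resolvent; apply/funext => f; apply/funext => x; rewrite !mul1r.
have hw (T : ('rV[R]_N -> R) -> 'rV[R]_N -> R) c1 c2 : `|c1| + `|c2| = `|al / dn| + `|be / dn| ->
    half_resolvent (`|c1| * (2 * K0) + `|c2| * (2 * K0)) A T -> half_resolvent K b T.
  move=> cE [h1 h2 h3 h4]; rewrite -mulrDl cE in h3 h4.
  have L0 : 0 <= (`|al / dn| + `|be / dn|) * (2 * K0) by rewrite mulr_ge0 ?addr_ge0 ?mulr_ge0.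
  split=> //.
  - move=> q f q1 bf; apply: le_trans (h3 _ _ q1 bf) _.
    rewrite lee_wpmul2r ?Lnorm_ge0// lee_fin /K -[leRHS]mulrA ler_wpM2l//.
    have : A^-1 <= (b / 20)^-1 by rewrite lef_pV2 ?posrE//; exact: divr_gt0.
    by rewrite (invf_div b).
  - move=> q f i q1 bf; apply: le_trans (h4 _ _ _ q1 bf) _.
    rewrite lee_wpmul2r ?Lnorm_ge0// lee_fin /K -[leRHS]mulrA ler_wpM2l//.
    have sA : 0 < Num.sqrt A by rewrite sqrtr_gt0.
    have sb : 0 < Num.sqrt b by rewrite sqrtr_gt0.
    suff : (Num.sqrt A)^-1 <= (Num.sqrt b / 20)^-1 by rewrite (invf_div (Num.sqrt b)).
    rewrite lef_pV2 ?posrE//; last by rewrite divr_gt0.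
    rewrite -(@ler_sqr _ _ (Num.sqrt A)) ?nnegrE ?divr_ge0 ?(ltW sA) ?(ltW sb)//.
    rewrite exprMn (sqr_sqrtr (ltW b0)) (sqr_sqrtr (ltW A0)); apply: le_trans Ab.
    by rewrite ler_pM2l// expr2 -[leRHS]mul1r ler_pM2r ?invr_gt0//; lra.
pose P := resP A B; pose Q := resQ A B.
pose U f x := al / dn * P f x + - (be / dn) * Q f x.
pose V f x := - (al / dn) * Q f x + - (be / dn) * P f x.
have [bP dP _ _] := hP; have [bQ dQ _ _] := hQ.
have hU := half_resolvent_lin (al / dn) (- (be / dn)) A0 K200 K200 hP hQ.
have hV := half_resolvent_lin (- (al / dn)) (- (be / dn)) A0 K200 K200 hQ hP.
have lapT T f x : (forall f, bCoo f -> bCoo (T f)) ->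
    (forall f i, bCoo f -> partial i (T f) = T (partial i f)) -> bCoo f ->
    lap (T f) x = \sum_i T (partial i (partial i f)) x.
  move=> bT dT bf; apply: eq_bigr => i _; rewrite !dT//; exact: bCoo_partial.
have i1 := cutoff_integrable A0 gc0 bc; have i2 := cutoff_integrable A0 gs0 bs.
have ipc := @profile_integrable R N _ _ ppc; have ips := @profile_integrable R N _ _ pps.
have tsum c k f x : 
   [/\ lam.-integrable setT (EFin \o (c \_ D)),
      lam.-integrable setT (EFin \o (fun s => s * (c \_ D) s)),
      \int[lam]_s `|(c \_ D) s| <= pi / 2 / Num.sqrt A &
      \int[lam]_s `|s * (c \_ D) s| <= (2 * A)^-1] ->
   mu.-integrable setT (EFin \o k) -> bCoo f ->
   ttop (fun s => s * (c \_ D) s) k (lap f) x =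
   \sum_i ttop (fun s => s * (c \_ D) s) k (partial i (partial i f)) x.
  move=> [_ ic _ _] ik bf; have [iK _] := integrable_ttK ic ik.
  by apply: transavg_sum => //; [exact: measurable_ttdir|move=> i; do 2 apply: bCoo_partial].
have lapP f x : bCoo f -> lap (P f) x = P (lap f) x.
  move=> bf; rewrite (lapT P)// /P /resP tsum// tsum// -sumrB.
  by [].
have lapQ f x : bCoo f -> lap (Q f) x = Q (lap f) x.
  move=> bf; rewrite (lapT Q)// /Q /resQ tsum// tsum// -big_split.
  by [].
have lapD u v c1 c2 x : bCoo u -> bCoo v ->
    lap (fun x => c1 * u x + c2 * v x) x = c1 * lap u x + c2 * lap v x.
  move=> bu bv; rewrite /lap !mulr_sumr -big_split; apply: eq_bigr => i _ /=.
  by rewrite partial_lin// partial_lin//; exact: bCoo_partial.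
exists U, V; split.
- by apply: hw hU; rewrite normrN.
- by apply: hw hV; rewrite !normrN.
- move=> f x bf; have [E1 E2] := @res_eq A B A0 f x bf.
  rewrite lapD; [|exact: bP|exact: bQ]; rewrite lapP// lapQ// /U /V.
  have aE : a = 4 * (A - 2 * B) by rewrite /A /B; field.
  have bE : b = 4 * (2 * A + B) by rewrite /A /B; field.
  have F1 : a * P f x + b * Q f x - P (lap f) x = al * f x.
    rewrite aE bE (_ : al * f x = 2 * (Zc (N := N) 2 * f x) + 4 * (Zs (N := N) 2 * f x)); last by rewrite /al; ring.
    by rewrite -E1 -E2 -/P -/Q; field.
  have F2 : a * Q f x - b * P f x - Q (lap f) x = - be * f x.
    rewrite aE bE (_ : - be * f x = 2 * (Zs (N := N) 2 * f x) - 4 * (Zc (N := N) 2 * f x)); last by rewrite /be; ring.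
    by rewrite -E1 -E2 -/P -/Q; field.
  transitivity (al / dn * (a * P f x + b * Q f x - P (lap f) x) - be / dn * (a * Q f x - b * P f x - Q (lap f) x)).
    by ring.
  by rewrite F1 F2 -[RHS](mulfK dn1) {3}/dn; field.
- move=> f x bf; have [E1 E2] := @res_eq A B A0 f x bf.
  rewrite lapD; [|exact: bQ|exact: bP]; rewrite lapP// lapQ// /U /V.
  have aE : a = 4 * (A - 2 * B) by rewrite /A /B; field.
  have bE : b = 4 * (2 * A + B) by rewrite /A /B; field.
  have F1 : a * P f x + b * Q f x - P (lap f) x = al * f x.
    rewrite aE bE (_ : al * f x = 2 * (Zc (N := N) 2 * f x) + 4 * (Zs (N := N) 2 * f x)); last by rewrite /al; ring.
    by rewrite -E1 -E2 -/P -/Q; field.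
  have F2 : a * Q f x - b * P f x - Q (lap f) x = - be * f x.
    rewrite aE bE (_ : - be * f x = 2 * (Zs (N := N) 2 * f x) - 4 * (Zc (N := N) 2 * f x)); last by rewrite /be; ring.
    by rewrite -E1 -E2 -/P -/Q; field.
  transitivity (- (al / dn) * (a * Q f x - b * P f x - Q (lap f) x) - be / dn * (a * P f x + b * Q f x - P (lap f) x)).
    by ring.
  by rewrite F1 F2; ring.
Qed.

End second_order_resolvent.

(** * The fourth-order resolvent and its derivatives *)

Section fourth_order.
Context {R : realType} {N : nat}.
Implicit Types (f g u v w : 'rV[R]_N -> R) (x : 'rV[R]_N) (i j : 'I_N).

Local Notation mu := (@lebesgue_rV R N).
Local Notation "'N_ p [ f ]" := ('N[mu]_p%:E[EFin \o f])%E.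

Lemma Lnorm_lin q (b1 b2 c1 c2 : R) u v g : 1 < q -> bCoo u -> bCoo v -> 0 <= b1 -> 0 <= b2 ->
  ('N_q [u] <= b1%:E * 'N_q [g])%E -> ('N_q [v] <= b2%:E * 'N_q [g])%E ->
  ('N_q [(fun x => c1 * u x + c2 * v x)%R] <= (`|c1| * b1 + `|c2| * b2)%:E * 'N_q [g])%E.
Proof.
move=> q1 bu bv b10 b20 Hu Hv; have q0 : 0 < q by exact: lt_trans q1.
have mu' := bCoo_measurable bu; have mv := bCoo_measurable bv.
apply: le_trans (LnormD q1 _ _) _; [exact: measurable_funM|exact: measurable_funM|].
rewrite !LnormZl// EFinD ge0_muleDl ?lee_fin ?mulr_ge0// !EFinM -!muleA.
by apply: leeD; apply: lee_wpmul2l.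
Qed.

Lemma Lnorm_scale_le q (c1 c2 : R) u g : c1 <= c2 ->
  ('N_q [u] <= c1%:E * 'N_q [g])%E -> ('N_q [u] <= c2%:E * 'N_q [g])%E.
Proof. by move=> c12 /le_trans; apply; rewrite lee_wpmul2r ?Lnorm_ge0. Qed.

Lemma Lnorm_trans q (c1 c2 : R) u v g : 0 <= c1 -> ('N_q [u] <= c1%:E * 'N_q [v])%E ->
  ('N_q [v] <= c2%:E * 'N_q [g])%E -> ('N_q [u] <= (c1 * c2)%:E * 'N_q [g])%E.
Proof.
by move=> c10 h1 h2; apply: (le_trans h1); rewrite EFinM -muleA lee_wpmul2l.
Qed.

(** Each derivative costs b^{1/2}, as b^2 is of the order of the fourth-order spectral parameter.
    The commutator contains third derivatives of w in the two forms [lap (partial j w)] and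
    [partial j (lap w)], which the second clause identifies. *)
Definition resolvent_bounds (K b : R) g w := [/\ bCoo w,
  forall j, lap (partial j w) = partial j (lap w) & forall q : R, 1 < q ->
  [/\ ('N_q [w] <= (K / b ^+ 2)%:E * 'N_q [g])%E,
      forall i, ('N_q [partial i w] <= (K / (b * Num.sqrt b))%:E * 'N_q [g])%E,
      forall i j, ('N_q [partial i (partial j w)] <= (K / b)%:E * 'N_q [g])%E,
      ('N_q [lap w] <= (K / b)%:E * 'N_q [g])%E &
      forall j, ('N_q [partial j (lap w)] <= (K / Num.sqrt b)%:E * 'N_q [g])%E]].

Definition resolvent_bounds1 (K b : R) g w := bCoo w /\ forall q : R, 1 < q ->
  [/\ ('N_q [w] <= (K / b ^+ 2)%:E * 'N_q [g])%E,
      forall i, ('N_q [partial i w] <= (K / (b * Num.sqrt b))%:E * 'N_q [g])%E &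
      forall i j, ('N_q [partial i (partial j w)] <= (K / b)%:E * 'N_q [g])%E].

(** Each factor takes at most one derivative and contributes K / b without it, K / b^{1/2} with
    it. *)
Lemma composition_bounds (K b : R) U1 U2 g : 0 <= K -> 0 < b ->
  half_resolvent K b U1 -> half_resolvent K b U2 -> bCoo g ->
  resolvent_bounds1 (K ^+ 2) b g (U1 (U2 g)).
Proof.
move=> K0 b0 [B1 D1 E1 F1] [B2 D2 E2 F2] bg; have sb : 0 < Num.sqrt b by rewrite sqrtr_gt0.
have n1 : 0 <= K / b by rewrite divr_ge0 ?(ltW b0).
have n2 : 0 <= K / Num.sqrt b by rewrite divr_ge0 ?(ltW sb).
split; first by auto.
move=> q q1; split.
- have -> : K ^+ 2 / b ^+ 2 = (K / b) * (K / b) by field; rewrite gt_eqF.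
  by apply: Lnorm_trans n1 (E1 _ _ q1 (B2 _ bg)) (E2 _ _ q1 bg).
- move=> i; have -> : K ^+ 2 / (b * Num.sqrt b) = (K / Num.sqrt b) * (K / b).
    by field; rewrite !gt_eqF.
  rewrite D1; last exact: B2.
  by apply: Lnorm_trans n2 (F1 _ _ _ q1 (B2 _ bg)) (E2 _ _ q1 bg).
- move=> i j; have -> : K ^+ 2 / b = (K / Num.sqrt b) * (K / Num.sqrt b).
    rewrite mulrACA -expr2 -invfM -expr2 sqr_sqrtr//; exact: ltW.
  have bgj := bCoo_partial j bg.
  rewrite (D1 _ j (B2 _ bg)) (D2 _ j bg) (D1 _ i (B2 _ bgj)).
  by apply: Lnorm_trans n2 (F1 _ _ _ q1 (B2 _ bgj)) (F2 _ _ _ q1 bg).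
Qed.

Lemma resolvent_bounds1_lin (K b c1 c2 : R) g u v : 0 <= K -> 0 < b -> `|c1| <= 1 -> `|c2| <= 1 ->
  resolvent_bounds1 K b g u -> resolvent_bounds1 K b g v ->
  resolvent_bounds1 (2 * K) b g (fun x => c1 * u x + c2 * v x).
Proof.
move=> K0 b0 h1 h2 [bu Hu] [bv Hv]; have sb : 0 <= Num.sqrt b := sqrtr_ge0 _.
have key q (t : R) f h : 1 < q -> bCoo f -> bCoo h -> 0 <= t ->
    ('N_q [f] <= (K / t)%:E * 'N_q [g])%E -> ('N_q [h] <= (K / t)%:E * 'N_q [g])%E ->
    ('N_q [(fun x => c1 * f x + c2 * h x)%R] <= (2 * K / t)%:E * 'N_q [g])%E.
  move=> q1 bf bh t0 Hf Hh; have Kt : 0 <= K / t by exact: divr_ge0.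
  apply: Lnorm_scale_le (Lnorm_lin c1 c2 q1 bf bh Kt Kt Hf Hh).
  by rewrite -mulrDl -mulrA ler_wpM2r//; lra.
split; first by apply: bCooD; exact: bCooZ.
move=> q q1; have [u1 u2 u3] := Hu q q1; have [v1 v2 v3] := Hv q q1; split.
- by apply: key => //; rewrite sqr_ge0.
- by move=> i; rewrite partial_lin//; apply: key; rewrite ?mulr_ge0 ?(ltW b0)//; exact: bCoo_partial.
- move=> i j; have bpu := bCoo_partial j bu; have bpv := bCoo_partial j bv.
  rewrite partial_lin// partial_lin//; apply: key; rewrite ?(ltW b0)//; exact: bCoo_partial.
Qed.

(** The equation for [lap w] gives what products of two resolvents do not reach directly:
    coefficients of size b raise the bounds on w and w' to the right order, and h is a single
    second-order resolvent of g, already of that order. *)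
Lemma resolvent_boundsE (K L b a1 a2 a3 : R) g w w' h : 0 <= K -> 0 <= L -> 0 < b ->
  `|a1| <= b -> `|a2| <= b -> `|a3| <= 1 ->
  resolvent_bounds1 K b g w -> resolvent_bounds1 K b g w' ->
  bCoo h ->
  (forall q, 1 < q -> ('N_q [h] <= (L / b)%:E * 'N_q [g])%E /\
     forall i, ('N_q [partial i h] <= (L / Num.sqrt b)%:E * 'N_q [g])%E) ->
  (forall j, lap (partial j w) = partial j (lap w)) ->
  (forall x, lap w x = a1 * w x + a2 * w' x + a3 * h x) ->
  resolvent_bounds (2 * K + L) b g w.
Proof.
move=> K0 L0 b0 A1 A2 A3 [bw Hw] [bw' Hw'] bh Hh Hc El.
have sb : 0 < Num.sqrt b by rewrite sqrtr_gt0.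
have lE : lap w = fun x => 1 * (a1 * w x + a2 * w' x) + a3 * h x.
  by apply/funext => x; rewrite El mul1r.
have bl : bCoo (fun x => a1 * w x + a2 * w' x) by apply: bCooD; exact: bCooZ.
have KL : K <= 2 * K + L by lra.
have key q (t s : R) f f' h' : 1 < q -> bCoo f -> bCoo f' -> bCoo h' -> 0 < t -> 0 < s -> t = b * s ->
    ('N_q [f] <= (K / t)%:E * 'N_q [g])%E -> ('N_q [f'] <= (K / t)%:E * 'N_q [g])%E ->
    ('N_q [h'] <= (L / s)%:E * 'N_q [g])%E ->
    ('N_q [(fun x => 1 * (a1 * f x + a2 * f' x) + a3 * h' x)%R] <= ((2 * K + L) / s)%:E * 'N_q [g])%E.
  move=> q1 bf bf' bh' t0 s0 ts Hf Hf' Hh'.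
  have Kt : 0 <= K / t by rewrite divr_ge0// ltW.
  have Ls : 0 <= L / s by rewrite divr_ge0// ltW.
  have := Lnorm_lin a1 a2 q1 bf bf' Kt Kt Hf Hf' => H1.
  have n0 : 0 <= `|a1| * (K / t) + `|a2| * (K / t) by rewrite -mulrDl mulr_ge0 ?addr_ge0.
  have bb : bCoo (fun x => a1 * f x + a2 * f' x) by apply: bCooD; exact: bCooZ.
  apply: Lnorm_scale_le (Lnorm_lin 1 a3 q1 bb bh' n0 Ls H1 Hh').
  rewrite normr1 mul1r -mulrDl [leRHS]mulrDl; apply: lerD; last by rewrite ler_piMl.
  rewrite (_ : 2 * K / s = (b + b) * (K / t)); last by rewrite ts; field; rewrite !gt_eqF.
  by rewrite ler_wpM2r// lerD.
split=> // q q1; have [w1 w2 w3] := Hw q q1; have [v1 v2 v3] := Hw' q q1; have [h1 h2] := Hh q q1.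
split.
- by apply: Lnorm_scale_le w1; rewrite ler_wpM2r// invr_ge0 sqr_ge0.
- by move=> i; apply: Lnorm_scale_le (w2 i); rewrite ler_wpM2r// invr_ge0 mulr_ge0 ?(ltW b0) ?(ltW sb).
- by move=> i j; apply: Lnorm_scale_le (w3 i j); rewrite ler_wpM2r// invr_ge0 ltW.
- by rewrite lE; apply: (key q (b ^+ 2)) => //; rewrite exprn_gt0.
- move=> j; rewrite lE partial_lin// partial_lin//.
  apply: (key q (b * Num.sqrt b)) => //; try exact: bCoo_partial.
  by rewrite mulr_gt0.
Qed.

(** Delta^2 - k^2 = (k - Delta)(-k - Delta) with k = a + i b. The second factor is inverted by the
    conjugate of the resolvent at -a + i b, so w = (U1 + i V1)(U2 - i V2) g, with real and imaginary
    parts [Wr] and [Wi]. All these operators commute with partial derivatives, which yields [cWr]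
    and [cWi]. *)
Lemma fourth_order_solution : exists K : R, 0 <= K /\ forall a b : R, 0 < b -> `|a| <= b ->
  forall g, bCoo g -> exists wr wi,
  [/\ resolvent_bounds K b g wr, resolvent_bounds K b g wi,
     forall x, lap (lap wr) x = (a ^+ 2 - b ^+ 2) * wr x - 2 * a * b * wi x + g x &
     forall x, lap (lap wi) x = (a ^+ 2 - b ^+ 2) * wi x + 2 * a * b * wr x].
Proof.
have [K [K0 HK]] := @second_order_resolvent R N.
exists (2 * (2 * K ^+ 2) + K); split; first by rewrite addr_ge0// !mulr_ge0 ?sqr_ge0.
move=> a b b0 ab g bg; have [U1 [V1 [hU1 hV1 E1 F1]]] := HK a b b0 ab.
have ab' : `|- a| <= b by rewrite normrN.
have [U2 [V2 [hU2 hV2 E2 F2]]] := HK (- a) b b0 ab'.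
have [BU1 DU1 _ _] := hU1; have [BV1 DV1 _ _] := hV1.
have [BU2 DU2 EU2 FU2] := hU2; have [BV2 DV2 EV2 FV2] := hV2.
have K20 : 0 <= K ^+ 2 := sqr_ge0 _.
pose Wr f x := 1 * U1 (U2 f) x + 1 * V1 (V2 f) x; pose Wi f x := 1 * V1 (U2 f) x + -1 * U1 (V2 f) x.
have lapD u v c1 c2 x : bCoo u -> bCoo v ->
    lap (fun x => c1 * u x + c2 * v x) x = c1 * lap u x + c2 * lap v x.
  move=> bu bv; rewrite /lap !mulr_sumr -big_split; apply: eq_bigr => i _ /=.
  by rewrite partial_lin// partial_lin//; exact: bCoo_partial.
have LWr f x : bCoo f -> lap (Wr f) x = a * Wr f x - b * Wi f x - U2 f x.
  have key (u1 v1 l1 u2 v2 l2 h : R) : a * u1 - b * v1 - l1 = h -> a * v2 + b * u2 - l2 = 0 ->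
      1 * l1 + 1 * l2 = a * (1 * u1 + 1 * v2) - b * (1 * v1 + -1 * u2) - h by lra.
  move=> bf; have bU := BU2 f bf; have bV := BV2 f bf.
  rewrite lapD; [|exact: BU1|exact: BV1].
  exact: key (E1 _ x bU) (F1 _ x bV).
have LWi f x : bCoo f -> lap (Wi f) x = a * Wi f x + b * Wr f x + V2 f x.
  have key (u1 v1 l1 u2 v2 l2 h : R) : a * u1 - b * v1 - l1 = h -> a * v2 + b * u2 - l2 = 0 ->
      1 * l2 + -1 * l1 = a * (1 * v2 + -1 * u1) + b * (1 * u2 + 1 * v1) + h by lra.
  move=> bf; have bU := BU2 f bf; have bV := BV2 f bf.
  rewrite lapD; [|exact: BV1|exact: BU1].
  exact: key (E1 _ x bV) (F1 _ x bU).
have bWr f : bCoo f -> bCoo (Wr f).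
  by move=> bf; apply: bCooD; apply: bCooZ; [apply: BU1; exact: BU2|apply: BV1; exact: BV2].
have bWi f : bCoo f -> bCoo (Wi f).
  by move=> bf; apply: bCooD; apply: bCooZ; [apply: BV1; exact: BU2|apply: BU1; exact: BV2].
have dWr f j : bCoo f -> partial j (Wr f) = Wr (partial j f).
  move=> bf; have bU := BU2 f bf; have bV := BV2 f bf.
  rewrite /Wr partial_lin; [|exact: BU1|exact: BV1].
  by rewrite (DU1 _ j bU) (DV1 _ j bV) (DU2 _ j bf) (DV2 _ j bf).
have dWi f j : bCoo f -> partial j (Wi f) = Wi (partial j f).
  move=> bf; have bU := BU2 f bf; have bV := BV2 f bf.
  rewrite /Wi partial_lin; [|exact: BV1|exact: BU1].
  by rewrite (DU1 _ j bV) (DV1 _ j bU) (DU2 _ j bf) (DV2 _ j bf).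
have cWr j : lap (partial j (Wr g)) = partial j (lap (Wr g)).
  have bgj := bCoo_partial j bg; rewrite dWr//.
  rewrite (_ : lap (Wr g) = fun x => 1 * (a * Wr g x + - b * Wi g x) + -1 * U2 g x); last first.
    by apply/funext => z; rewrite LWr//; ring.
  rewrite partial_lin; [|by apply: bCooD; apply: bCooZ; [exact: bWr|exact: bWi]|exact: BU2].
  rewrite partial_lin; [|exact: bWr|exact: bWi].
  by apply/funext => z; rewrite LWr// dWr// dWi// DU2//; ring.
have cWi j : lap (partial j (Wi g)) = partial j (lap (Wi g)).
  have bgj := bCoo_partial j bg; rewrite dWi//.
  rewrite (_ : lap (Wi g) = fun x => 1 * (a * Wi g x + b * Wr g x) + 1 * V2 g x); last first.
    by apply/funext => z; rewrite LWi//; ring.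
  rewrite partial_lin; [|by apply: bCooD; apply: bCooZ; [exact: bWi|exact: bWr]|exact: BV2].
  rewrite partial_lin; [|exact: bWi|exact: bWr].
  by apply/funext => z; rewrite LWi// dWr// dWi// DV2//; ring.
pose hr := U2 g; pose hi := V2 g; pose wr := Wr g; pose wi := Wi g.
have bhr : bCoo hr := BU2 _ bg. have bhi : bCoo hi := BV2 _ bg.
have Lwr x : lap wr x = a * wr x - b * wi x - hr x by exact: LWr.
have Lwi x : lap wi x = a * wi x + b * wr x + hi x by exact: LWi.
have Lhr x : lap hr x = - a * hr x - b * hi x - g x by have e1 := E2 g x bg; rewrite -/hr -/hi in e1; clear -e1; lra.
have Lhi x : lap hi x = - a * hi x + b * hr x by have e1 := F2 g x bg; rewrite -/hr -/hi in e1; clear -e1; lra.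
have n1 : `|1 : R| <= 1 by rewrite normr1.
have nN1 : `|-1 : R| <= 1 by rewrite normrN normr1.
have w1 : resolvent_bounds1 (2 * K ^+ 2) b g wr.
  exact: (resolvent_bounds1_lin K20 b0 n1 n1 (composition_bounds K0 b0 hU1 hU2 bg) (composition_bounds K0 b0 hV1 hV2 bg)).
have w2 : resolvent_bounds1 (2 * K ^+ 2) b g wi.
  exact: (resolvent_bounds1_lin K20 b0 n1 nN1 (composition_bounds K0 b0 hV1 hU2 bg) (composition_bounds K0 b0 hU1 hV2 bg)).
have hrB q : 1 < q -> ('N_q [hr] <= (K / b)%:E * 'N_q [g])%E /\
     forall i, ('N_q [partial i hr] <= (K / Num.sqrt b)%:E * 'N_q [g])%E.
  by move=> q1; split=> [|i]; [exact: EU2|rewrite DU2//; exact: FU2].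
have hiB q : 1 < q -> ('N_q [hi] <= (K / b)%:E * 'N_q [g])%E /\
     forall i, ('N_q [partial i hi] <= (K / Num.sqrt b)%:E * 'N_q [g])%E.
  by move=> q1; split=> [|i]; [exact: EV2|rewrite DV2//; exact: FV2].
have bb : `|b| <= b by rewrite ger0_norm// ltW.
have bb' : `|- b| <= b by rewrite normrN.
have Kge : 0 <= 2 * K ^+ 2 by rewrite mulr_ge0.
have [bwr _] := w1; have [bwi _] := w2.
exists wr, wi; split.
- have L x : lap wr x = a * wr x + - b * wi x + -1 * hr x by rewrite Lwr; ring.
  exact: (resolvent_boundsE Kge K0 b0 ab bb' nN1 w1 w2 bhr hrB cWr L).
- have L x : lap wi x = a * wi x + b * wr x + 1 * hi x by rewrite Lwi mul1r.
  exact: (resolvent_boundsE Kge K0 b0 ab bb n1 w2 w1 bhi hiB cWi L).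
- move=> x; rewrite (_ : lap wr = fun x => 1 * (a * wr x + - b * wi x) + -1 * hr x); last first.
    by apply/funext => z; rewrite Lwr; ring.
  rewrite lapD//; last by apply: bCooD; exact: bCooZ.
  by rewrite lapD// Lwr Lwi Lhr; ring.
- move=> x; rewrite (_ : lap wi = fun x => 1 * (a * wi x + b * wr x) + 1 * hi x); last first.
    by apply/funext => z; rewrite Lwi; ring.
  rewrite lapD//; last by apply: bCooD; exact: bCooZ.
  by rewrite lapD// Lwr Lwi Lhi; ring.
Qed.

End fourth_order.

(** * The local estimate *)

Section commutator.
Context {R : realType} {N : nat}.
Implicit Types (f g u v w eta : 'rV[R]_N -> R) (x : 'rV[R]_N) (i j : 'I_N).

Local Notation e_ i := (delta_mx ord0 i : 'rV[R]_N).
Local Notation mu := (@lebesgue_rV R N).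
Local Notation "'N_ p [ f ]" := ('N[mu]_p%:E[EFin \o f])%E.

Definition gradp f g x : R := \sum_j partial j f x * partial j g x.

#[local] Opaque partial bCoo.

Lemma partialMb i f g : bCoo f -> bCoo g ->
  partial i (fun x => f x * g x) = fun x => partial i f x * g x + f x * partial i g x.
Proof.
move=> bf bg; have df x : derivable f x (e_ i) := bCoo_derivable bf.
have dg x : derivable g x (e_ i) := bCoo_derivable bg.
rewrite (partialM df dg); apply/funext => x.
by move: (partial i f x) (partial i g x) (f x) (g x) => *; ring.
Qed.

Lemma partialDb i f g : bCoo f -> bCoo g ->
  partial i (fun x => f x + g x) = fun x => partial i f x + partial i g x.
Proof.
move=> bf bg; have := partial_lin i 1 1 bf bg.
by under eq_fun do rewrite !mul1r; move=> ->; apply/funext => x; rewrite !mul1r.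
Qed.

Lemma lapM f g : bCoo f -> bCoo g ->
  lap (fun x => f x * g x) = fun x => f x * lap g x + 2 * gradp f g x + g x * lap f x.
Proof.
move=> bf bg; apply/funext => x; rewrite /lap /gradp !mulr_sumr -!big_split.
apply: eq_bigr => i _ /=; have bfi := bCoo_partial i bf; have bgi := bCoo_partial i bg.
have b1 := bCooM bfi bg; have b2 := bCooM bf bgi.
rewrite (partialMb i bf bg) (partialDb i b1 b2) (partialMb i bfi bg) (partialMb i bf bgi).
move: (partial i (partial i f) x) (partial i (partial i g) x) (partial i f x) (partial i g x) => *.
by move: (f x) (g x) => *; ring.
Qed.

Lemma lapD f g : bCoo f -> bCoo g -> lap (fun x => f x + g x) = fun x => lap f x + lap g x.
Proof.
move=> bf bg; apply/funext => x; rewrite /lap -big_split; apply: eq_bigr => i _ /=.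
by rewrite (partialDb i bf bg) (partialDb i (bCoo_partial i bf) (bCoo_partial i bg)).
Qed.

Lemma lapZ (c : R) f : bCoo f -> lap (fun x => c * f x) = fun x => c * lap f x.
Proof.
move=> bf; apply/funext => x; rewrite /lap mulr_sumr; apply: eq_bigr => i _.
have dc h : bCoo h -> partial i (fun x => c * h x) = fun x => c * partial i h x.
  by move=> bh; rewrite partialZ// => z; exact: bCoo_derivable.
by rewrite dc// dc//; exact: bCoo_partial.
Qed.

Lemma lap_sum (I : Type) (r : seq I) (F : I -> 'rV[R]_N -> R) : (forall k, bCoo (F k)) ->
  lap (fun x => \sum_(k <- r) F k x) = fun x => \sum_(k <- r) lap (F k) x.
Proof.
move=> bF; elim: r => [|k r IH].
  apply/funext => x; rewrite big_nil /lap big1// => i _.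
  by under eq_fun do rewrite big_nil; rewrite !partial_cst.
under eq_fun do rewrite big_cons.
rewrite lapD//; last exact: bCoo_sum.
by rewrite IH; apply/funext => x; rewrite big_cons.
Qed.

Lemma bCoo_gradp f g : bCoo f -> bCoo g -> bCoo (gradp f g).
Proof. by move=> bf bg; apply: bCoo_sum => j; apply: bCooM; exact: bCoo_partial. Qed.

#[local] Opaque lap gradp.

(** [Delta^2, eta] w in the form that two applications of the product rule for [lap] produce. Every
    term has four derivatives in all, at least one of them on eta. *)
Definition comm eta w x := 2 * gradp eta (lap w) x + 2 * (lap eta x * lap w x) +
  lap (lap eta) x * w x + 2 * gradp (lap eta) w x +
  2 * \sum_j (partial j eta x * lap (partial j w) x +
     2 * gradp (partial j eta) (partial j w) x + lap (partial j eta) x * partial j w x).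

Lemma lap_lapM eta w x : bCoo eta -> bCoo w ->
  lap (lap (fun x => eta x * w x)) x = eta x * lap (lap w) x + comm eta w x.
Proof.
move=> be bw; have ble := bCoo_lap be; have blw := bCoo_lap bw.
have bg := bCoo_gradp be bw; have b1 := bCooM be blw; have b2 := bCooZ 2 bg.
have b3 := bCooM bw ble; have b12 := bCooD b1 b2.
have E1 : lap (lap (fun x => eta x * w x)) x =
    lap (fun z => eta z * lap w z + 2 * gradp eta w z + w z * lap eta z) x :=
  congr1 (fun F => lap F x) (lapM be bw).
have E2 := congr1 (fun F => F x) (lapD b12 b3); have E3 := congr1 (fun F => F x) (lapD b1 b2).
have E4 := congr1 (fun F => F x) (lapM be blw); have E5 := congr1 (fun F => F x) (lapZ 2 bg).
have E6 := congr1 (fun F => F x)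
  (lap_sum (index_enum 'I_N) (fun j => bCooM (bCoo_partial j be) (bCoo_partial j bw))).
have E7 := congr1 (fun F => F x) (lapM bw ble).
have E8 : gradp w (lap eta) x = gradp (lap eta) w x by apply: eq_bigr => j _; exact: mulrC.
have E9 : \sum_j lap (fun x => partial j eta x * partial j w x) x =
    \sum_j (partial j eta x * lap (partial j w) x +
     2 * gradp (partial j eta) (partial j w) x + lap (partial j eta) x * partial j w x).
  apply: eq_bigr => j _; have := congr1 (fun F => F x) (lapM (bCoo_partial j be) (bCoo_partial j bw)).
  by move=> ->; congr (_ + _); exact: mulrC.
have key (A B A1 A2 G S e LLw g1 Lw Le w0 LLe g4 g4' S' : R) : A = A1 + A2 ->
    A1 = e * LLw + 2 * g1 + Lw * Le -> A2 = 2 * G -> G = S' -> S' = S ->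
    B = w0 * LLe + 2 * g4' + Le * Lw -> g4' = g4 ->
    A + B = e * LLw + (2 * g1 + 2 * (Le * Lw) + LLe * w0 + 2 * g4 + 2 * S).
  by move=> -> -> -> -> -> -> ->; ring.
apply: (etrans E1); apply: (etrans E2).
exact: (key _ _ _ _ _ _ _ _ _ _ _ _ _ _ _ _ E3 E4 E5 E6 E9 E7 E8).
Qed.

Lemma bCoo_comm eta w : bCoo eta -> bCoo w -> bCoo (comm eta w).
Proof.
move=> be bw; have ble := bCoo_lap be; have blw := bCoo_lap bw.
have b4 j := bCooM (bCoo_partial j be) (bCoo_lap (bCoo_partial j bw)).
have b5 j := bCooZ 2 (bCoo_gradp (bCoo_partial j be) (bCoo_partial j bw)).
have b6 j := bCooM (bCoo_lap (bCoo_partial j be)) (bCoo_partial j bw).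
have b7 := bCoo_sum (index_enum 'I_N) (fun j => bCooD (bCooD (b4 j) (b5 j)) (b6 j)).
exact: (bCooD (bCooD (bCooD (bCooD (bCooZ 2 (bCoo_gradp be blw)) (bCooZ 2 (bCooM ble blw)))
  (bCooM (bCoo_lap ble) bw)) (bCooZ 2 (bCoo_gradp ble bw))) (bCooZ 2 b7)).
Qed.

(** The datum g of the resolvent equation is the common unit of measure, so that bounds add and
    multiply as plain numbers. *)
Definition nb (q : R) g f (B : R) := [/\ bCoo f, 0 <= B & ('N_q [f] <= B%:E * 'N_q [g])%E].

Section norm_bounds.
Variables (q : R) (g : 'rV[R]_N -> R).
Hypothesis q1 : 1 < q.

Lemma nb_le f B B' : nb q g f B -> B <= B' -> nb q g f B'.
Proof.
by move=> [bf B0 H] BB; split; [|exact: le_trans BB|exact: Lnorm_scale_le H].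
Qed.

Lemma nbD f1 f2 B1 B2 : nb q g f1 B1 -> nb q g f2 B2 -> nb q g (fun x => f1 x + f2 x) (B1 + B2).
Proof.
move=> [b1 p1 h1] [b2 p2 h2]; split; [exact: bCooD|exact: addr_ge0|].
apply: le_trans (LnormD q1 _ _) _; [exact: bCoo_measurable|exact: bCoo_measurable|].
by rewrite EFinD ge0_muleDl ?lee_fin//; exact: leeD.
Qed.

Lemma nbM m f M B : bCoo m -> (forall x, `|m x| <= M) -> nb q g f B ->
  nb q g (fun x => m x * f x) (M * B).
Proof.
move=> bm mM [bf B0 h]; have M0 : 0 <= M by exact: le_trans (mM 0).
have q0 : 0 < q by exact: lt_trans q1.
have mf := bCoo_measurable bf; have mm := bCoo_measurable bm.
split; [exact: bCooM|exact: mulr_ge0|].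
apply: (@le_trans _ _ ('N_q [(fun x => M * f x)%R])).
  apply: le_Lnorm => //; [exact: measurable_funM|exact: measurable_funM|].
  by move=> x; rewrite !normrM (ger0_norm M0) ler_wpM2r.
by rewrite LnormZl// ger0_norm// EFinM -muleA lee_wpmul2l.
Qed.

Lemma nbZ (c : R) f B : 0 <= c -> nb q g f B -> nb q g (fun x => c * f x) (c * B).
Proof. by move=> c0 h; apply: nbM => //; [exact: bCoo_cst|move=> x; rewrite ger0_norm]. Qed.

Lemma nb_sum (F : 'I_N -> 'rV[R]_N -> R) B : 0 <= B -> (forall j, nb q g (F j) B) ->
  nb q g (fun x => \sum_j F j x) (N%:R * B).
Proof.
move=> B0 h; have q0 : 0 < q by exact: lt_trans q1.
have key (r : seq 'I_N) : nb q g (fun x => \sum_(j <- r) F j x) ((size r)%:R * B).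
  elim: r => [|j r IH] /=.
    under eq_fun do rewrite big_nil; split; [exact: bCoo_cst|by rewrite mul0r|].
    rewrite mul0r mul0e (_ : 'N[mu]_q%:E[_]%E = 0%E)//.
    have := @LnormZl _ _ _ mu q 0 (fun=> 0) q0 (measurable_cst _).
    by under eq_fun do rewrite mul0r; rewrite normr0 mul0e.
  under eq_fun do rewrite big_cons.
  rewrite (_ : (size r).+1%:R * B = B + (size r)%:R * B); first exact: nbD.
  by rewrite -natr1; ring.
by have := key (index_enum 'I_N); rewrite [index_enum _]unlock -enumT size_enum_ord.
Qed.

End norm_bounds.

(* [1 / H] is the length scale of the cutoff [eta] *)
Definition cutoff_bounds (M H : R) eta := [/\ bCoo eta,
  forall i x, `|partial i eta x| <= M * H,
  (forall i j x, `|partial i (partial j eta) x| <= M * H ^+ 2) /\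
    forall x, `|lap eta x| <= M * H ^+ 2,
  (forall i x, `|partial i (lap eta) x| <= M * H ^+ 3) /\
    forall i x, `|lap (partial i eta) x| <= M * H ^+ 3 &
  forall x, `|lap (lap eta) x| <= M * H ^+ 4].

(** The spectral size is b = beta^2, so beta is an inverse length, to be compared with H. Each term
    is at most M K H / beta, and with multiplicities there are 2N + 2 + 1 + 2N + 2N (2N + 2) = 4N^2
    + 8N + 3 of them. *)
Lemma comm_bound (q M H K beta : R) eta g w : 1 < q -> 0 <= M -> 0 <= K -> 0 < beta ->
  0 <= H <= beta -> cutoff_bounds M H eta -> resolvent_bounds K (beta ^+ 2) g w ->
  nb q g (comm eta w) ((4 * N%:R ^+ 2 + 8 * N%:R + 3) * (M * K * (H / beta))).
Proof.
move=> q1 M0 K0 b0 /andP[H0 Hb] [be e1 [e2 e2'] [e3 e3'] e4] [bw cw /(_ q q1)].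
have sb : Num.sqrt (beta ^+ 2) = beta by rewrite sqrtr_sqr ger0_norm// ltW.
rewrite sb => -[w0 w1 w2 w2' w1'].
pose y := H / beta; have y0 : 0 <= y by rewrite divr_ge0 ?(ltW b0).
have y1 : y <= 1 by rewrite ler_pdivrMr// mul1r.
pose Y := M * K * y; have Y0 : 0 <= Y := mulr_ge0 (mulr_ge0 M0 K0) y0.
have bn0 : beta != 0 by rewrite gt_eqF.
(* [k.+1] derivatives fall on eta and the other 3 - k on w, giving (H / beta)^{k+1}, which is at
   most H / beta because that ratio is at most 1. *)
have key m f k (B : R) : bCoo m -> (forall x, `|m x| <= M * H ^+ k.+1) -> bCoo f ->
    ('N_q [f] <= B%:E * 'N_q [g])%E -> B = K / beta ^+ k.+1 -> nb q g (fun x => m x * f x) Y.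
  move=> bm mM bf hf BE; have B0 : 0 <= B by rewrite BE divr_ge0// exprn_ge0// ltW.
  apply: (@nb_le _ _ _ (M * H ^+ k.+1 * B)); first exact: (nbM q1 bm mM).
  rewrite BE (_ : M * H ^+ k.+1 * (K / beta ^+ k.+1) = M * K * y ^+ k.+1); last first.
    by rewrite /y expr_div_n; ring.
  by rewrite ler_wpM2l ?mulr_ge0// exprS ler_piMr// exprn_ile1.
have bpe i := bCoo_partial i be; have bpw i := bCoo_partial i bw.
have ble := bCoo_lap be; have blw := bCoo_lap bw.
have g1 : nb q g (gradp eta (lap w)) (N%:R * Y).
  apply: nb_sum => // j; apply: (key _ _ 0%N _ (bpe j) (e1 j)); [exact: bCoo_partial|exact: w1'|by rewrite expr1].
have g2 : nb q g (fun x => lap eta x * lap w x) Y by apply: (key _ _ 1%N _ ble e2' blw w2').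
have g3 : nb q g (fun x => lap (lap eta) x * w x) Y.
  by apply: (key _ _ 3%N _ (bCoo_lap ble) e4 bw w0); field.
have g4 : nb q g (gradp (lap eta) w) (N%:R * Y).
  apply: nb_sum => // j; apply: (key _ _ 2%N _ (bCoo_partial j ble) (e3 j) (bpw j) (w1 j)); by field.
have g5 j : nb q g (fun x => partial j eta x * lap (partial j w) x) Y.
  rewrite cw; apply: (key _ _ 0%N _ (bpe j) (e1 j)); [exact: bCoo_partial|exact: w1'|by rewrite expr1].
have g6 j : nb q g (gradp (partial j eta) (partial j w)) (N%:R * Y).
  by apply: nb_sum => // i; apply: (key _ _ 1%N _ (bCoo_partial i (bpe j)) (e2 i j) (bCoo_partial i (bpw j)) (w2 i j)).
have g7 j : nb q g (fun x => lap (partial j eta) x * partial j w x) Y.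
  by apply: (key _ _ 2%N _ (bCoo_lap (bpe j)) (e3' j) (bpw j) (w1 j)); field.
have two : 0 <= 2 :> R by [].
have g8 : nb q g (fun x => \sum_j (partial j eta x * lap (partial j w) x +
     2 * gradp (partial j eta) (partial j w) x + lap (partial j eta) x * partial j w x))
     (N%:R * (Y + 2 * (N%:R * Y) + Y)).
  have nY : 0 <= N%:R * Y := mulr_ge0 (ler0n _ _) Y0.
  apply: nb_sum => //; first exact: addr_ge0 (addr_ge0 Y0 (mulr_ge0 (ler0n _ 2) nY)) Y0.
  move=> j; exact: (nbD q1 (nbD q1 (g5 j) (nbZ q1 two (g6 j))) (g7 j)).
have := nbD q1 (nbD q1 (nbD q1 (nbD q1 (nbZ q1 two g1) (nbZ q1 two g2)) g3) (nbZ q1 two g4)) (nbZ q1 two g8).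
rewrite -/y -/Y (_ : (4 * N%:R ^+ 2 + 8 * N%:R + 3) * Y = 2 * (N%:R * Y) + 2 * Y + Y +
  2 * (N%:R * Y) + 2 * (N%:R * (Y + 2 * (N%:R * Y) + Y))) //.
by ring.
Qed.

End commutator.

(** * The duality estimate on one cube *)

Section local_estimate.
Context {R : realType} {N : nat}.
Implicit Types (f g u v w eta : 'rV[R]_N -> R) (x : 'rV[R]_N) (i j : 'I_N).

Local Notation e_ i := (delta_mx ord0 i : 'rV[R]_N).
Local Notation mu := (@lebesgue_rV R N).
Local Notation "'N_ p [ f ]" := ('N[mu]_p%:E[EFin \o f])%E.

Lemma comm_out eta w (O : set 'rV[R]_N) : open O -> (forall x, O x -> eta x = 0) ->
  forall x, O x -> comm eta w x = 0.
Proof.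
move=> oO e0.
have p0 h i : (forall x, O x -> h x = 0) -> forall x, O x -> partial i h x = 0 by exact: partial_eq0.
have l0 h : (forall x, O x -> h x = 0) -> forall x, O x -> lap h x = 0.
  move=> h0 x Ox; rewrite /lap big1// => i _; have h1 := p0 h i h0.
  exact: (p0 _ i h1 x Ox).
have g0 h k : (forall x, O x -> h x = 0) -> forall x, O x -> gradp h k x = 0.
  by move=> h0 x Ox; rewrite /gradp big1// => i _; rewrite (p0 h)// mul0r.
move=> x Ox; have el := l0 _ e0.
rewrite /comm (g0 eta)// el// (l0 _ el)// (g0 _ _ el)// big1; first by rewrite !mul0r !mulr0 !addr0.
move=> j _; have ej := p0 _ j e0.
by rewrite ej// (g0 _ _ ej)// (l0 _ ej)// !mul0r mulr0 !addr0.
Qed.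

Lemma test_function_comm eta w : test_function eta -> bCoo w -> test_function (comm eta w).
Proof.
move=> te bw; apply: test_functionP; first by apply: bCoo_comm => //; exact: test_function_bCoo.
have [M HM] := test_function_support te; exists M => x fx i.
rewrite leNgt; apply: contra fx => Mi; apply/eqP.
apply: (@comm_out _ _ [set x : 'rV[R]_N | exists i, M < `|x ord0 i|]); last by exists i.
  exact: open_out_box.
by move=> y [j Mj]; apply/eqP; apply: contraTT Mj => /HM; rewrite -leNgt.
Qed.

Lemma test_function_lap f : test_function f -> test_function (lap f).
Proof.
move=> tf.
have key (r : seq 'I_N) : test_function (fun x => \sum_(i <- r) partial i (partial i f) x).
  elim: r => [|i r IH]; first by under eq_fun do rewrite big_nil; exact: test_function0.
  under eq_fun do rewrite big_cons; apply: test_functionD => //.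
  exact: (@test_function_partials _ _ f [:: i; i]).
exact: key.
Qed.

Lemma test_function_Lnorm_lty q f : 0 < q -> test_function f -> ('N_q [f] < +oo)%E.
Proof.
move=> q0 tf; have bf := test_function_bCoo tf; have [K fK] := bCoo_bounded bf.
have [M HM] := test_function_support tf.
pose B := obox (const_mx (- M - 1) : 'rV[R]_N) (const_mx (M + 1)).
apply/Lnorm_ltyP => //.
apply: (@le_lt_trans _ _ (\int[mu]_x ((K `^ q)%:E * (\1_B x)%:E))%E).
  apply: ge0_le_integral => //.
  - by apply: measurable_pow; exact: bCoo_measurable.
  - by apply: measurable_funeM; apply/measurable_EFinP/measurable_indic; exact: measurable_obox.
  move=> x _; rewrite indicE -EFinM lee_fin.
  have [->|fx] := eqVneq (f x) 0.
    by rewrite normr0 powR0 ?gt_eqF// mulr_ge0 ?powR_ge0.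
  rewrite mem_set ?mulr1; first by rewrite ge0_ler_powR ?(ltW q0)// nnegrE// (le_trans _ (fK 0)).
  move=> i; rewrite !mxE; have := HM x fx i; rewrite ler_norml => /andP[h1 h2].
  by apply/andP; split; lra.
rewrite ge0_integralZl ?lee_fin ?powR_ge0//; last first.
  by apply/measurable_EFinP/measurable_indic; exact: measurable_obox.
rewrite integral_indic ?setIT//; last exact: measurable_obox.
by rewrite lte_mul_pinfty// ?lee_fin ?powR_ge0//; exact: obox_finite.
Qed.

(** All four derivatives sit on the test function. This very weak form of Delta^2 u = b is what the
    duality argument pairs with. *)
Definition weak_bilap u (b : 'rV[R]_N -> R) :=
  [/\ measurable_fun setT u, measurable_fun setT b,
      forall phi, test_function phi -> mu.-integrable setT (EFin \o (fun x => u x * phi x)),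
      forall phi, test_function phi -> mu.-integrable setT (EFin \o (fun x => b x * phi x)) &
      forall phi, test_function phi ->
        \int[mu]_x (u x * lap (lap phi) x) = \int[mu]_x (b x * phi x)].

Lemma weak_bilapN u b : weak_bilap u b -> weak_bilap (fun x => - u x) (fun x => - b x).
Proof.
move=> [mu' mb iu ib E].
have iN h : mu.-integrable setT (EFin \o h) -> mu.-integrable setT (EFin \o (fun x => - h x)).
  by move=> /(integrableRZ (-1)); under eq_fun do rewrite mulN1r.
have RN h : mu.-integrable setT (EFin \o h) -> \int[mu]_x (- h x) = - \int[mu]_x h x.
  move=> ih; rewrite -mulN1r -RintegralZl//; apply: eq_Rintegral => x _; by rewrite mulN1r.
split; [exact: measurableT_comp|exact: measurableT_comp| | |].
- by move=> phi tp; under eq_fun do rewrite mulNr; exact: iN (iu _ tp).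
- by move=> phi tp; under eq_fun do rewrite mulNr; exact: iN (ib _ tp).
- move=> phi tp; under eq_Rintegral do rewrite mulNr; under [RHS]eq_Rintegral do rewrite mulNr.
  rewrite RN; last by apply: iu; do 2 apply: test_function_lap.
  by rewrite RN ?E//; exact: ib.
Qed.

Lemma integral_is_eq (F G : 'rV[R]_N -> R) (v : R) : integral_is mu F v -> F =1 G -> integral_is mu G v.
Proof. by move=> h /funext <-. Qed.

(** For u = ur + i ui and a solution w = wr + i wi of (Delta^2 + mr + i mi) w = g, the weak equation
    is tested with eta w, and eta Delta^2 w = Delta^2(eta w) - [comm eta w]. Only the real part is
    recorded. *)
Lemma weak_pairing ur ui br bi eta wr wi g (mr mi : R) :
  weak_bilap ur br -> weak_bilap ui bi -> test_function eta -> bCoo wr -> bCoo wi -> bCoo g ->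
  (forall x, lap (lap wr) x = - mr * wr x + mi * wi x + g x) ->
  (forall x, lap (lap wi) x = - mr * wi x - mi * wr x) ->
  \int[mu]_x (eta x * ur x * g x) =
    \int[mu]_x (eta x * (br x + mr * ur x - mi * ui x) * wr x) -
    \int[mu]_x (eta x * (bi x + mr * ui x + mi * ur x) * wi x) -
    \int[mu]_x (ur x * comm eta wr x) + \int[mu]_x (ui x * comm eta wi x).
Proof.
move=> [_ _ iur ibr Er] [_ _ iui ibi Ei] te bwr bwi bg Lr Li.
have tr : test_function (fun x => eta x * wr x) := test_functionM bwr te.
have ti : test_function (fun x => eta x * wi x) := test_functionM bwi te.
have tg : test_function (fun x => eta x * g x) := test_functionM bg te.
have tcr := test_function_comm te bwr; have tci := test_function_comm te bwi.
have be := test_function_bCoo te.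
have I h : mu.-integrable setT (EFin \o h) -> integral_is mu h (\int[mu]_x h x) by [].
have a1 := I _ (ibr _ tr); have a2 := I _ (ibi _ ti).
have a3 := I _ (iur _ tr); have a4 := I _ (iur _ ti); have a5 := I _ (iui _ tr); have a6 := I _ (iui _ ti).
have a7 := I _ (iur _ tg); have a8 := I _ (iur _ tcr); have a9 := I _ (iui _ tci).
have HR := Er _ tr; have HI := Ei _ ti.
set J1 := \int[mu]_x (br x * _) in a1 HR *; set J2 := \int[mu]_x (bi x * _) in a2 HI *.
set J3 := \int[mu]_x (ur x * (eta x * wr x)) in a3; set J4 := \int[mu]_x (ur x * (eta x * wi x)) in a4.
set J5 := \int[mu]_x (ui x * (eta x * wr x)) in a5; set J6 := \int[mu]_x (ui x * (eta x * wi x)) in a6.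
set J7 := \int[mu]_x (ur x * (eta x * g x)) in a7.
set J8 := \int[mu]_x (ur x * comm _ _ x) in a8 *; set J9 := \int[mu]_x (ui x * comm _ _ x) in a9 *.
have [_ H1] : integral_is mu (fun x => ui x * lap (lap (fun x => eta x * wi x)) x) (- mr * J6 + - mi * J5 + J9).
  apply: integral_is_eq (integral_isD (integral_isD (integral_isZ (- mr) a6) (integral_isZ (- mi) a5)) a9) _ => x.
  rewrite (lap_lapM x be bwi) Li; move: (comm _ _ x) (ui x) (eta x) (wi x) (wr x); clear => *; ring.
have [_ H2] : integral_is mu (fun x => ur x * lap (lap (fun x => eta x * wr x)) x) (- mr * J3 + mi * J4 + J7 + J8).
  apply: integral_is_eq (integral_isD (integral_isD (integral_isD (integral_isZ (- mr) a3) (integral_isZ mi a4)) a7) a8) _ => x.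
  rewrite (lap_lapM x be bwr) Lr; move: (comm _ _ x) (ur x) (eta x) (wi x) (wr x) (g x); clear => *; ring.
have [_ H3] : integral_is mu (fun x => eta x * (br x + mr * ur x - mi * ui x) * wr x) (J1 + mr * J3 + - mi * J5).
  apply: integral_is_eq (integral_isD (integral_isD a1 (integral_isZ mr a3)) (integral_isZ (- mi) a5)) _ => x.
  by move: (br x) (ur x) (ui x) (eta x) (wr x); clear => *; ring.
have [_ H4] : integral_is mu (fun x => eta x * (bi x + mr * ui x + mi * ur x) * wi x) (J2 + mr * J6 + mi * J4).
  apply: integral_is_eq (integral_isD (integral_isD a2 (integral_isZ mr a6)) (integral_isZ mi a4)) _ => x.
  by move: (bi x) (ur x) (ui x) (eta x) (wi x); clear => *; ring.
have [_ H5] : integral_is mu (fun x => eta x * ur x * g x) J7.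
  by apply: integral_is_eq a7 _ => x; rewrite mulrA [ur x * _]mulrC.
have key (X1 X2 Y1 Y2 Y3 j1 j2 j3 j4 j5 j6 j7 j8 j9 : R) : X1 = j2 -> X2 = j1 ->
    X1 = - mr * j6 + - mi * j5 + j9 -> X2 = - mr * j3 + mi * j4 + j7 + j8 ->
    Y1 = j1 + mr * j3 + - mi * j5 -> Y2 = j2 + mr * j6 + mi * j4 -> Y3 = j7 ->
    Y3 = Y1 - Y2 - j8 + j9 by clear => *; lra.
exact: (key _ _ _ _ _ _ _ _ _ _ _ _ _ _ HI HR H1 H2 H3 H4 H5).
Qed.

Lemma hoelder_le p q f h (A B : R) : 0 < p -> 0 < q -> p^-1 + q^-1 = 1 ->
  measurable_fun setT f -> measurable_fun setT h -> 0 <= A ->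
  ('N_p [f] <= A%:E)%E -> ('N_q [h] <= B%:E)%E -> `|\int[mu]_x (f x * h x)| <= A * B.
Proof.
move=> p0 q0 pq mf mh A0 hA hB.
have fl : ('N_p [f] < +oo)%E by exact: le_lt_trans hA (ltry _).
have hl : ('N_q [h] < +oo)%E by exact: le_lt_trans hB (ltry _).
rewrite -lee_fin EFinM; apply: le_trans (hoelder_Rintegral mf mh p0 q0 pq fl hl) _.
by apply: lee_pmul => //; exact: Lnorm_ge0.
Qed.

Definition local_bound (K : R) : Prop :=
  forall (p q : R), 1 < p -> 1 < q -> p^-1 + q^-1 = 1 ->
  forall ur ui br bi eta (B : set 'rV[R]_N) (a beta M H P1 P2 T1 T2 : R),
  weak_bilap ur br -> weak_bilap ui bi -> test_function eta ->
  measurable B -> open (~` B) -> (forall x, ~ B x -> eta x = 0) ->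
  0 < beta -> `|a| <= beta ^+ 2 -> 0 <= M -> 0 <= H <= beta -> cutoff_bounds M H eta ->
  let mr := (beta ^+ 2) ^+ 2 - a ^+ 2 in let mi := - 2 * a * beta ^+ 2 in
  0 <= P1 -> 0 <= P2 -> 0 <= T1 -> 0 <= T2 ->
  ('N_p [(fun x => eta x * (br x + mr * ur x - mi * ui x))%R] <= P1%:E)%E ->
  ('N_p [(fun x => eta x * (bi x + mr * ui x + mi * ur x))%R] <= P2%:E)%E ->
  ('N_p [(fun x => \1_B x * ur x)%R] <= T1%:E)%E ->
  ('N_p [(fun x => \1_B x * ui x)%R] <= T2%:E)%E ->
  ('N_p [(fun x => eta x * ur x)%R] < +oo)%E ->
  ('N_p [(fun x => eta x * ur x)%R] <=
    (K * ((P1 + P2) / beta ^+ 4 + M * (H / beta) * (T1 + T2)))%:E)%E.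

Lemma local_estimate : exists K : R, 0 <= K /\ local_bound K.
Proof.
have [K [K0 HK]] := @fourth_order_solution R N.
pose cN : R := 4 * N%:R ^+ 2 + 8 * N%:R + 3.
have cN0 : 0 <= cN by rewrite /cN; have := ler0n R N; nra.
exists (K * (1 + cN)); split; first by rewrite mulr_ge0// addr_ge0.
move=> p q p1 q1 pq ur ui br bi eta B a beta M H P1 P2 T1 T2 wr_ wi_ te mB oB eB b0 ab M0 Hb cb mr mi.
move=> P10 P20 T10 T20 hP1 hP2 hT1 hT2 hfin.
have [mur mbr _ _ _] := wr_; have [mui mbi _ _ _] := wi_.
have be := test_function_bCoo te; have me := bCoo_measurable be.
have p0 : 0 < p by exact: lt_trans p1. have q0 : 0 < q by exact: lt_trans q1.
have m1 : measurable_fun setT (\1_B : 'rV[R]_N -> R) by exact: measurable_indic.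
have y0 : 0 <= H / beta by have /andP[? _] := Hb; rewrite divr_ge0// ltW.
apply: (Lnorm_duality p1 q1 pq) => //.
- exact: measurable_funM.
- apply: mulr_ge0; first by rewrite mulr_ge0// addr_ge0.
  apply: addr_ge0; first by rewrite divr_ge0 ?exprn_ge0 ?(ltW b0)// addr_ge0.
  by rewrite mulr_ge0 ?addr_ge0// mulr_ge0.
move=> g tg; have bg := test_function_bCoo tg.
have b20 : 0 < beta ^+ 2 by exact: exprn_gt0.
have [wr [wi [Br Bi Lr Li]]] := HK a (beta ^+ 2) b20 ab g bg.
have [bwr _ /(_ q q1)[nwr _ _ _ _]] := Br; have [bwi _ /(_ q q1)[nwi _ _ _ _]] := Bi.
have Lr' x : lap (lap wr) x = - mr * wr x + mi * wi x + g x.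
  by rewrite Lr /mr /mi; move: (wr x) (wi x) (g x); clear => *; ring.
have Li' x : lap (lap wi) x = - mr * wi x - mi * wr x.
  by rewrite Li /mr /mi; move: (wr x) (wi x); clear => *; ring.
rewrite (weak_pairing wr_ wi_ te bwr bwi bg Lr' Li').
have Gl := test_function_Lnorm_lty q0 tg.
pose G := fine ('N_q [g])%E.
have GE : ('N_q [g] = G%:E)%E by rewrite fineK// ge0_fin_numE ?Lnorm_ge0.
have G0 : 0 <= G by rewrite fine_ge0// Lnorm_ge0.
rewrite GE -EFinM lee_fin; rewrite GE -EFinM in nwr; rewrite GE -EFinM in nwi.
have [bcr c0 ncr] := comm_bound q1 M0 K0 b0 Hb cb Br.
have [bci _ nci] := comm_bound q1 M0 K0 b0 Hb cb Bi.
rewrite GE -EFinM -/cN in ncr; rewrite GE -EFinM -/cN in nci.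
(* As eta vanishes on the open complement of B, so does the commutator; u may be multiplied by the
   indicator of B, and only its norm on B enters. *)
have i1 : (fun x => ur x * comm eta wr x) = fun x => \1_B x * ur x * comm eta wr x.
  apply/funext => x; rewrite indicE; have [xB|xB] := pselect (B x).
    by rewrite mem_set// mul1r.
  by rewrite (comm_out _ oB eB)// !mulr0.
have i2 : (fun x => ui x * comm eta wi x) = fun x => \1_B x * ui x * comm eta wi x.
  apply/funext => x; rewrite indicE; have [xB|xB] := pselect (B x).
    by rewrite mem_set// mul1r.
  by rewrite (comm_out _ oB eB)// !mulr0.
rewrite i1 i2.
have h1 := hoelder_le p0 q0 pq (measurable_funM me (measurable_funB (measurable_funD mbr (measurable_funM (measurable_cst mr) mur)) (measurable_funM (measurable_cst mi) mui)))
   (bCoo_measurable bwr) P10 hP1 nwr.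
have h2 := hoelder_le p0 q0 pq (measurable_funM me (measurable_funD (measurable_funD mbi (measurable_funM (measurable_cst mr) mui)) (measurable_funM (measurable_cst mi) mur)))
   (bCoo_measurable bwi) P20 hP2 nwi.
have h3 := hoelder_le p0 q0 pq (measurable_funM m1 mur) (bCoo_measurable bcr) T10 hT1 ncr.
have h4 := hoelder_le p0 q0 pq (measurable_funM m1 mui) (bCoo_measurable bci) T20 hT2 nci.
have e4 : beta ^+ 2 ^+ 2 = beta ^+ 4 by rewrite -exprM.
rewrite e4 in h1 h2.
have tri (z1 z2 z3 z4 y1 y2 y3 y4 : R) : `|z1| <= y1 -> `|z2| <= y2 -> `|z3| <= y3 -> `|z4| <= y4 ->
    `|z1 - z2 - z3 + z4| <= y1 + y2 + y3 + y4.
  by clear; rewrite !ler_norml => /andP[? ?] /andP[? ?] /andP[? ?] /andP[? ?]; apply/andP; split; lra.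
apply: le_trans (tri _ _ _ _ _ _ _ _ h1 h2 h3 h4) _.
have b40 : 0 <= (beta ^+ 4)^-1 by rewrite invr_ge0 exprn_ge0 ?ltW.
have key (b4 y : R) : 0 <= b4 -> 0 <= y -> P1 * (K * b4 * G) + P2 * (K * b4 * G) + T1 * (cN * (M * K * y) * G) +
    T2 * (cN * (M * K * y) * G) <= K * (1 + cN) * ((P1 + P2) * b4 + M * y * (T1 + T2)) * G.
  move=> b4p yp.
  have z1 : 0 <= K * cN * ((P1 + P2) * b4) * G by rewrite !mulr_ge0// addr_ge0.
  have z2 : 0 <= K * (M * y * (T1 + T2)) * G by rewrite !mulr_ge0// addr_ge0.
  by rewrite -subr_ge0 (_ : _ - _ = K * cN * ((P1 + P2) * b4) * G + K * (M * y * (T1 + T2)) * G) ?addr_ge0//; ring.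
exact: key.
Qed.

End local_estimate.

(** * Cutoff functions adapted to a cube *)

Section cutoffs.
Context {R : realType} {N : nat}.
Implicit Types (f eta : 'rV[R]_N -> R) (x : 'rV[R]_N) (i j : 'I_N).

Local Notation e_ i := (delta_mx ord0 i : 'rV[R]_N).

Definition cube (x0 : 'rV[R]_N) (h : R) : set 'rV[R]_N :=
  [set x | forall i, `|x ord0 i - x0 ord0 i| <= h].

Lemma measurable_cube x0 h : measurable (cube x0 h).
Proof.
rewrite (_ : cube x0 h = \bigcap_(i : 'I_N)
   ((fun x : 'rV[R]_N => x ord0 i : measurableTypeR R) @^-1` `[x0 ord0 i - h, x0 ord0 i + h]%classic)).
  apply: fin_bigcap_measurable => // i _.
  by rewrite -[X in measurable X]setTI; exact: measurable_coor.
apply/seteqP; split=> x /= H i.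
  by move=> _ /=; rewrite in_itv/=; have := H i; rewrite ler_distl.
by have := H i I; rewrite /= in_itv/= ler_distl.
Qed.

Lemma open_cubeC x0 h : open (~` cube x0 h).
Proof.
rewrite (_ : ~` _ = \bigcup_(i in [set: 'I_N]) [set x : 'rV[R]_N | h < `|x ord0 i - x0 ord0 i|]).
  apply: bigcup_open => i _.
  apply: (@open_comp _ _ (fun x : 'rV[R]_N => `|x ord0 i - x0 ord0 i|) [set y | h < y]); last exact: open_gt.
  move=> x _; apply: (@continuous_comp _ _ _ (fun x : 'rV[R]_N => x ord0 i) (fun y : R => `|y - x0 ord0 i|)).
    exact: coord_continuous.
  by apply: cvg_norm; apply: cvgB; [exact: cvg_id|exact: cvg_cst].
apply/seteqP; split=> x /=.
  by move=> /existsNP[i /negP]; rewrite -ltNge => xi; exists i.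
by move=> [i _ xi] /(_ i); rewrite leNgt xi.
Qed.

Lemma partial_scale (c H : R) x0 f i : bCoo f ->
  partial i (fun x => c * f (H *: (x - x0))) = fun x => c * H * partial i f (H *: (x - x0)).
Proof.
move=> bf; apply/funext => x.
have d : is_derive x (e_ i) (fun x => f (H *: (x - x0))) (partial i f (H *: (x - x0)) * H).
  apply: derive_line.
  rewrite (_ : (fun s0 => _) = (fun u => f (H *: (x - x0) + u *: e_ i)) \o (fun t => H * t)); last first.
    by apply/funext => t; rewrite /= addrAC scalerDr scalerA.
  apply: is_derive1_comp.
    rewrite mulr0; have := @is_derive_line _ _ f (H *: (x - x0)) (e_ i) 0 (bCoo_derivable bf).
    by rewrite scale0r addr0.
  by apply: is_derive_eq; rewrite /GRing.scale/=; ring.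
have [df E] := d; rewrite /partial deriveZ// E.
by rewrite [_ * H]mulrC /GRing.scale /= mulrA.
Qed.

Lemma fin_bounded (I : finType) (F : I -> 'rV[R]_N -> R) :
  (forall k, exists M : R, forall x, `|F k x| <= M) -> exists M : R, forall k x, `|F k x| <= M.
Proof.
move=> H; exists (\sum_k projT1 (cid (H k))) => k x.
have h0 l : 0 <= projT1 (cid (H l)) by case: cid => M /= HM; exact: le_trans (HM 0).
rewrite (bigD1 k)//=; apply: (@le_trans _ _ (projT1 (cid (H k)))); first by case: cid => M /= HM; exact: HM.
by rewrite lerDl; apply: sumr_ge0 => l _; exact: h0.
Qed.

(** A fixed bump on [-1, 1]^N is rescaled, so each derivative brings one factor 1 / h with constants
    independent of x0 and h. The cutoff is not 1 on the inner cube; the lower bound c1 is paid for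
    by a division at the end of [frozen_estimate]. *)
Lemma cutoff_exists : exists M c1 : R, [/\ 0 <= M, 0 < c1 & forall x0 (h : R), 0 < h ->
  exists eta, [/\ test_function eta, cutoff_bounds M h^-1 eta,
    forall x, 0 <= eta x <= 1, forall x, ~ cube x0 h x -> eta x = 0 &
    forall x, cube x0 (h / 2) x -> c1 <= eta x]].
Proof.
pose eta1 : 'rV[R]_N -> R := bumpf 1 (const_mx (-1)) (const_mx 1).
have b1 : bCoo eta1 by exact: bCoo_bumpf.
have [M1 h1] := fin_bounded (fun i => bCoo_bounded (bCoo_partial i b1)).
have [M2 h2] := @fin_bounded ('I_N * 'I_N)%type (fun ij => partial ij.1 (partial ij.2 eta1))
  (fun ij => bCoo_bounded (bCoo_partial ij.1 (bCoo_partial ij.2 b1))).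
have [M3 h3] := bCoo_bounded (bCoo_lap b1).
have [M4 h4] := fin_bounded (fun i => bCoo_bounded (bCoo_partial i (bCoo_lap b1))).
have [M5 h5] := fin_bounded (fun i => bCoo_bounded (bCoo_lap (bCoo_partial i b1))).
have [M6 h6] := bCoo_bounded (bCoo_lap (bCoo_lap b1)).
pose M := `|M1| + `|M2| + `|M3| + `|M4| + `|M5| + `|M6|.
have MM : [/\ M1 <= M, M2 <= M, M3 <= M & [/\ M4 <= M, M5 <= M & M6 <= M]].
  have n1 := normr_ge0 M1; have n2 := normr_ge0 M2; have n3 := normr_ge0 M3.
  have n4 := normr_ge0 M4; have n5 := normr_ge0 M5; have n6 := normr_ge0 M6.
  have l1 := ler_norm M1; have l2 := ler_norm M2; have l3 := ler_norm M3.
  have l4 := ler_norm M4; have l5 := ler_norm M5; have l6 := ler_norm M6.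
  rewrite /M; clear -n1 n2 n3 n4 n5 n6 l1 l2 l3 l4 l5 l6.
  by split; last split; lra.
have [m1 m2 m3 [m4 m5 m6]] := MM.
have M0 : 0 <= M by rewrite /M !addr_ge0.
(* On the inner cube each factor of the bump is e^{-1/z} with z >= 1 / 2, hence at least e^{-2}. *)
exists M, (\prod_(i < N) expR (- 2)); split=> //.
  by apply: prodr_gt0 => i _; exact: expR_gt0.
move=> x0 h h0; pose H := h^-1; have H0 : 0 < H by rewrite invr_gt0.
pose eta : 'rV[R]_N -> R := bumpf (H ^+ 2) (\row_i (x0 ord0 i - h)) (\row_i (x0 ord0 i + h)).
have etaE : eta = fun x => 1 * eta1 (H *: (x - x0)).
  apply/funext => x; rewrite mul1r /eta /eta1 /bumpf; apply: eq_bigr => i _; congr (flat 0 _).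
  by rewrite !mxE /H; field; rewrite gt_eqF.
have te : test_function eta.
  by apply: test_function_bumpf => [|i]; rewrite ?exprn_gt0// !mxE; lra.
have bp i := bCoo_partial i b1; have bl := bCoo_lap b1.
have pe i : partial i eta = fun x => H * partial i eta1 (H *: (x - x0)).
  by rewrite etaE partial_scale// mul1r.
have ppe i j : partial i (partial j eta) = fun x => H * H * partial i (partial j eta1) (H *: (x - x0)).
  by rewrite pe partial_scale.
have le : lap eta = fun x => H * H * lap eta1 (H *: (x - x0)).
  by apply/funext => x; rewrite /lap mulr_sumr; apply: eq_bigr => i _; exact: (congr1 (fun g => g x) (ppe i i)).
have lapS (c : R) f : bCoo f -> lap (fun x => c * f (H *: (x - x0))) = fun x => c * H * H * lap f (H *: (x - x0)).
  move=> bf; apply/funext => x; rewrite /lap mulr_sumr; apply: eq_bigr => i _.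
  by rewrite partial_scale// partial_scale//; exact: bCoo_partial.
have bd (c c' m y : R) : 0 <= c -> c = c' -> `|y| <= m -> m <= M -> `|c * y| <= M * c'.
  move=> c0 <- ym mM; rewrite normrM (ger0_norm c0) mulrC ler_wpM2r//; exact: le_trans mM.
have H0' := ltW H0.
exists eta; split.
- exact: te.
- split; first exact: test_function_bCoo.
  + by move=> i x; rewrite pe; apply: bd (h1 i _) m1.
  + split; first by move=> i j x; rewrite ppe; apply: bd (h2 (i, j) _) m2; rewrite ?mulr_ge0.
    by move=> x; rewrite le; apply: bd (h3 _) m3; rewrite ?mulr_ge0.
  + split; first by move=> i x; rewrite le partial_scale//; apply: bd (h4 i _) m4; rewrite ?mulr_ge0// !exprS expr0 mulr1 mulrA.
    by move=> i x; rewrite pe lapS//; apply: bd (h5 i _) m5; rewrite ?mulr_ge0// !exprS expr0 mulr1 mulrA.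
  + by move=> x; rewrite le lapS//; apply: bd (h6 _) m6; rewrite ?mulr_ge0// !exprS expr0 mulr1 !mulrA.
- by move=> x; rewrite bumpf_ge0 bumpf_le1.
- move=> x /existsNP[i /negP]; rewrite ler_distl => nx.
  apply: (@bumpf_out _ _ _ _ _ _ i); rewrite ?exprn_gt0// !mxE; first lra.
  by apply: contra nx => /andP[/ltW -> /ltW ->].
- move=> x xh; rewrite /eta /bumpf; apply: ler_prod => i _; rewrite expR_ge0/= !mxE.
  have := xh i; rewrite ler_norml => /andP[l1 l2].
  set z := _ * _ * _; have zE : z = 1 - (H * (x ord0 i - x0 ord0 i)) ^+ 2.
    by rewrite /z /H; field; rewrite gt_eqF.
  have z1 : 2^-1 <= z.
    have d2 : (H * (x ord0 i - x0 ord0 i)) ^+ 2 <= 2^-1 ^+ 2.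
      rewrite -real_normK ?num_real// lerXn2r ?nnegrE// ler_norml.
      have Hh : H * h = 1 by rewrite /H mulVf// gt_eqF.
      have k1 := ler_wpM2l H0' l1; have k2 := ler_wpM2l H0' l2.
      rewrite mulrN mulrA Hh in k1; rewrite mulrA Hh in k2.
      by clear -k1 k2; apply/andP; split; lra.
    by rewrite zE; move: d2; rewrite expr2 => d2; lra.
  have z0 : 0 < z by apply: lt_le_trans z1.
  rewrite /flat z0 expr0 invr1 mul1r ler_expR lerN2 -[leRHS]invrK lef_pV2 ?posrE//.
Qed.

End cutoffs.

(** * Averaging over cubes of variable size *)

Section averaging.
Context {R : realType} {N : nat}.
Implicit Types (x y : 'rV[R]_N) (i : 'I_N).

Local Notation mu := (@lebesgue_rV R N).

Lemma lebesgue_cube x (h : R) : 0 <= h -> mu (cube x h) = ((2 * h) ^+ N)%:E.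
Proof.
move=> h0; pose a : 'rV[R]_N := \row_i (x ord0 i - h); pose b : 'rV[R]_N := \row_i (x ord0 i + h).
have ab i : a ord0 i <= b ord0 i by rewrite !mxE; lra.
have -> : cube x h = [set y | forall i, a ord0 i <= y ord0 i <= b ord0 i].
  by apply/seteqP; split=> y H i; have := H i; rewrite !mxE ler_distl.
rewrite lebesgue_rV_box//; congr EFin.
rewrite (eq_bigr (fun=> 2 * h)); last by move=> i _; rewrite !mxE; ring.
by rewrite big_const iter_mulr_1 card_ord.
Qed.

Variables (s : 'rV[R]_N -> R) (L sigma : R).
Hypothesis s0 : forall x, 0 < s x.
Hypothesis ms : measurable_fun setT s.
Hypothesis L0 : 0 <= L.
Hypothesis sL : forall x y, `|s x - s y| <= L * \sum_i `|x ord0 i - y ord0 i|.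
Hypothesis sigma0 : 0 < sigma.
Hypothesis Lsigma : L * N%:R * sigma <= 2^-1.

Let E : set ('rV[R]_N * 'rV[R]_N) := [set z | cube z.1 (sigma * s z.1) z.2].

Let mE : measurable E.
Proof.
rewrite (_ : E = \bigcap_(i : 'I_N)
   ((fun z : 'rV[R]_N * 'rV[R]_N => sigma * s z.1 - `|z.2 ord0 i - z.1 ord0 i| : measurableTypeR R)
     @^-1` `[0, +oo[%classic)).
  apply: fin_bigcap_measurable => // i _; rewrite -[X in measurable X]setTI.
  have m : measurable_fun setT (fun z : 'rV[R]_N * 'rV[R]_N => sigma * s z.1 - `|z.2 ord0 i - z.1 ord0 i|).
    apply: measurable_funB.
      by apply: measurable_funM => //; apply: measurableT_comp => //; exact: measurable_fst.
    apply: measurableT_comp => //; apply: measurable_funB.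
      by apply: (measurableT_comp (measurable_coor i)); exact: measurable_snd.
    by apply: (measurableT_comp (measurable_coor i)); exact: measurable_fst.
  exact: m.
apply/seteqP; split=> z /= H i.
  by move=> _ /=; rewrite in_itv/= andbT subr_ge0; exact: H.
by have := H i I; rewrite /= in_itv/= andbT subr_ge0.
Qed.

Let k (z : 'rV[R]_N * 'rV[R]_N) : R := (s z.1 ^+ N)^-1 * \1_E z.

Let k0 z : 0 <= k z.
Proof. by rewrite mulr_ge0// invr_ge0 exprn_ge0// ltW. Qed.

Let mk : measurable_fun setT k.
Proof.
apply: measurable_funM; last exact: measurable_indic.
apply: (measurableT_comp (f := fun x => (s x ^+ N)^-1)); last exact: measurable_fst.
rewrite (_ : (fun x => _) = (fun x => s x `^ (- N%:R))); last first.
  by apply/funext => x; rewrite powRN powR_mulrn// ltW.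
by apply: (measurableT_comp (measurable_powR _)).
Qed.

Let mks x : measurable_fun setT (fun y => (k (y, x))%:E).
Proof.
apply/measurable_EFinP; apply: (measurableT_comp mk).
exact: measurable_pair2.
Qed.

Let near_s x y (h : R) : 0 <= h -> (forall i, `|x ord0 i - y ord0 i| <= h) ->
  `|s x - s y| <= L * N%:R * h.
Proof.
move=> h0 H; apply: le_trans (sL x y) _; rewrite -mulrA ler_wpM2l//.
rewrite -[N in N%:R]card_ord mulr_natl -sumr_const; exact: ler_sum.
Qed.

(** The total weight with which the point x is counted by all cubes together. The normalisation
    s(y)^{-N} offsets the volume of the cube, so W lies between two positive constants. *)
Let W x : \bar R := (\int[mu]_y (k (y, x))%:E)%E.

(** If x is in the cube of y, then |s x - s y| <= s y / 2, so s x / 2 <= s y <= 2 s x. Such y lie in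
    a cube of half-side 2 sigma s x and carry a weight at most (2 / s x)^N. *)
Let W_ub x : (W x <= ((8 * sigma) ^+ N)%:E)%E.
Proof.
have sx := s0 x.
apply: (@le_trans _ _ (\int[mu]_y (((2 / s x) ^+ N)%:E * (\1_(cube x (2 * sigma * s x)) y)%:E))%E).
  apply: ge0_le_integral => //.
  - by move=> y _; rewrite lee_fin.
  - by apply: measurable_funeM; apply/measurable_EFinP/measurable_indic; exact: measurable_cube.
  move=> y _; rewrite -EFinM lee_fin /k !indicE.
  have [yx|yx] := pselect (E (y, x)); last first.
    by rewrite [_ \in E]memNset// mulr0 mulr_ge0// exprn_ge0// divr_ge0// ltW.
  rewrite [_ \in E]mem_set// mulr1; have sy := s0 y.
  have ss := near_s (mulr_ge0 (ltW sigma0) (ltW sy)) yx.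
  have ssy : `|s x - s y| <= 2^-1 * s y.
    by apply: (le_trans ss); rewrite mulrA ler_wpM2r// ltW.
  move: ssy; rewrite ler_norml => /andP[s1 s2].
  have sy2 : s y <= 2 * s x by lra.
  rewrite mem_set ?mulr1.
    rewrite -exprVn lerXn2r ?nnegrE ?invr_ge0 ?divr_ge0 ?(ltW sx) ?(ltW sy)//.
    have : s x / 2 <= s y by lra.
    by move=> h; rewrite -[leRHS]invrK invf_div lef_pV2 ?posrE ?divr_gt0.
  move=> i; rewrite distrC; apply: (le_trans (yx i)) => /=.
  have := ler_wpM2l (ltW sigma0) sy2.
  have : 0 <= sigma * s x by rewrite mulr_ge0// ltW.
  by lra.
rewrite ge0_integralZl//; last 2 first.
- by apply/measurable_EFinP/measurable_indic; exact: measurable_cube.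
- by rewrite lee_fin exprn_ge0// divr_ge0// ltW.
rewrite integral_indic ?setIT//; last exact: measurable_cube.
rewrite [X in (_ * X)%E]lebesgue_cube; last by rewrite !mulr_ge0// ltW.
rewrite -EFinM -exprMn lee_fin (_ : 2 / s x * _ = 8 * sigma)//.
by field; rewrite gt_eqF.
Qed.

(** Conversely, for y in the cube of half-side sigma s x / 2 around x, s y differs from s x by at
    most a quarter of s x; hence s y >= s x / 2, the cube of y contains x, and the weight is at
    least (2 s x)^{-N}. *)
Let W_lb x : (((sigma / 2) ^+ N)%:E <= W x)%E.
Proof.
have sx := s0 x.
apply: (@le_trans _ _ (\int[mu]_y (((2 * s x)^-1 ^+ N)%:E * (\1_(cube x (sigma / 2 * s x)) y)%:E))%E).
  rewrite ge0_integralZl//; last 2 first.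
  - by apply/measurable_EFinP/measurable_indic; exact: measurable_cube.
  - by rewrite lee_fin exprn_ge0// invr_ge0 mulr_ge0// ltW.
  rewrite integral_indic ?setIT//; last exact: measurable_cube.
  rewrite [X in (_ * X)%E]lebesgue_cube; last by rewrite !mulr_ge0 ?invr_ge0// ltW.
  rewrite -EFinM -exprMn lee_fin (_ : (2 * s x)^-1 * _ = sigma / 2)//.
  by field; rewrite gt_eqF.
apply: ge0_le_integral => //.
- by move=> y _; rewrite -EFinM lee_fin mulr_ge0// exprn_ge0// invr_ge0 mulr_ge0// ltW.
- by apply: measurable_funeM; apply/measurable_EFinP/measurable_indic; exact: measurable_cube.
move=> y _; rewrite -EFinM lee_fin /k !indicE.
have [yx|yx] := pselect (cube x (sigma / 2 * s x) y); last first.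
  by rewrite [_ \in cube _ _]memNset// mulr0 k0.
rewrite [_ \in cube _ _]mem_set// mulr1; have sy := s0 y.
have ss := near_s (mulr_ge0 (mulr_ge0 (ltW sigma0) (ltW (_ : 0 < 2^-1))) (ltW sx)) yx.
have ssx : `|s y - s x| <= 4^-1 * s x.
  apply: (le_trans (ss _)); first by rewrite invr_gt0.
  rewrite mulrA ler_wpM2r ?(ltW sx)// mulrA; move: Lsigma; lra.
move: ssx; rewrite ler_norml => /andP[s1 s2].
rewrite mem_set ?mulr1; last first.
  move=> i /=; rewrite distrC; apply: (le_trans (yx i)).
  rewrite -mulrA ler_wpM2l ?(ltW sigma0)//; lra.
rewrite -exprVn lerXn2r ?nnegrE ?invr_ge0 ?mulr_ge0 ?(ltW sx) ?(ltW sy)//.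
by rewrite lef_pV2 ?posrE ?mulr_gt0//; lra.
Qed.

Section averages.
Variable G : 'rV[R]_N -> \bar R.
Hypothesis mG : measurable_fun setT G.
Hypothesis G0 : forall x, (0 <= G x)%E.

Definition cube_average : \bar R :=
  (\int[mu]_y (((s y ^+ N)^-1)%:E * \int[mu]_x ((\1_(cube y (sigma * s y)) x)%:E * G x)))%E.

Let F (z : 'rV[R]_N * 'rV[R]_N) : \bar R := ((k z)%:E * G z.2)%E.
Let mF : measurable_fun setT F.
Proof.
apply: emeasurable_funM; first exact/measurable_EFinP.
by apply: measurableT_comp => //; exact: measurable_snd.
Qed.
Let F0 z : (0 <= F z)%E.
Proof. by rewrite mule_ge0// lee_fin. Qed.

Let cubeE y x : (F (y, x) = ((s y ^+ N)^-1)%:E * ((\1_(cube y (sigma * s y)) x)%:E * G x))%E.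
Proof. by rewrite /F /k EFinM muleA /=. Qed.

Let FE y : (\int[mu]_x F (y, x) =
  ((s y ^+ N)^-1)%:E * \int[mu]_x ((\1_(cube y (sigma * s y)) x)%:E * G x))%E.
Proof.
under eq_integral do rewrite cubeE.
rewrite ge0_integralZl//.
- apply: emeasurable_funM => //; apply/measurable_EFinP/measurable_indic; exact: measurable_cube.
- by move=> x _; rewrite mule_ge0// lee_fin.
- by rewrite lee_fin invr_ge0 exprn_ge0// ltW.
Qed.

Lemma measurable_cube_average : measurable_fun setT (fun y =>
  (((s y ^+ N)^-1)%:E * \int[mu]_x ((\1_(cube y (sigma * s y)) x)%:E * G x))%E).
Proof.
under eq_fun do rewrite -FE.
exact: (measurable_fun_fubini_tonelli_F (m2 := mu) _ mF F0).
Qed.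

Let averageE : (cube_average = \int[mu]_x (W x * G x))%E.
Proof.
rewrite /cube_average; under eq_integral do rewrite -FE.
rewrite (fubini_tonelli (m1 := mu) (m2 := mu) _ mF F0).
apply: eq_integral => x _; rewrite /F /= ge0_integralZr//.
by move=> y _; rewrite lee_fin.
Qed.

Let mW : measurable_fun setT W.
Proof.
apply: (measurable_fun_fubini_tonelli_G (m1 := mu) (EFin \o k)); first exact/measurable_EFinP.
by move=> z; rewrite /= lee_fin.
Qed.

Lemma cube_average_le : (cube_average <= ((8 * sigma) ^+ N)%:E * \int[mu]_x G x)%E.
Proof.
rewrite averageE -ge0_integralZl//; last by rewrite lee_fin exprn_ge0// mulr_ge0// ltW.
apply: ge0_le_integral => //.
- by move=> x _; rewrite mule_ge0// integral_ge0// => y _; rewrite lee_fin.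
- exact: emeasurable_funM.
- by apply: emeasurable_funM.
- by move=> x _; rewrite lee_wpmul2r.
Qed.

Lemma cube_average_ge : (((sigma / 2) ^+ N)%:E * \int[mu]_x G x <= cube_average)%E.
Proof.
have c0 : (0 <= ((sigma / 2) ^+ N)%:E)%E by rewrite lee_fin exprn_ge0// divr_ge0// ltW.
rewrite averageE -ge0_integralZl//.
apply: ge0_le_integral => //.
- by move=> x _; rewrite mule_ge0.
- by apply: emeasurable_funM.
- exact: emeasurable_funM.
- by move=> x _; rewrite lee_wpmul2r.
Qed.

End averages.
End averaging.

(** * Weak derivatives *)

Section weak_bilaplacian.
Context {R : realType} {N : nat}.
Implicit Types (u v : 'rV[R]_N -> R[i]) (s : seq 'I_N).

Local Notation mu := (@lebesgue_rV R N).
Local Notation Re := complex.Re.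
Local Notation Im := complex.Im.
Local Open Scope complex_scope.

Lemma Re_sum (I : Type) (r : seq I) (F : I -> R[i]) : Re (\sum_(j <- r) F j) = \sum_(j <- r) Re (F j).
Proof. by apply: (big_morph (@complex.Re R)) => // -[? ?] [? ?]. Qed.

Lemma Im_sum (I : Type) (r : seq I) (F : I -> R[i]) : Im (\sum_(j <- r) F j) = \sum_(j <- r) Im (F j).
Proof. by apply: (big_morph (@complex.Im R)) => // -[? ?] [? ?]. Qed.

Lemma Re_le_normc (z : R[i]) : `|Re z| <= Normc.normc z.
Proof.
case: z => x y /=; rewrite -[leLHS]sqrtr_sqr ler_sqrt ?addr_ge0 ?sqr_ge0//.
by rewrite lerDl sqr_ge0.
Qed.

Lemma Im_le_normc (z : R[i]) : `|Im z| <= Normc.normc z.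
Proof.
case: z => x y /=; rewrite -[leLHS]sqrtr_sqr ler_sqrt ?addr_ge0 ?sqr_ge0//.
by rewrite lerDr sqr_ge0.
Qed.

Lemma normc_le_ReIm (z : R[i]) : Normc.normc z <= `|Re z| + `|Im z|.
Proof.
case: z => x y /=; rewrite -[leRHS]ger0_norm ?addr_ge0// -sqrtr_sqr ler_wsqrtr//.
rewrite sqrrD -!normrX !(ger0_norm (sqr_ge0 _)) lerD// lerDl.
by rewrite mulrn_wge0// mulr_ge0.
Qed.

Lemma normcD_le (z w : R[i]) : Normc.normc (z + w) <= Normc.normc z + Normc.normc w.
Proof. exact: le_normcD. Qed.

Lemma modulus_ge0 u x : 0 <= modulus u x.
Proof. by rewrite /modulus; case: (u x) => ? ? /=; exact: sqrtr_ge0. Qed.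

Lemma measurable_compact (K : set 'rV[R]_N) : compact K -> measurable K.
Proof.
move=> cK; have cl : closed K by apply: (compact_closed _ cK); exact: norm_hausdorff.
by rewrite -[K]setCK; apply: measurableC; apply: measurable_open_rV; exact: closed_openC.
Qed.

Lemma measurable_modulus u : cmeasurable u -> measurable_fun setT (modulus u).
Proof.
move=> [mr mi].
rewrite (_ : modulus u = fun x => Num.sqrt (Re (u x) ^+ 2 + Im (u x) ^+ 2)); last first.
  by apply/funext => x; rewrite /modulus; case: (u x).
apply: (measurableT_comp (f := @Num.sqrt R)).
  apply: measurable_realfun.continuous_measurable_fun => t; exact: sqrt_continuous.
by apply: measurable_funD; exact: measurable_funX.
Qed.

Lemma Lp_loc1D u v : Lp_loc 1 u -> Lp_loc 1 v -> Lp_loc 1 (fun x => u x + v x).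
Proof.
move=> [[mur mui] Ku] [[mvr mvi] Kv]; split.
  split.
    rewrite (_ : (fun x => _) = fun x => Re (u x) + Re (v x)); first exact: measurable_funD.
    by apply/funext => x; case: (u x) (v x) => ? ? [].
  rewrite (_ : (fun x => _) = fun x => Im (u x) + Im (v x)); first exact: measurable_funD.
  by apply/funext => x; case: (u x) (v x) => ? ? [].
move=> K cK; have mK : measurable K := measurable_compact cK.
have m1 := measurable_modulus (conj mur mui : cmeasurable u).
have m2 := measurable_modulus (conj mvr mvi : cmeasurable v).
have m3 : cmeasurable (fun x => u x + v x).
  split.
    rewrite (_ : (fun x => _) = fun x => Re (u x) + Re (v x)); first exact: measurable_funD.
    by apply/funext => x; case: (u x) (v x) => ? ? [].
  rewrite (_ : (fun x => _) = fun x => Im (u x) + Im (v x)); first exact: measurable_funD.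
  by apply/funext => x; case: (u x) (v x) => ? ? [].
have m0 w : cmeasurable w -> measurable_fun K (fun x => (modulus w x `^ 1)%:E).
  move=> mw; apply/measurable_EFinP; apply: measurable_funTS.
  by apply: (measurableT_comp (measurable_powR _)); exact: measurable_modulus.
apply: (@le_lt_trans _ _ (\int[mu]_(x in K) ((modulus u x `^ 1)%:E + (modulus v x `^ 1)%:E))%E).
  apply: ge0_le_integral => //.
  - by move=> x _; rewrite lee_fin powR_ge0.
  - exact: m0.
  - by apply: emeasurable_funD; apply: m0.
  move=> x _; rewrite -EFinD lee_fin !powRr1 ?modulus_ge0//; exact: normcD_le.
rewrite ge0_integralD//; [|by move=> x _; rewrite lee_fin powR_ge0|exact: m0|by move=> x _; rewrite lee_fin powR_ge0|exact: m0].
by rewrite lte_add_pinfty//; [exact: Ku|exact: Kv].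
Qed.

Lemma Lp_loc1_sum (I : Type) (r : seq I) (F : I -> 'rV[R]_N -> R[i]) :
  (forall k, Lp_loc 1 (F k)) -> Lp_loc 1 (fun x => \sum_(k <- r) F k x).
Proof.
move=> H; elim: r => [|k r IH].
  under eq_fun do rewrite big_nil; split; first by split; exact: measurable_cst.
  move=> K _; rewrite (@eq_integral _ _ _ _ _ (cst 0%E)) ?integral0 ?ltry// => x _.
  by rewrite /modulus /= expr0n/= addr0 sqrtr0 powR0// oner_neq0.
have -> : (fun x => \sum_(j <- k :: r) F j x) = fun x => F k x + \sum_(j <- r) F j x.
  by apply/funext => x; rewrite big_cons.
exact: (Lp_loc1D (H k) IH).
Qed.

Lemma Lp_loc1_integrable u phi : Lp_loc 1 u -> test_function phi ->
  mu.-integrable setT (EFin \o (fun x => Re (u x) * phi x)) /\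
  mu.-integrable setT (EFin \o (fun x => Im (u x) * phi x)).
Proof.
move=> [cu Ku] tp; have bp := test_function_bCoo tp; have [M pM] := bCoo_bounded bp.
have mp := bCoo_measurable bp; have [mr mi] := cu; have mm := measurable_modulus cu.
have M0 : 0 <= M by exact: le_trans (pM 0).
pose K := closure [set x | phi x != 0]; have cK : compact K by have [] := tp.
have mK : measurable K := measurable_compact cK.
have key (h : 'rV[R]_N -> R) : measurable_fun setT h -> (forall x, `|h x| <= modulus u x) ->
    mu.-integrable setT (EFin \o (fun x => h x * phi x)).
  move=> mh hu; apply/integrableP; split; first by apply/measurable_EFinP; exact: measurable_funM.
  apply: (@le_lt_trans _ _ (\int[mu]_(x in K) (M%:E * (modulus u x `^ 1)%:E))%E).
    rewrite [leRHS]integral_mkcond; apply: ge0_le_integral => //.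
    - by apply: measurableT_comp => //; apply/measurable_EFinP; exact: measurable_funM.
    - apply/(measurable_restrictT _ mK); apply: measurable_funeM; apply/measurable_EFinP; apply: measurable_funTS.
      exact: (measurableT_comp (measurable_powR _)).
    move=> x _; rewrite patchE /=; case: ifPn => xK.
      rewrite -EFinM lee_fin normrM mulrC powRr1 ?modulus_ge0//; exact: ler_pM.
    have -> : phi x = 0.
      by apply/eqP; apply: contraNT xK => px; rewrite inE; exact: subset_closure.
    by rewrite mulr0 normr0.
  rewrite ge0_integralZl//; last 2 first.
  - by apply/measurable_EFinP; apply: measurable_funTS; exact: (measurableT_comp (measurable_powR _)).
  - by move=> x _; rewrite lee_fin powR_ge0.
  by rewrite lte_mul_pinfty// ?lee_fin//; exact: Ku.
by split; apply: key => // x; [exact: Re_le_normc|exact: Im_le_normc].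
Qed.

Lemma ReIm_mulC (z : R[i]) (r : R) : Re (z * r%:C) = Re z * r /\ Im (z * r%:C) = Im z * r.
Proof. by case: z => x y; rewrite /= !mulr0 subr0 add0r. Qed.

Lemma cintegral_mulC u (phi : 'rV[R]_N -> R) : cintegral (fun x => u x * (phi x)%:C) =
  (\int[mu]_x (Re (u x) * phi x)) +i* (\int[mu]_x (Im (u x) * phi x)).
Proof.
rewrite /cintegral; congr (_ +i* _); apply: eq_Rintegral => x _.
  by have [-> _] := ReIm_mulC (u x) (phi x).
by have [_ ->] := ReIm_mulC (u x) (phi x).
Qed.

(** In even order the sign in the definition disappears, and the complex identity splits into its
    components. *)
Lemma is_weak_derivativeE s u v phi : is_weak_derivative s u v -> ~~ odd (size s) -> test_function phi ->
  \int[mu]_x (Re (u x) * partials s phi x) = \int[mu]_x (Re (v x) * phi x) /\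
  \int[mu]_x (Im (u x) * partials s phi x) = \int[mu]_x (Im (v x) * phi x).
Proof.
move=> [_ _ H] os /H; rewrite -signr_odd (negPf os) expr0 mul1r !cintegral_mulC.
by case.
Qed.

Lemma weak_derivativeP s u : (exists v, is_weak_derivative s u v) ->
  is_weak_derivative s u (weak_derivative s u).
Proof. by move=> H; exact: (xgetPex (fun=> 0) H). Qed.

(** [bilaplacian] differentiates a sum of chosen representatives, and the junk value 0 threatens
    unless that sum has weak second derivatives. They exist because the fourth-order weak
    derivatives of u, summed over j, satisfy the defining identity; the chosen representatives then
    satisfy it as well. *)
Lemma sobolev_weak_bilap (p : R) u : sobolev_loc 4 p u ->
  weak_bilap (fun x => Re (u x)) (fun x => Re (bilaplacian u x)) /\
  weak_bilap (fun x => Im (u x)) (fun x => Im (bilaplacian u x)).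
Proof.
move=> su.
have H s : (size s <= 4)%N -> is_weak_derivative s u (weak_derivative s u).
  by move=> /su[v hv _]; apply: weak_derivativeP; exists v.
(* The clause of order zero, [[::]], yields local integrability of u itself. *)
have lu : Lp_loc 1 u by have [] := H [::] isT.
pose L := laplacian u.
have lw s : (size s <= 4)%N -> Lp_loc 1 (weak_derivative s u) by move=> /H[].
have lL : Lp_loc 1 L by apply: Lp_loc1_sum => j; exact: lw.
have I2 w psi : Lp_loc 1 w -> test_function psi -> _ := @Lp_loc1_integrable w psi.
have HL i phi : test_function phi ->
   \int[mu]_x (Re (L x) * partials [:: i; i] phi x) = \sum_j \int[mu]_x (Re (u x) * partials [:: j; j; i; i] phi x) /\
   \int[mu]_x (Im (L x) * partials [:: i; i] phi x) = \sum_j \int[mu]_x (Im (u x) * partials [:: j; j; i; i] phi x).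
  move=> tp; have ti : test_function (partials [:: i; i] phi) by exact: test_function_partials.
  have e j := is_weak_derivativeE (H [:: j; j] isT) isT ti.
  have i2 j := I2 _ _ (lw [:: j; j] isT) ti.
  split.
    rewrite (eq_bigr _ (fun j _ => (e j).1)) -(Rintegral_sum _ (fun j => (i2 j).1)).2.
    by apply: eq_Rintegral => x _; rewrite /L /laplacian Re_sum mulr_suml.
  rewrite (eq_bigr _ (fun j _ => (e j).2)) -(Rintegral_sum _ (fun j => (i2 j).2)).2.
  by apply: eq_Rintegral => x _; rewrite /L /laplacian Im_sum mulr_suml.
have WL i : is_weak_derivative [:: i; i] L (weak_derivative [:: i; i] L).
  apply: weak_derivativeP; exists (fun x => \sum_j weak_derivative [:: j; j; i; i] u x).
  split; [exact: lL|by apply: Lp_loc1_sum => j; exact: lw|].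
  move=> phi tp; rewrite expr2 mulrNN mulr1 mul1r !cintegral_mulC.
  have e j := is_weak_derivativeE (H [:: j; j; i; i] isT) isT tp.
  have i2 j := I2 _ _ (lw [:: j; j; i; i] isT) tp.
  congr (_ +i* _).
    apply: (etrans (HL i phi tp).1); rewrite (eq_bigr _ (fun j _ => (e j).1)) -(Rintegral_sum _ (fun j => (i2 j).1)).2.
    by apply: eq_Rintegral => x _; rewrite Re_sum mulr_suml.
  apply: (etrans (HL i phi tp).2); rewrite (eq_bigr _ (fun j _ => (e j).2)) -(Rintegral_sum _ (fun j => (i2 j).2)).2.
  by apply: eq_Rintegral => x _; rewrite Im_sum mulr_suml.
have lWL i : Lp_loc 1 (weak_derivative [:: i; i] L) by have [] := WL i.
have lb : Lp_loc 1 (bilaplacian u) by apply: Lp_loc1_sum.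
have [[mur mui] _] := lu; have [[mbr mbi] _] := lb.
have ll (phi : 'rV[R]_N -> R) : test_function phi -> lap (lap phi) = fun x => \sum_i \sum_j partials [:: j; j; i; i] phi x.
  move=> tp; have bp := test_function_bCoo tp.
  rewrite {2}/lap (lap_sum (index_enum 'I_N) (fun i => bCoo_partial i (bCoo_partial i bp))).
  by apply/funext => x; apply: eq_bigr.
(* The projection f is instantiated by the real part and by the imaginary part. *)
have main (f : R[i] -> R) (g := fun x => f (u x)) (h := fun x => f (bilaplacian u x)) :
    (forall phi, test_function phi -> mu.-integrable setT (EFin \o (fun x => g x * phi x))) ->
    (forall (r : seq 'I_N) (F : 'I_N -> R[i]), f (\sum_(j <- r) F j) = \sum_(j <- r) f (F j)) ->
    (forall i phi, test_function phi -> mu.-integrable setT (EFin \o (fun x => f (weak_derivative [:: i; i] L x) * phi x))) ->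
    (forall i phi, test_function phi -> \int[mu]_x (f (L x) * partials [:: i; i] phi x) =
      \int[mu]_x (f (weak_derivative [:: i; i] L x) * phi x)) ->
    (forall i phi, test_function phi -> \int[mu]_x (f (L x) * partials [:: i; i] phi x) =
      \sum_j \int[mu]_x (g x * partials [:: j; j; i; i] phi x)) ->
    forall phi, test_function phi -> \int[mu]_x (g x * lap (lap phi) x) = \int[mu]_x (h x * phi x).
  move=> ig fs iw e1 e2 phi tp; rewrite (ll _ tp).
  have t4 i j : test_function (partials [:: j; j; i; i] phi) by exact: test_function_partials.
  transitivity (\sum_i \sum_j \int[mu]_x (g x * partials [:: j; j; i; i] phi x)).
    have ij i := Rintegral_sum (index_enum 'I_N) (fun j => ig _ (t4 i j)).
    rewrite (eq_bigr _ (fun i _ => esym (ij i).2)) -(Rintegral_sum _ (fun i => (ij i).1)).2.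
    by apply: eq_Rintegral => x _; rewrite mulr_sumr; apply: eq_bigr => i _; rewrite mulr_sumr.
  rewrite (eq_bigr _ (fun i _ => esym (e2 i _ tp))) (eq_bigr _ (fun i _ => e1 i _ tp)).
  rewrite -(Rintegral_sum _ (fun i => iw i _ tp)).2.
  by apply: eq_Rintegral => x _; rewrite /h /bilaplacian -/L {1}/laplacian fs mulr_suml.
split.
- split=> //; try by move=> phi tp; have [] := I2 _ _ lu tp.
    by move=> phi tp; have [] := I2 _ _ lb tp.
  have M := main (@complex.Re R).
  simple refine (M (fun phi tp => (I2 u phi lu tp).1) (fun r F => Re_sum r F)
    (fun i phi tp => (I2 _ phi (lWL i) tp).1) (fun i phi tp => (is_weak_derivativeE (WL i) isT tp).1)
    (fun i phi tp => (HL i phi tp).1)).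
- split=> //; try by move=> phi tp; have [] := I2 _ _ lu tp.
    by move=> phi tp; have [] := I2 _ _ lb tp.
  have M := main (@complex.Im R).
  simple refine (M (fun phi tp => (I2 u phi lu tp).2) (fun r F => Im_sum r F)
    (fun i phi tp => (I2 _ phi (lWL i) tp).2) (fun i phi tp => (is_weak_derivativeE (WL i) isT tp).2)
    (fun i phi tp => (HL i phi tp).2)).
Qed.

End weak_bilaplacian.

(** * Freezing the coefficient *)

Section freezing.
Context {R : realType} {N : nat}.
Implicit Types (f g u : 'rV[R]_N -> R) (x y : 'rV[R]_N) (i : 'I_N).

Local Notation e_ i := (delta_mx ord0 i : 'rV[R]_N).
Local Notation mu := (@lebesgue_rV R N).
Local Notation "'N_ p [ f ]" := ('N[mu]_p%:E[EFin \o f])%E.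

Section coefficient.
Variables (c : R) (a : 'rV[R]_N -> R).
Hypothesis a1 : Ck 1 a.
Hypothesis a0 : forall x, 0 < a x.
Hypothesis Da : forall x, grad_norm a x <= c * a x `^ (1 / 2).

(** The gradient of a^{1/2} is Da / (2 a^{1/2}), bounded by c / 2 under the assumption on a; so
    a^{1/2} is a length over which a changes little in relative terms. *)
Lemma sqrt_coef_lipschitz x y :
  `|Num.sqrt (a x) - Num.sqrt (a y)| <= c / 2 * \sum_i `|x ord0 i - y ord0 i|.
Proof.
have da i z : derivable a z (e_ i) by have [_ /(_ i)[d _]] := a1; exact: d.
have ds i z : is_derive z (e_ i) (fun z => Num.sqrt (a z)) ((2 * Num.sqrt (a z))^-1 * partial i a z).
  apply: derive_line; apply: (@is_derive1_comp _ (@Num.sqrt R) (fun t => a (z + t *: e_ i))).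
    by rewrite scale0r addr0; exact: is_derive1_sqrt.
  have := @is_derive_line _ _ a z (e_ i) 0 (da i _).
  by rewrite scale0r addr0.
apply: (@mvt_path _ _ (fun z => Num.sqrt (a z))) => [i z|i z _]; first by have [] := ds i z.
rewrite /partial; have [_ ->] := ds i z; have s0 : 0 < Num.sqrt (a z) by rewrite sqrtr_gt0.
have pg : `|partial i a z| <= c * Num.sqrt (a z).
  apply: (@le_trans _ _ (grad_norm a z)).
    rewrite -sqrtr_sqr /grad_norm ler_wsqrtr// (bigD1 i)//= lerDl.
    by apply: sumr_ge0 => j _; exact: sqr_ge0.
  by have := Da z; rewrite mul1r powR12_sqrt// ltW.
rewrite normrM ger0_norm; last by rewrite invr_ge0 mulr_ge0// ltW.
rewrite mulrC ler_pdivrMr ?mulr_gt0//; apply: (le_trans pg).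
by rewrite le_eqVlt; apply/orP; left; apply/eqP; field.
Qed.

Lemma measurable_coef : measurable_fun setT a.
Proof. by apply: continuous_measurable_rV; have [] := a1. Qed.

End coefficient.

(** Here s = a(x)^{1/2}, so s^4 = a(x)^2. With z = s0 / s one has z <= 2 and |1 - z| <= 2 tau; then
    16 = 2^4, and 30 = 2 * 15, where 15 = 1 + 2 + 4 + 8 bounds (1 - z^4) / (1 - z). *)
Lemma freeze_bounds (s s0 tau : R) : 0 < s -> 0 < s0 -> 0 <= tau <= 2^-1 -> `|s - s0| <= tau * s0 ->
  (s ^+ 4)^-1 <= 16 / s0 ^+ 4 /\ `|(s0 ^+ 4)^-1 - (s ^+ 4)^-1| <= 30 * tau / s0 ^+ 4.
Proof.
move=> s_gt s0_gt /andP[t0 t1] st; pose z := s0 / s.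
have sn : s != 0 by rewrite gt_eqF. have s0n : s0 != 0 by rewrite gt_eqF.
have z0 : 0 < z by rewrite divr_gt0.
have hs : s0 <= 2 * s.
  have h1 : tau * s0 <= 2^-1 * s0 by rewrite ler_wpM2r// ltW.
  by move: (le_trans st h1); rewrite ler_norml => /andP[? _]; lra.
have z2 : z <= 2 by rewrite ler_pdivrMr.
have z1 : `|1 - z| <= 2 * tau.
  rewrite (_ : 1 - z = (s - s0) / s); last by rewrite /z; field.
  rewrite normrM normfV (gtr0_norm s_gt) ler_pdivrMr//; apply: (le_trans st).
  by rewrite [2 * tau]mulrC -mulrA ler_wpM2l.
have E1 : (s ^+ 4)^-1 = z ^+ 4 / s0 ^+ 4 by rewrite /z; field; rewrite s0n.
have i0 : 0 <= (s0 ^+ 4)^-1 by rewrite invr_ge0 exprn_ge0// ltW.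
have z4 : z ^+ 4 <= 16.
  have -> : 16 = 2 ^+ 4 :> R by rewrite -natrX.
  by rewrite lerXn2r// nnegrE ltW.
split; first by rewrite E1 ler_wpM2r.
have -> : (s0 ^+ 4)^-1 - (s ^+ 4)^-1 = (1 - z) * (1 + z + z ^+ 2 + z ^+ 3) / s0 ^+ 4 by rewrite E1; ring.
rewrite normrM (ger0_norm i0) ler_wpM2r// normrM.
have zz : 0 <= 1 + z + z ^+ 2 + z ^+ 3 by rewrite !addr_ge0 ?exprn_ge0// ltW.
rewrite (ger0_norm zz).
have z15 : 1 + z + z ^+ 2 + z ^+ 3 <= 15.
  have h2 : z ^+ 2 <= 4 by have -> : 4 = 2 ^+ 2 :> R by [rewrite -natrX]; rewrite lerXn2r// nnegrE ltW.
  have h3 : z ^+ 3 <= 8 by have -> : 8 = 2 ^+ 3 :> R by [rewrite -natrX]; rewrite lerXn2r// nnegrE ltW.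
  by lra.
apply: (@le_trans _ _ (2 * tau * 15)); first exact: ler_pM.
by lra.
Qed.

Lemma powR_add_le (p t1 t2 : R) : 0 < p -> 0 <= t1 -> 0 <= t2 ->
  (t1 + t2) `^ p <= 2 `^ p * (t1 `^ p + t2 `^ p).
Proof.
move=> p0 h1 h2; wlog t12 : t1 t2 h1 h2 / t1 <= t2.
  move=> H; have [/H|/ltW/H] := leP t1 t2; first exact.
  by rewrite addrC [t2 `^ _ + _]addrC; exact.
apply: (@le_trans _ _ ((2 * t2) `^ p)).
  by apply: ge0_ler_powR; rewrite ?nnegrE ?(ltW p0) ?addr_ge0 ?mulr_ge0//; lra.
by rewrite powRM// ler_wpM2l ?powR_ge0// lerDr powR_ge0.
Qed.

Lemma powR_add4_le (p t1 t2 t3 t4 : R) : 0 < p -> 0 <= t1 -> 0 <= t2 -> 0 <= t3 -> 0 <= t4 ->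
  (t1 + t2 + (t3 + t4)) `^ p <= 2 `^ p * 2 `^ p * ((t1 `^ p + t2 `^ p) + (t3 `^ p + t4 `^ p)).
Proof.
move=> p0 h1 h2 h3 h4; apply: le_trans (powR_add_le p0 (addr_ge0 h1 h2) (addr_ge0 h3 h4)) _.
by rewrite -mulrA ler_wpM2l ?powR_ge0// mulrDr lerD// powR_add_le.
Qed.

(** This is where Re lambda >= 0 enters: cos theta >= 0 says sin^2 <= cos^2 at theta / 2, so the
    square root of lambda stays within the angle pi / 4 of the positive axis, and cos^2 >= 1 / 2. *)
Lemma half_angle (theta : R) : - (pi / 2) <= theta <= pi / 2 ->
  [/\ 2^-1 <= cos (theta / 2), `|sin (theta / 2)| <= cos (theta / 2),
     cos theta = cos (theta / 2) ^+ 2 - sin (theta / 2) ^+ 2 &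
     sin theta = 2 * sin (theta / 2) * cos (theta / 2)].
Proof.
move=> /andP[t1 t2]; set t := theta / 2; have tt : theta = t + t by rewrite /t; field.
have pi0 : 0 < pi :> R := pi_gt0 R.
have ct : 0 <= cos t by apply: cos_ge0_pihalf; rewrite /t; apply/andP; split; lra.
have cth : 0 <= cos theta by apply: cos_ge0_pihalf; rewrite t1.
have E1 : cos theta = cos t ^+ 2 - sin t ^+ 2 by rewrite tt cosD -!expr2.
have E2 : sin theta = 2 * sin t * cos t by rewrite tt sinD; ring.
have cs := cos2Dsin2 t.
have sc : sin t ^+ 2 <= cos t ^+ 2 by rewrite -subr_ge0 -E1.
split=> //.
- rewrite -(@ler_sqr _ _ (cos t)) ?nnegrE ?invr_ge0//.
  by apply: (@le_trans _ _ 2^-1); [rewrite expr2; lra|lra].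
- by rewrite -(@ler_sqr _ _ (cos t)) ?nnegrE// real_normK ?num_real.
Qed.

Lemma Lnorm_le3 (p A D F S1 S2 : R) (psi f u1 u2 : 'rV[R]_N -> R) : 1 < p -> 0 <= A -> 0 <= D ->
  measurable_fun setT psi -> measurable_fun setT f -> measurable_fun setT u1 -> measurable_fun setT u2 ->
  (forall x, `|psi x| <= A * `|f x| + D * (`|u1 x| + `|u2 x|)) ->
  ('N_p [f] = F%:E)%E -> ('N_p [u1] = S1%:E)%E -> ('N_p [u2] = S2%:E)%E ->
  ('N_p [psi] <= (A * F + D * (S1 + S2))%:E)%E.
Proof.
move=> p1 A0 D0 mpsi mf m1 m2 H EF E1 E2; have p0 : 0 < p by exact: lt_trans p1.
have mn (h : 'rV[R]_N -> R) : measurable_fun setT h -> measurable_fun setT (fun x => `|h x|).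
  by move=> mh; exact: measurableT_comp.
have Nn (h : 'rV[R]_N -> R) : ('N_p [(fun x => `|h x|)%R] = 'N_p [h])%E.
  by rewrite !LnormE; under eq_integral do rewrite normr_id.
have m12 : measurable_fun setT (fun x => `|u1 x| + `|u2 x|).
  by apply: measurable_funD; exact: mn.
apply: (@le_trans _ _ ('N_p [(fun x => A * `|f x| + D * (`|u1 x| + `|u2 x|))%R])%E).
  apply: le_Lnorm => //.
    by apply: measurable_funD; apply: measurable_funM => //; exact: mn.
  by move=> x; apply: le_trans (H x) (ler_norm _).
apply: le_trans (LnormD p1 _ _) _; [by apply: measurable_funM => //; exact: mn|exact: measurable_funM|].
rewrite !LnormZl//; last exact: mn.
rewrite !ger0_norm// Nn EF EFinD EFinM leeD2l// EFinM lee_wpmul2l//.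
apply: le_trans (LnormD p1 _ _) _; [exact: mn|exact: mn|].
by rewrite !Nn E1 E2.
Qed.

Lemma Lnorm_le_fin (p : R) (f g : 'rV[R]_N -> R) : 0 < p -> measurable_fun setT f -> measurable_fun setT g ->
  (forall x, `|g x| <= `|f x|) -> ('N_p [f] < +oo)%E ->
  exists G : R, [/\ 0 <= G, ('N_p [g] = G%:E)%E & ((G `^ p)%:E = \int[mu]_x (`|g x| `^ p)%:E)%E].
Proof.
move=> p0 mf mg fg fl.
have gl : ('N_p [g] < +oo)%E by apply: le_lt_trans fl; exact: le_Lnorm.
have gE : ('N_p [g] = (fine ('N_p [g])%E)%:E)%E by rewrite fineK// ge0_fin_numE ?Lnorm_ge0.
exists (fine ('N_p [g])%E); split=> //; first by rewrite fine_ge0// Lnorm_ge0.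
by rewrite -poweR_EFin -gE Lnorm_powE.
Qed.

Lemma cube_pow_le (p : R) (B : set 'rV[R]_N) (f g : 'rV[R]_N -> R) : 0 < p -> measurable B ->
  measurable_fun setT f -> measurable_fun setT g -> (forall x, `|g x| <= \1_B x * `|f x|) ->
  (\int[mu]_x (`|g x| `^ p)%:E <= \int[mu]_x ((\1_B x)%:E * (`|f x| `^ p)%:E))%E.
Proof.
move=> p0 mB mf mg H; apply: ge0_le_integral => //.
- exact: measurable_pow.
- by apply: emeasurable_funM; [exact/measurable_EFinP/measurable_indic|exact: measurable_pow].
move=> x _; rewrite -EFinM lee_fin; have := H x; rewrite indicE; case: (x \in B).
  by rewrite !mul1r => h; apply: ge0_ler_powR; rewrite ?nnegrE// ltW.
by rewrite !mul0r normr_le0 => /eqP ->; rewrite normr0 powR0// gt_eqF.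
Qed.

(** c / 2 N eps is the relative variation of a^{1/2} on a cube of half-side eps a(x0)^{1/2}. The
    first bound allows [freeze_bounds], the second the absorption of the freezing error. *)
Lemma freezing_radius (c Q : R) : 0 < c -> 0 <= Q -> exists eps : R, [/\ 0 < eps,
  c / 2 * N%:R * eps <= 2^-1 & Q * (c / 2 * N%:R * eps) <= 1].
Proof.
move=> c0 Q0; have n0 : 0 <= N%:R :> R := ler0n R N.
have w0 : 0 < 1 + Q by rewrite ltr_wpDr.
have N1 : 0 < N%:R + 1 :> R by rewrite ltr_wpDl.
have dn0 : 0 < c * (N%:R + 1) * (1 + Q) by exact: mulr_gt0 (mulr_gt0 c0 N1) w0.
exists (c * (N%:R + 1) * (1 + Q))^-1; rewrite invr_gt0.
have tE : c / 2 * N%:R / (c * (N%:R + 1) * (1 + Q)) * (2 * (1 + Q)) <= 1.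
  rewrite (_ : _ * (2 * _) = N%:R / (N%:R + 1)); last by field; rewrite !gt_eqF.
  by rewrite ler_pdivrMr// mul1r lerDl.
have t0 : 0 <= c / 2 * N%:R / (c * (N%:R + 1) * (1 + Q)).
  by rewrite divr_ge0 ?(ltW dn0)// mulr_ge0// divr_ge0// ltW.
move: tE t0; set t := _ / (c * _ * _) => tE t0.
have tQ : 0 <= t * Q by exact: mulr_ge0.
by split=> //; clear -tE t0 tQ; lra.
Qed.

(** Adding the two inequalities leaves at most half of S1 + S2 on the right. The quantities are real
    numbers, so it can be subtracted. *)
Lemma absorb_sum (K0 al de ga F T S1 S2 : R) : 0 <= S1 -> 0 <= S2 -> 4 * K0 * de <= 2^-1 ->
  S1 <= K0 * (al * F + 2 * de * (S1 + S2) + ga * T) ->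
  S2 <= K0 * (al * F + 2 * de * (S1 + S2) + ga * T) ->
  S1 + S2 <= 4 * K0 * (al * F + ga * T).
Proof.
move=> S10 S20 Kd h1 h2; have S0 : 0 <= S1 + S2 by exact: addr_ge0.
have h := ler_wpM2r S0 Kd.
have : K0 * (al * F + 2 * de * (S1 + S2) + ga * T) =
  K0 * (al * F + ga * T) + 2^-1 * (4 * K0 * de * (S1 + S2)) by field.
by move: (K0 * (al * F + _ + _)) (4 * K0 * de * _) h h1 h2 => X Y; lra.
Qed.

Lemma ereal_absorb (X c K al be f t : R) (J JF JU : \bar R) : 0 < c -> 0 <= X -> X / c <= K ->
  0 <= al -> 0 <= be -> 0 <= f -> 0 <= t -> (c%:E * J <= (X * (al * f + be * t))%:E)%E ->
  (f%:E <= JF)%E -> (t%:E <= JU)%E ->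
  (J <= K%:E * (al%:E * JF + be%:E * JU))%E.
Proof.
move=> c0 X0 XK al0 be0 f0 t0 h hf ht.
have K0 : 0 <= K by apply: le_trans XK; rewrite divr_ge0// ltW.
have -> : J = (c^-1%:E * (c%:E * J))%E by rewrite muleA -EFinM mulVf ?gt_eqF// mul1e.
apply: (@le_trans _ _ (c^-1%:E * (X * (al * f + be * t))%:E)%E).
  by rewrite lee_wpmul2l// lee_fin invr_ge0 ltW.
rewrite -EFinM mulrA [c^-1 * X]mulrC.
apply: (@le_trans _ _ (K * (al * f + be * t))%:E).
  by rewrite lee_fin ler_wpM2r// addr_ge0// mulr_ge0.
rewrite EFinM lee_wpmul2l// EFinD !EFinM; apply: leeD; exact: lee_wpmul2l.
Qed.

(** With lambda = q^4 e^{i theta} and S = a(x0)^{1/2}, dividing by a^2 gives Delta^2 u + lambda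
    S^{-4} u = f / a^2 + lambda (S^{-4} - a^{-2}) u. The last term is absorbed at once, on the same
    cutoff. The commutator term lives on the larger cube and must stay on the right; its factor 1 /
    q is exploited only after averaging. *)
Lemma frozen_estimate (p c : R) : 1 < p -> 0 < c -> exists K eps : R,
  [/\ 0 < K, 0 < eps, c / 2 * N%:R * eps <= 2^-1 & forall a,
  Ck 1 a -> (forall x, 0 < a x) -> (forall x, grad_norm a x <= c * a x `^ (1 / 2)) ->
  forall q theta : R, 1 <= q -> 2 / eps <= q -> - (pi / 2) <= theta <= pi / 2 ->
  forall ur ui br bi, weak_bilap ur br -> weak_bilap ui bi ->
  let fr x := q ^+ 4 * (cos theta * ur x - sin theta * ui x) + a x ^+ 2 * br x in
  let fi x := q ^+ 4 * (cos theta * ui x + sin theta * ur x) + a x ^+ 2 * bi x in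
  ('N_p [ur] < +oo)%E -> ('N_p [ui] < +oo)%E -> ('N_p [fr] < +oo)%E -> ('N_p [fi] < +oo)%E ->
  forall x0 h, h = eps * Num.sqrt (a x0) ->
  (\int[mu]_x ((\1_(cube x0 (h / 2)) x)%:E * (`|ur x| `^ p + `|ui x| `^ p)%:E) <=
   K%:E * (((q ^+ 4)^-1 `^ p)%:E * \int[mu]_x ((\1_(cube x0 h) x)%:E * (`|fr x| `^ p + `|fi x| `^ p)%:E) +
     (q^-1)%:E * \int[mu]_x ((\1_(cube x0 h) x)%:E * (`|ur x| `^ p + `|ui x| `^ p)%:E)))%E].
Proof.
move=> p1 c0; have p0 : 0 < p by exact: lt_trans p1.
pose q' := (1 - p^-1)^-1.
have q'1 : 1 < q'.
  by rewrite invf_gt1 ?subr_gt0 ?invf_lt1// ltrBlDr ltrDl invr_gt0.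
have pq : p^-1 + q'^-1 = 1 by rewrite invrK addrC subrK.
have [K0 [K00 LE]] := @local_estimate R N.
have [M [c1 [M0 c10 CUT]]] := @cutoff_exists R N.
have n0 : 0 <= N%:R :> R := ler0n R N.
(* 32 * 30 = 2 * 4 * 120: this choice gives 4 K0 (120 tau) <= 1 / 2, the hypothesis of
   [absorb_sum]. *)
have [eps [eps0 tau1 tau2]] := freezing_radius c0 (mulr_ge0 (ler0n R 32) (mulr_ge0 (ler0n R 30) K00)).
pose tau := c / 2 * N%:R * eps.
have tau0 : 0 <= tau by apply: mulr_ge0 (ltW eps0); rewrite mulr_ge0// divr_ge0// ltW.
pose K1 := 4 * K0 * (64 + M * (2 / eps)).
have K10 : 0 <= K1.
  apply: mulr_ge0; first exact: mulr_ge0.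
  by rewrite addr_ge0// mulr_ge0// divr_ge0// ltW.
pose K := 2 * (K1 `^ p * (2 `^ p * 2 `^ p)) / c1 `^ p + 1.
have c1p : 0 < c1 `^ p by exact: powR_gt0.
have Kq0 : 0 <= 2 * (K1 `^ p * (2 `^ p * 2 `^ p)) by rewrite !mulr_ge0 ?powR_ge0.
exists K, eps; split=> //.
  by rewrite ltr_wpDl// divr_ge0// ltW.
move=> a a1 a0 Da q theta q1 qe hth ur ui br bi wr wi fr fi Nur Nui Nfr Nfi x0 h hE.
have q0 : 0 < q by exact: lt_le_trans q1.
have [mur mbr _ _ _] := wr; have [mui mbi _ _ _] := wi.
have ma := measurable_coef a1.
have ma2 : measurable_fun setT (fun x => a x ^+ 2) by exact: measurable_funX.
have mfr : measurable_fun setT fr.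
  apply: measurable_funD; last exact: measurable_funM.
  by apply: measurable_funM => //; apply: measurable_funB; exact: measurable_funM.
have mfi : measurable_fun setT fi.
  apply: measurable_funD; last exact: measurable_funM.
  by apply: measurable_funM => //; apply: measurable_funD; exact: measurable_funM.
pose s x := Num.sqrt (a x).
have s0 x : 0 < s x by rewrite sqrtr_gt0.
have sa x : a x ^+ 2 = s x ^+ 4 by rewrite -[a x in LHS](@sqr_sqrtr _ (a x)) ?(ltW (a0 x))// -exprM.
pose S := s x0; have S0 : 0 < S := s0 x0.
have h0 : 0 < h by rewrite hE mulr_gt0.
have [eta [te cb e01 eo el]] := CUT x0 h h0.
have be := test_function_bCoo te; have me := bCoo_measurable be.
have mB := measurable_cube x0 h; have oB := @open_cubeC R N x0 h.
have [ct1 st cosE sinE] := half_angle hth.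
set C := cos (theta / 2) in ct1 st cosE sinE *; set Sn := sin (theta / 2) in st cosE sinE *.
have C0 : 0 < C by apply: lt_le_trans ct1; rewrite invr_gt0.
(* aa + i beta^2 = i m e^{i theta / 2}, so -(aa + i beta^2)^2 = m^2 e^{i theta} = lambda /
   a(x0)^2. *)
pose m := q ^+ 2 / S ^+ 2; have m0 : 0 < m by rewrite divr_gt0// exprn_gt0.
pose b := m * C; have b0 : 0 < b by rewrite mulr_gt0.
pose beta := Num.sqrt b; have beta0 : 0 < beta by rewrite sqrtr_gt0.
have betab : beta ^+ 2 = b by rewrite sqr_sqrtr// ltW.
pose aa := - (m * Sn).
have aab : `|aa| <= beta ^+ 2.
  by rewrite betab normrN normrM (gtr0_norm m0) ler_wpM2l// ltW.
have SN : S != 0 by rewrite gt_eqF.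
have m2 : m ^+ 2 = q ^+ 4 / S ^+ 4 by rewrite /m; field.
have mrE : (beta ^+ 2) ^+ 2 - aa ^+ 2 = q ^+ 4 / S ^+ 4 * cos theta.
  by rewrite betab cosE -m2 /b /aa; ring.
have miE : - 2 * aa * beta ^+ 2 = q ^+ 4 / S ^+ 4 * sin theta.
  by rewrite betab sinE -m2 /b /aa; ring.
pose H := h^-1; have H0 : 0 < H by rewrite invr_gt0.
pose y := H / beta; have y0 : 0 < y by rewrite divr_gt0.
(* S cancels: y^2 = 1 / (eps^2 q^2 cos(theta / 2)), and the cosine is at least 1 / 2, a fortiori 1 /
   4. *)
have yq : y <= 2 / (eps * q).
  have yy : y ^+ 2 <= (2 / (eps * q)) ^+ 2.
    have -> : y ^+ 2 = (eps ^+ 2 * q ^+ 2 * C)^-1.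
      rewrite /y expr_div_n betab /H hE -/(s x0) -/S /b /m; field.
      by rewrite SN !gt_eqF.
    have -> : (2 / (eps * q)) ^+ 2 = (eps ^+ 2 * q ^+ 2 * 4^-1)^-1 by field; rewrite !gt_eqF.
    have e2 : 0 < eps ^+ 2 * q ^+ 2 by rewrite mulr_gt0 ?exprn_gt0.
    rewrite lef_pV2 ?posrE ?mulr_gt0 ?invr_gt0// ler_wpM2l ?(ltW e2)//.
    by apply: le_trans ct1; clear; lra.
  by move: yy; rewrite ler_sqr ?nnegrE ?(ltW y0)// divr_ge0// mulr_ge0// ltW.
have yq2 : 2 / (eps * q) <= 1.
  by rewrite ler_pdivrMr ?mulr_gt0// mul1r mulrC -ler_pdivrMr.
have Hb : 0 <= H <= beta.
  by rewrite (ltW H0)/=; have := le_trans yq yq2; rewrite ler_pdivrMr// mul1r.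
have etaN x : `|eta x| <= \1_(cube x0 h) x.
  rewrite indicE; have [xB|xB] := pselect (cube x0 h x).
    by rewrite mem_set//; have /andP[e1 e2] := e01 x; rewrite ger0_norm.
  by rewrite eo// normr0.
have eta1 x : `|eta x| <= 1 by have /andP[e1 e2] := e01 x; rewrite ger0_norm.
have fin1 g : measurable_fun setT g -> ('N_p [g] < +oo)%E -> exists G : R, [/\ 0 <= G,
    ('N_p [(fun x => eta x * g x)%R] = G%:E)%E &
    ((G `^ p)%:E = \int[mu]_x (`|eta x * g x| `^ p)%:E)%E].
  move=> mg gl; apply: (Lnorm_le_fin p0 mg _ _ gl); first exact: measurable_funM.
  by move=> x; rewrite normrM ler_piMl.
have m1B : measurable_fun setT (\1_(cube x0 h) : 'rV[R]_N -> R) by exact: measurable_indic.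
have fin2 g : measurable_fun setT g -> ('N_p [g] < +oo)%E -> exists G : R, [/\ 0 <= G,
    ('N_p [(fun x => \1_(cube x0 h) x * g x)%R] = G%:E)%E &
    ((G `^ p)%:E = \int[mu]_x (`|\1_(cube x0 h) x * g x| `^ p)%:E)%E].
  move=> mg gl; apply: (Lnorm_le_fin p0 mg _ _ gl); first exact: measurable_funM.
  by move=> x; rewrite normrM ler_piMl// ger0_norm// indicE; case: (_ \in _).
have [F1 [F10 EF1 IF1]] := fin1 fr mfr Nfr; have [F2 [F20 EF2 IF2]] := fin1 fi mfi Nfi.
have [S1 [S10 ES1 IS1]] := fin1 ur mur Nur; have [S2 [S20 ES2 IS2]] := fin1 ui mui Nui.
have [T1 [T10 ET1 IT1]] := fin2 ur mur Nur; have [T2 [T20 ET2 IT2]] := fin2 ui mui Nui.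
have tauP : 0 <= tau <= 2^-1 by rewrite tau0.
have near x : cube x0 h x -> `|s x - S| <= tau * S.
  move=> xB; apply: (le_trans (sqrt_coef_lipschitz a1 a0 Da x x0)).
  rewrite /tau -!mulrA 2?ler_wpM2l ?invr_ge0 ?(ltW c0)//.
  rewrite [leRHS](_ : _ = \sum_(i < N) h); last by rewrite sumr_const card_ord -[RHS]mulr_natl hE.
  by apply: ler_sum => i _; exact: xB.
(* On the cube, A bounds 1 / a^2 and D bounds the freezing coefficient q^4 |S^{-4} - a^{-2}|. *)
pose A := 16 / S ^+ 4; pose D := q ^+ 4 * (30 * tau / S ^+ 4).
have S4 : 0 < S ^+ 4 by exact: exprn_gt0.
have q4 : 0 < q ^+ 4 by exact: exprn_gt0.
have A0 : 0 <= A by rewrite divr_ge0// ltW.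
have D0 : 0 <= D by rewrite mulr_ge0 ?(ltW q4)// divr_ge0 ?(ltW S4)// mulr_ge0.
have csb (z1 z2 : R) : `|cos theta * z1 - sin theta * z2| <= `|z1| + `|z2|.
  apply: le_trans (ler_normB _ _) _; rewrite !normrM.
  by apply: lerD; rewrite ler_piMl// ?cos_max ?sin_max.
have csb' (z1 z2 : R) : `|cos theta * z1 + sin theta * z2| <= `|z1| + `|z2|.
  apply: le_trans (ler_normD _ _) _; rewrite !normrM.
  by apply: lerD; rewrite ler_piMl// ?cos_max ?sin_max.
have core (e z f v s4 w1 w2 : R) : s4 != 0 -> f = q ^+ 4 * v + s4 * z -> s4^-1 <= A -> 0 <= s4 ->
    `|(S ^+ 4)^-1 - s4^-1| <= 30 * tau / S ^+ 4 -> `|v| <= `|w1| + `|w2| ->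
    `|e * (z + q ^+ 4 / S ^+ 4 * v)| <= A * `|e * f| + D * (`|e * w1| + `|e * w2|).
  move=> s4n fE sA s4p sD vw.
  have -> : z + q ^+ 4 / S ^+ 4 * v = s4^-1 * f + q ^+ 4 * ((S ^+ 4)^-1 - s4^-1) * v.
    by rewrite fE; field; rewrite s4n.
  rewrite mulrDr; apply: le_trans (ler_normD _ _) _; apply: lerD.
    rewrite mulrCA normrM [`|_^-1|]ger0_norm ?invr_ge0//; exact: ler_wpM2r.
  rewrite (_ : e * _ = q ^+ 4 * ((S ^+ 4)^-1 - s4^-1) * (e * v)); last by ring.
  rewrite normrM; apply: ler_pM => //.
    by rewrite normrM (gtr0_norm q4) ler_wpM2l// ltW.
  by rewrite !normrM -mulrDr ler_wpM2l.
have ptw x (z f v w1 w2 : R) : f = q ^+ 4 * v + a x ^+ 2 * z -> `|v| <= `|w1| + `|w2| ->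
    `|eta x * (z + q ^+ 4 / S ^+ 4 * v)| <= A * `|eta x * f| + D * (`|eta x * w1| + `|eta x * w2|).
  move=> fE vw; have [xB|xB] := pselect (cube x0 h x); last first.
    by rewrite eo// !mul0r normr0 addr0 !mulr0 addr0.
  have [k1 k2] := freeze_bounds (s0 x) S0 tauP (near x xB).
  apply: core fE _ _ _ vw.
  - by rewrite gt_eqF// exprn_gt0.
  - by rewrite sa.
  - by rewrite exprn_ge0// ltW.
  - by rewrite sa.
pose mr := (beta ^+ 2) ^+ 2 - aa ^+ 2; pose mi := - 2 * aa * beta ^+ 2.
have mPsi1 : measurable_fun setT (fun x => eta x * (br x + mr * ur x - mi * ui x)).
  by apply: measurable_funM => //; apply: measurable_funB; [apply: measurable_funD => //|]; exact: measurable_funM.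
have mPsi2 : measurable_fun setT (fun x => eta x * (bi x + mr * ui x + mi * ur x)).
  by apply: measurable_funM => //; apply: measurable_funD; [apply: measurable_funD => //|]; exact: measurable_funM.
have me_ g : measurable_fun setT g -> measurable_fun setT (fun x => eta x * g x) by exact: measurable_funM.
have hP1 := Lnorm_le3 p1 A0 D0 mPsi1 (me_ _ mfr) (me_ _ mur) (me_ _ mui) _ EF1 ES1 ES2.
have hP2 := Lnorm_le3 p1 A0 D0 mPsi2 (me_ _ mfi) (me_ _ mui) (me_ _ mur) _ EF2 ES2 ES1.
have {}hP1 := hP1 (fun x => _); have {}hP2 := hP2 (fun x => _).
have HP1 : ('N_p [(fun x => eta x * (br x + mr * ur x - mi * ui x))%R] <= (A * F1 + D * (S1 + S2))%:E)%E.
  apply: hP1 => x; have := ptw x (br x) (fr x) (cos theta * ur x - sin theta * ui x) (ur x) (ui x) erefl (csb _ _).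
  by rewrite /mr /mi mrE miE mulrBr !mulrA addrA.
have HP2 : ('N_p [(fun x => eta x * (bi x + mr * ui x + mi * ur x))%R] <= (A * F2 + D * (S2 + S1))%:E)%E.
  apply: hP2 => x; have := ptw x (bi x) (fi x) (cos theta * ui x + sin theta * ur x) (ui x) (ur x) erefl (csb' _ _).
  by rewrite /mr /mi mrE miE [q ^+ 4 / S ^+ 4 * (_ + _)]mulrDr !mulrA addrA.
have P1ge : 0 <= A * F1 + D * (S1 + S2) by rewrite addr_ge0// mulr_ge0// addr_ge0.
have P2ge : 0 <= A * F2 + D * (S2 + S1) by rewrite addr_ge0// mulr_ge0// addr_ge0.
have fS1 : ('N_p [(fun x => eta x * ur x)%R] < +oo)%E by rewrite ES1 ltry.
have fS2 : ('N_p [(fun x => eta x * ui x)%R] < +oo)%E by rewrite ES2 ltry.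
have hT1 : ('N_p [(fun x => \1_(cube x0 h) x * ur x)%R] <= T1%:E)%E by rewrite ET1.
have hT2 : ('N_p [(fun x => \1_(cube x0 h) x * ui x)%R] <= T2%:E)%E by rewrite ET2.
have EST1 := LE p q' p1 q'1 pq ur ui br bi eta (cube x0 h) aa beta M H _ _ T1 T2 wr wi te mB oB eo
  beta0 aab M0 Hb cb P1ge P2ge T10 T20 HP1 HP2 hT1 hT2 fS1.
have NN f1 f2 : (forall x, `|f1 x| = `|f2 x|) -> ('N_p [f1] = 'N_p [f2])%E.
  by move=> ff; rewrite !LnormE; under eq_integral do rewrite ff.
have HP1' : ('N_p [(fun x => eta x * (- br x + mr * - ur x + mi * ui x))%R] <= (A * F1 + D * (S1 + S2))%:E)%E.
  rewrite (NN _ (fun x => eta x * (br x + mr * ur x - mi * ui x))) // => x.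
  by rewrite -normrN; congr (`|_|); ring.
have HP2' : ('N_p [(fun x => eta x * (bi x + mr * ui x - mi * - ur x))%R] <= (A * F2 + D * (S2 + S1))%:E)%E.
  rewrite (NN _ (fun x => eta x * (bi x + mr * ui x + mi * ur x))) // => x.
  by rewrite mulrN opprK.
have hT1' : ('N_p [(fun x => \1_(cube x0 h) x * - ur x)%R] <= T1%:E)%E.
  by rewrite (NN _ (fun x => \1_(cube x0 h) x * ur x)) // => x; rewrite mulrN normrN.
(* The pair (ui, -ur) represents -i u; its real part is the imaginary part of u. *)
have EST2 := LE p q' p1 q'1 pq ui (fun x => - ur x) bi (fun x => - br x) eta (cube x0 h) aa beta M H
  _ _ T2 T1 wi (weak_bilapN wr) te mB oB eo
  beta0 aab M0 Hb cb P2ge P1ge T20 T10 HP2' HP1' hT2 hT1' fS2.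
rewrite ES1 lee_fin in EST1; rewrite ES2 lee_fin in EST2.
pose F := F1 + F2; pose T := T1 + T2.
have F0 : 0 <= F by exact: addr_ge0. have T0 : 0 <= T by exact: addr_ge0.
have b4 : (beta ^+ 4)^-1 <= 4 * (S ^+ 4 / q ^+ 4).
  have e4 : beta ^+ 4 = m ^+ 2 * C ^+ 2 by rewrite -[4%N]/(2 * 2)%N exprM betab /b exprMn.
  have c4 : 4^-1 <= C ^+ 2.
    have -> : 4^-1 = 2^-1 ^+ 2 :> R by field.
    by rewrite lerXn2r ?nnegrE ?invr_ge0// ltW.
  have -> : 4 * (S ^+ 4 / q ^+ 4) = (m ^+ 2 * 4^-1)^-1.
    by rewrite m2; field; rewrite SN !gt_eqF.
  rewrite e4 lef_pV2 ?posrE; last 2 first.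
  - by rewrite mulr_gt0 ?exprn_gt0.
  - by rewrite mulr_gt0 ?invr_gt0 ?exprn_gt0.
  by rewrite ler_wpM2l// exprn_ge0// ltW.
(* 64 = 16 * 4 and 120 = 30 * 4, where 4 comes from [b4]. *)
have est1 X Y P' P'' : P' + P'' = A * F + 2 * D * (S1 + S2) -> X <= K0 * ((P' + P'') / beta ^+ 4 + M * (H / beta) * Y) -> Y = T ->
    X <= K0 * (64 / q ^+ 4 * F + 2 * (120 * tau) * (S1 + S2) + M * (2 / (eps * q)) * T).
  move=> PE XE YE; apply: (le_trans XE); rewrite PE YE ler_wpM2l//; apply: lerD; last first.
    by rewrite ler_wpM2r// ler_wpM2l.
  rewrite mulrDl; apply: lerD.
    rewrite mulrAC ler_wpM2r//; apply: (@le_trans _ _ (A * (4 * (S ^+ 4 / q ^+ 4)))).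
      by rewrite ler_wpM2l.
    rewrite le_eqVlt; apply/orP; left; apply/eqP; rewrite /A; field.
    by rewrite SN gt_eqF.
  rewrite mulrAC ler_wpM2r ?addr_ge0//; apply: (@le_trans _ _ (2 * D * (4 * (S ^+ 4 / q ^+ 4)))).
    by rewrite ler_wpM2l// mulr_ge0.
  rewrite le_eqVlt; apply/orP; left; apply/eqP; rewrite /D; field.
  by rewrite SN gt_eqF.
have e1 := est1 _ _ _ _ _ EST1 erefl; have e2 := est1 _ _ _ _ _ EST2 (addrC _ _).
have {}e1 := e1 (ltac:(rewrite /F; ring)); have {}e2 := e2 (ltac:(rewrite /F; ring)).
have t2 : 32 * (30 * K0) * tau <= 1 := tau2.
have tK : 4 * K0 * (120 * tau) <= 2^-1.
  rewrite (_ : 4 * K0 * (120 * tau) = 2^-1 * (32 * (30 * K0) * tau)); last by field.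
  by move: (32 * _ * _) t2 => X; clear; lra.
have SS := absorb_sum S10 S20 tK e1 e2.
have Zle : S1 + S2 <= K1 * (F1 / q ^+ 4 + F2 / q ^+ 4 + (T1 / q + T2 / q)).
  apply: (le_trans SS); rewrite -subr_ge0.
  rewrite (_ : _ - _ = 4 * K0 * (64 * (T / q) + M * (2 / eps) * (F / q ^+ 4))); last first.
    by rewrite /K1 /F /T; field; rewrite !gt_eqF.
  apply: mulr_ge0; first exact: mulr_ge0.
  have v1 : 0 <= T / q by exact: divr_ge0 T0 (ltW q0).
  have v2 : 0 <= F / q ^+ 4 by exact: divr_ge0 F0 (ltW q4).
  have v3 : 0 <= 2 / eps by exact: divr_ge0 (ler0n R 2) (ltW eps0).
  exact: addr_ge0 (mulr_ge0 (ler0n R 64) v1) (mulr_ge0 (mulr_ge0 M0 v3) v2).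
pose W := F1 / q ^+ 4 + F2 / q ^+ 4 + (T1 / q + T2 / q).
have [u1 u2 u3 u4] : [/\ 0 <= F1 / q ^+ 4, 0 <= F2 / q ^+ 4, 0 <= T1 / q & 0 <= T2 / q].
  by split; rewrite divr_ge0 ?(ltW q4) ?(ltW q0).
have W0 : 0 <= W by rewrite /W !addr_ge0.
(* As q >= 1 and p > 1, the power p on the commutator factor may be dropped; the first power of 1 /
   q still tends to 0. *)
have qp : q^-1 `^ p <= q^-1.
  rewrite -powR_inv1 ?(ltW q0)// -powRrM mulN1r powRN powR_inv1 ?(ltW q0)// lef_pV2 ?posrE ?powR_gt0//.
  by rewrite -[leLHS]powRr1 ?(ltW q0)// ler_powR// ltW.
have Wp : W `^ p <= 2 `^ p * 2 `^ p * ((q ^+ 4)^-1 `^ p * (F1 `^ p + F2 `^ p) + q^-1 * (T1 `^ p + T2 `^ p)).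
  apply: le_trans (powR_add4_le p0 u1 u2 u3 u4) _; rewrite ler_wpM2l ?mulr_ge0 ?powR_ge0//.
  have iq4 : 0 <= (q ^+ 4)^-1 by rewrite invr_ge0 ltW.
  have iq : 0 <= q^-1 by rewrite invr_ge0 ltW.
  rewrite !powRM// -!mulrDl; apply: lerD; first by rewrite mulrC.
  by rewrite mulrC ler_wpM2r// addr_ge0 ?powR_ge0.
have Sp X : 0 <= X -> X <= S1 + S2 -> X `^ p <= K1 `^ p * W `^ p.
  move=> X0 XS; rewrite -powRM//; apply: ge0_ler_powR; rewrite ?nnegrE ?(ltW p0)//; first exact: mulr_ge0 K10 W0.
  exact: le_trans XS Zle.
have SSp : S1 `^ p + S2 `^ p <= 2 * (K1 `^ p * (2 `^ p * 2 `^ p)) *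
    ((q ^+ 4)^-1 `^ p * (F1 `^ p + F2 `^ p) + q^-1 * (T1 `^ p + T2 `^ p)).
  have SS1 : S1 <= S1 + S2 by rewrite lerDl.
  have SS2 : S2 <= S1 + S2 by rewrite lerDr.
  apply: le_trans (lerD (Sp _ S10 SS1) (Sp _ S20 SS2)) _.
  have h2 := ler_wpM2l (powR_ge0 K1 p) Wp.
  by move: h2; rewrite !mulrA; move: (K1 `^ p * W `^ p) => X h2; clear -h2; lra.
have mpow (g : 'rV[R]_N -> R) : measurable_fun setT g -> measurable_fun setT (fun x => (`|g x| `^ p)%:E).
  exact: measurable_pow.
have pow0 (z : R) : (0 <= (`|z| `^ p)%:E)%E by rewrite lee_fin powR_ge0.
have mind (A' : set 'rV[R]_N) : measurable A' -> measurable_fun setT (fun x => (\1_A' x)%:E : \bar R).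
  by move=> mA; exact/measurable_EFinP/measurable_indic.
have ind0 (A' : set 'rV[R]_N) x : (0 <= (\1_A' x : R)%:E)%E by rewrite lee_fin.
have split2 (A' : set 'rV[R]_N) g1 g2 : measurable A' -> measurable_fun setT g1 -> measurable_fun setT g2 ->
    (\int[mu]_x ((\1_A' x)%:E * (`|g1 x| `^ p + `|g2 x| `^ p)%:E) =
     \int[mu]_x ((\1_A' x)%:E * (`|g1 x| `^ p)%:E) + \int[mu]_x ((\1_A' x)%:E * (`|g2 x| `^ p)%:E))%E.
  move=> mA mg1 mg2; rewrite -ge0_integralD//.
  - by apply: eq_integral => x _; rewrite EFinD ge0_muleDr.
  - by apply: emeasurable_funM; [exact: mind|exact: mpow].
  - by apply: emeasurable_funM; [exact: mind|exact: mpow].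
have mB2 := measurable_cube x0 (h / 2).
apply: (@ereal_absorb (2 * (K1 `^ p * (2 `^ p * 2 `^ p))) (c1 `^ p) K ((q ^+ 4)^-1 `^ p) q^-1
  (F1 `^ p + F2 `^ p) (T1 `^ p + T2 `^ p)) => //.
- by rewrite /K lerDl.
- exact: powR_ge0.
- by rewrite invr_ge0 ltW.
- by rewrite addr_ge0// powR_ge0.
- by rewrite addr_ge0// powR_ge0.
- apply: (@le_trans _ _ (S1 `^ p + S2 `^ p)%:E); last by rewrite lee_fin.
  have half g G : measurable_fun setT g -> ((G `^ p)%:E = \int[mu]_x (`|eta x * g x| `^ p)%:E)%E ->
      ((c1 `^ p)%:E * \int[mu]_x ((\1_(cube x0 (h / 2)) x)%:E * (`|g x| `^ p)%:E) <= (G `^ p)%:E)%E.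
    move=> mg ->; rewrite -ge0_integralZl//; last 2 first.
    - by apply: emeasurable_funM; [exact: mind|exact: mpow].
    - by rewrite lee_fin powR_ge0.
    apply: ge0_le_integral => //.
    - by move=> x _; rewrite mule_ge0 ?lee_fin ?powR_ge0//; exact: mule_ge0.
    - by apply: measurable_funeM; apply: emeasurable_funM; [exact: mind|exact: mpow].
    - by apply: mpow; exact: measurable_funM.
    move=> x _; rewrite -!EFinM lee_fin indicE.
    have [xB|xB] := pselect (cube x0 (h / 2) x); last by rewrite memNset// mul0r mulr0 powR_ge0.
    rewrite mem_set// mul1r -powRM ?(ltW c10)//; apply: ge0_ler_powR; rewrite ?nnegrE ?(ltW p0) ?mulr_ge0 ?(ltW c10)//.
    by rewrite normrM ler_wpM2r//; apply: le_trans (el x xB) (ler_norm _).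
  rewrite split2// ge0_muleDr; last 2 first.
  - by apply: integral_ge0 => x _; exact: mule_ge0.
  - by apply: integral_ge0 => x _; exact: mule_ge0.
  by rewrite EFinD; apply: leeD; [exact: half IS1|exact: half IS2].
- rewrite split2// EFinD IF1 IF2; apply: leeD; apply: cube_pow_le => //; try exact: measurable_funM.
  + by move=> x; rewrite normrM ler_wpM2r.
  + by move=> x; rewrite normrM ler_wpM2r.
- have indN x : `|\1_(cube x0 h) x : R| = \1_(cube x0 h) x by rewrite ger0_norm.
  rewrite split2// EFinD IT1 IT2; apply: leeD; apply: cube_pow_le => //; try exact: measurable_funM.
  + by move=> x; rewrite normrM indN.
  + by move=> x; rewrite normrM indN.
Qed.

End freezing.

(** * From the cubes to the whole space *)

Section global.
Context {R : realType} {N : nat}.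
Implicit Types (f g : 'rV[R]_N -> R) (x y : 'rV[R]_N) (u : 'rV[R]_N -> R[i]).

Local Notation mu := (@lebesgue_rV R N).
Local Notation "'N_ p [ f ]" := ('N[mu]_p%:E[EFin \o f])%E.

(** The local inequality is multiplied by s(y)^{-N} and integrated in y. The lower bound on averages
    is used with eps / 2 on the left, the upper bound with eps on the right. *)
Lemma average_estimate (s : 'rV[R]_N -> R) (L eps K al be : R) (Gu Gf : 'rV[R]_N -> \bar R) :
  (forall x, 0 < s x) -> measurable_fun setT s -> 0 <= L ->
  (forall x y, `|s x - s y| <= L * \sum_i `|x ord0 i - y ord0 i|) ->
  0 < eps -> L * N%:R * eps <= 2^-1 -> 0 <= K -> 0 <= al -> 0 <= be ->
  measurable_fun setT Gu -> (forall x, 0 <= Gu x)%E ->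
  measurable_fun setT Gf -> (forall x, 0 <= Gf x)%E ->
  (forall y, (\int[mu]_x ((\1_(cube y (eps / 2 * s y)) x)%:E * Gu x) <=
     K%:E * (al%:E * \int[mu]_x ((\1_(cube y (eps * s y)) x)%:E * Gf x) +
             be%:E * \int[mu]_x ((\1_(cube y (eps * s y)) x)%:E * Gu x)))%E) ->
  (((eps / 2 / 2) ^+ N)%:E * \int[mu]_x Gu x <=
   K%:E * (al%:E * (((8 * eps) ^+ N)%:E * \int[mu]_x Gf x) +
           be%:E * (((8 * eps) ^+ N)%:E * \int[mu]_x Gu x)))%E.
Proof.
move=> s0 ms L0 sL eps0 Le K0 al0 be0 mU U0 mF F0 H.
have e20 : 0 < eps / 2 by rewrite divr_gt0.
have Le2 : L * N%:R * (eps / 2) <= 2^-1.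
  by apply: le_trans Le; rewrite ler_wpM2l ?mulr_ge0//; lra.
have i0 y : (0 <= ((s y ^+ N)^-1)%:E)%E by rewrite lee_fin invr_ge0 exprn_ge0// ltW.
apply: le_trans (cube_average_ge s0 ms L0 sL e20 Le2 mU U0) _.
have lU := cube_average_le s0 ms L0 sL eps0 Le mU U0.
have lF := cube_average_le s0 ms L0 sL eps0 Le mF F0.
have mUe := measurable_cube_average eps s0 ms mU U0; have mFe := measurable_cube_average eps s0 ms mF F0.
have mU2 := measurable_cube_average (eps / 2) s0 ms mU U0.
have c0 (e : R) (G : 'rV[R]_N -> \bar R) y : (forall x, 0 <= G x)%E -> (0 <= \int[mu]_x ((\1_(cube y (e * s y)) x)%:E * G x))%E.
  by move=> G0; apply: integral_ge0 => x _; rewrite mule_ge0// lee_fin.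
have d0 (e : R) (G : 'rV[R]_N -> \bar R) y : (forall x, 0 <= G x)%E ->
    (0 <= ((s y ^+ N)^-1)%:E * \int[mu]_x ((\1_(cube y (e * s y)) x)%:E * G x))%E.
  by move=> G0; apply: mule_ge0 => //; exact: c0.
apply: (@le_trans _ _ (K%:E * (al%:E * cube_average s eps Gf + be%:E * cube_average s eps Gu))%E).
  rewrite /cube_average -[X in (_ * (X + _))%E]ge0_integralZl//; last by move=> y _; exact: d0.
  rewrite -[X in (_ * (_ + X))%E]ge0_integralZl//; last by move=> y _; exact: d0.
  have a0 y : (0 <= al%:E * (((s y ^+ N)^-1)%:E * \int[mu]_x ((\1_(cube y (eps * s y)) x)%:E * Gf x)))%E.
    by apply: mule_ge0; [rewrite lee_fin|exact: d0].
  have b0 y : (0 <= be%:E * (((s y ^+ N)^-1)%:E * \int[mu]_x ((\1_(cube y (eps * s y)) x)%:E * Gu x)))%E.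
    by apply: mule_ge0; [rewrite lee_fin|exact: d0].
  have mae := measurable_funeM al%:E mFe; have mbe := measurable_funeM be%:E mUe.
  rewrite -ge0_integralD// -ge0_integralZl//; last 2 first.
  - exact: emeasurable_funD.
  - by move=> y _; exact: adde_ge0.
  apply: ge0_le_integral => //.
  - by move=> y _; exact: d0.
  - by apply: measurable_funeM; exact: emeasurable_funD.
  move=> y _; apply: le_trans (lee_wpmul2l (i0 y) (H y)) _.
  rewrite muleCA lee_wpmul2l// ge0_muleDr; last 2 first.
  - by apply: mule_ge0; [rewrite lee_fin|exact: c0].
  - by apply: mule_ge0; [rewrite lee_fin|exact: c0].
  by rewrite muleCA [X in (_ + X)%E]muleCA.
by apply: lee_wpmul2l => //; apply: leeD; apply: lee_wpmul2l.
Qed.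

(** Finiteness of J allows half of e J to be moved to the left. JF may be infinite, and then the
    positive coefficient makes the claim trivial. *)
Lemma absorb_final (e k K al be : R) (J JF : \bar R) : 0 < e -> 0 < k -> 0 < K -> 0 < al -> 0 <= be ->
  K * be * k <= e / 2 -> (0 <= J < +oo)%E -> (0 <= JF)%E ->
  (e%:E * J <= K%:E * (al%:E * (k%:E * JF) + be%:E * (k%:E * J)))%E ->
  (J <= (2 * K * k / e * al)%:E * JF)%E.
Proof.
move=> e0 k0 K0 al0 be0 Kb /andP[J0 Joo] F0; have [j jE] : exists j, J = j%:E by exists (fine J); rewrite fineK// ge0_fin_numE.
move: J0 {Joo}; rewrite {}jE lee_fin => j0.
have X0 : 0 < 2 * K * k / e * al by rewrite mulr_gt0// divr_gt0// !mulr_gt0.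
case: JF F0 => [f||]//; last first.
  by move=> _ _; rewrite gt0_muley ?leey.
rewrite lee_fin => f0; have -> : (K%:E * (al%:E * (k%:E * f%:E) + be%:E * (k%:E * j%:E)) = (K * (al * (k * f) + be * (k * j)))%:E)%E by [].
rewrite -!EFinM !lee_fin => h.
have h2 : K * be * k * j <= e / 2 * j by rewrite ler_wpM2r.
have h3 : e / 2 * j <= K * k * al * f.
  have E : K * (al * (k * f) + be * (k * j)) = K * k * al * f + K * be * k * j by ring.
  have E2 : e / 2 * j = e * j / 2 by rewrite mulrAC.
  rewrite E2 in h2 *; rewrite E in h.
  by move: (K * k * al * f) (K * be * k * j) (e * j) h h2 => X Y Z; clear; lra.
rewrite (_ : _ * f = (K * k * al * f) / (e / 2)); last by field; rewrite gt_eqF.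
by rewrite ler_pdivlMr ?divr_gt0// mulrC.
Qed.

Lemma measurable_powD (p : R) (g h : 'rV[R]_N -> R) : measurable_fun setT g -> measurable_fun setT h ->
  measurable_fun setT (fun x => (`|g x| `^ p + `|h x| `^ p)%:E : \bar R).
Proof.
by move=> m1 m2; under eq_fun do rewrite EFinD; apply: emeasurable_funD; exact: measurable_pow.
Qed.

Lemma global_estimate (p c : R) : 1 < p -> 0 < c -> exists C rp : R, [/\ 0 < C, 0 < rp & forall a,
  Ck 1 a -> (forall x, 0 < a x) -> (forall x, grad_norm a x <= c * a x `^ (1 / 2)) ->
  forall r theta : R, rp < r -> - (pi / 2) <= theta <= pi / 2 ->
  forall ur ui br bi, weak_bilap ur br -> weak_bilap ui bi ->
  let fr x := r * (cos theta * ur x - sin theta * ui x) + a x ^+ 2 * br x in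
  let fi x := r * (cos theta * ui x + sin theta * ur x) + a x ^+ 2 * bi x in
  ('N_p [ur] < +oo)%E -> ('N_p [ui] < +oo)%E -> ('N_p [fr] < +oo)%E -> ('N_p [fi] < +oo)%E ->
  (\int[mu]_x (`|ur x| `^ p + `|ui x| `^ p)%:E <=
   (C * r^-1 `^ p)%:E * \int[mu]_x (`|fr x| `^ p + `|fi x| `^ p)%:E)%E].
Proof.
move=> p1 c0; have p0 : 0 < p by exact: lt_trans p1.
have [K [eps [K0 eps0 ce H]]] := @frozen_estimate R N p c p1 c0.
pose e := (eps / 2 / 2) ^+ N; pose k := (8 * eps) ^+ N.
have e0 : 0 < e by rewrite exprn_gt0// !divr_gt0.
have k0 : 0 < k by rewrite exprn_gt0// mulr_gt0.
pose C := 2 * K * k / e; have C0 : 0 < C by rewrite divr_gt0// !mulr_gt0.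
(* Three thresholds for q = r^{1/4}: q >= 1 and q >= 2 / eps are required by [frozen_estimate], and
   q >= C = 2 K k / e by the absorption condition K q^{-1} k <= e / 2. *)
pose Q := 1 + 2 / eps + C.
have e2 : 0 < 2 / eps by rewrite divr_gt0.
have Q1 : 1 <= Q by rewrite /Q -addrA lerDl addr_ge0// ltW.
have Qe : 2 / eps <= Q by rewrite /Q addrAC lerDr addr_ge0// ltW.
have QC : C <= Q by rewrite /Q lerDr addr_ge0// ltW.
have Q0 : 0 < Q by exact: lt_le_trans Q1.
exists C, (Q ^+ 4); split=> //; first exact: exprn_gt0.
move=> a a1 a0 Da r theta rQ hth ur ui br bi wr wi fr fi Nur Nui Nfr Nfi.
have r0 : 0 < r by apply: lt_trans rQ; exact: exprn_gt0.
pose q := Num.sqrt (Num.sqrt r).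
have qr : q ^+ 4 = r by rewrite -[4%N]/(2 * 2)%N exprM !sqr_sqrtr// ltW// sqrtr_gt0.
have qQ : Q <= q.
  have := ltW rQ; rewrite -qr ler_pXn2r// nnegrE; first exact: ltW.
  exact: sqrtr_ge0.
have q0 : 0 < q by exact: lt_le_trans qQ.
have [mur mbr _ _ _] := wr; have [mui mbi _ _ _] := wi.
have ma := measurable_coef a1.
have ma2 : measurable_fun setT (fun x => a x ^+ 2) by exact: measurable_funX.
have mfr : measurable_fun setT fr.
  apply: measurable_funD; last exact: measurable_funM.
  by apply: measurable_funM => //; apply: measurable_funB; exact: measurable_funM.
have mfi : measurable_fun setT fi.
  apply: measurable_funD; last exact: measurable_funM.
  by apply: measurable_funM => //; apply: measurable_funD; exact: measurable_funM.
have G0 (z1 z2 : R) : (0 <= (`|z1| `^ p + `|z2| `^ p)%:E)%E by rewrite lee_fin addr_ge0 ?powR_ge0.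
have lf g : ('N_p [g] < +oo)%E -> (\int[mu]_x (`|g x| `^ p)%:E < +oo)%E.
  by move=> gl; rewrite -Lnorm_powE//; apply: poweR_lty.
have iU : (0 <= \int[mu]_x (`|ur x| `^ p + `|ui x| `^ p)%:E < +oo)%E.
  apply/andP; split; first by apply: integral_ge0 => x _; exact: G0.
  under eq_integral do rewrite EFinD.
  rewrite ge0_integralD//; [|exact: measurable_pow|exact: measurable_pow].
  by rewrite lte_add_pinfty// lf.
apply: (absorb_final (e := e) (k := k) (K := K) (be := q^-1)) => //.
- by rewrite powR_gt0// invr_gt0.
- by rewrite invr_ge0 ltW.
- rewrite mulrAC ler_pdivrMr// -ler_pdivrMl ?divr_gt0//.
  apply: le_trans qQ; apply: le_trans QC; rewrite le_eqVlt; apply/orP; left; apply/eqP.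
  by rewrite /C; field; rewrite gt_eqF.
- by apply: integral_ge0 => x _; exact: G0.
apply: (average_estimate (s := fun x => Num.sqrt (a x)) (L := c / 2)) => //.
- by move=> x; rewrite sqrtr_gt0.
- apply: (measurableT_comp (f := @Num.sqrt R)) => //.
  by apply: measurable_realfun.continuous_measurable_fun => t; exact: sqrt_continuous.
- by rewrite divr_ge0// ltW.
- exact: sqrt_coef_lipschitz.
- exact: ltW.
- exact: powR_ge0.
- by rewrite invr_ge0 ltW.
- exact: measurable_powD.
- exact: measurable_powD.
move=> y; rewrite [eps / 2 * _]mulrAC.
have := H a a1 a0 Da q theta (le_trans Q1 qQ) (le_trans Qe qQ) hth ur ui br bi wr wi.
by rewrite qr => /(_ Nur Nui Nfr Nfi y _ erefl).
Qed.

Lemma Lnorm_modulus_lt p u g : 0 < p -> cmeasurable u -> (Lpnorm p u < +oo)%E ->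
  measurable_fun setT g -> (forall x, `|g x| <= modulus u x) -> ('N_p [g] < +oo)%E.
Proof.
move=> p0 mu_ ul mg gu; apply: le_lt_trans ul; apply: le_Lnorm => //.
  exact: measurable_modulus.
by move=> x; apply: le_trans (gu x) (ler_norm _).
Qed.

Lemma modulus_pow_le p u x : 0 < p ->
  modulus u x `^ p <= 2 `^ p * (`|complex.Re (u x)| `^ p + `|complex.Im (u x)| `^ p).
Proof.
move=> p0; apply: le_trans (powR_add_le p0 (normr_ge0 _) (normr_ge0 _)).
by apply: ge0_ler_powR; rewrite ?nnegrE ?(ltW p0) ?modulus_ge0 ?addr_ge0//; exact: normc_le_ReIm.
Qed.

Lemma integral_modulus_le p u : 0 < p -> cmeasurable u ->
  (\int[mu]_x (`|modulus u x| `^ p)%:E <=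
   (2 `^ p)%:E * \int[mu]_x (`|complex.Re (u x)| `^ p + `|complex.Im (u x)| `^ p)%:E)%E.
Proof.
move=> p0 mu_; have mmu := measurable_modulus mu_; have [mur mui] := mu_.
have G0 (z1 z2 : R) : (0 <= (`|z1| `^ p + `|z2| `^ p)%:E)%E by rewrite lee_fin addr_ge0 ?powR_ge0.
rewrite -ge0_integralZl//; last exact: measurable_powD.
apply: ge0_le_integral => //.
- exact: measurable_pow.
- by apply: measurable_funeM; exact: measurable_powD.
by move=> x _; rewrite -EFinM lee_fin ger0_norm ?modulus_ge0//; exact: modulus_pow_le.
Qed.

Lemma integral_ReIm_le p u : 0 < p -> cmeasurable u ->
  (\int[mu]_x (`|complex.Re (u x)| `^ p + `|complex.Im (u x)| `^ p)%:E <=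
   2%:E * \int[mu]_x (`|modulus u x| `^ p)%:E)%E.
Proof.
move=> p0 mu_; have mmu := measurable_modulus mu_; have [mur mui] := mu_.
have G0 (z1 z2 : R) : (0 <= (`|z1| `^ p + `|z2| `^ p)%:E)%E by rewrite lee_fin addr_ge0 ?powR_ge0.
have k0 : (0 <= (2 : R)%:E)%E by rewrite lee_fin.
rewrite -ge0_integralZl//; last exact: measurable_pow.
apply: ge0_le_integral => //.
- exact: measurable_powD.
- by apply: measurable_funeM; exact: measurable_pow.
move=> x _; rewrite -EFinM lee_fin mulr_natl mulr2n (ger0_norm (modulus_ge0 u x)).
have pm z : 0 <= z -> z <= modulus u x -> z `^ p <= modulus u x `^ p.
  by move=> z0 zv; apply: ge0_ler_powR; rewrite ?nnegrE ?(ltW p0) ?modulus_ge0.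
by apply: lerD; apply: pm => //; [exact: Re_le_normc|exact: Im_le_normc].
Qed.

(** Passage from the two components back to the modulus, at the cost of 2^p for u and 2 for v before
    the p-th root is taken. *)
Lemma Lpnorm_le_integral (p C r : R) u v : 1 < p -> 0 < C -> 0 < r -> cmeasurable u -> cmeasurable v ->
  (Lpnorm p u < +oo)%E -> (Lpnorm p v < +oo)%E ->
  (\int[mu]_x (`|complex.Re (u x)| `^ p + `|complex.Im (u x)| `^ p)%:E <=
   (C * r^-1 `^ p)%:E * \int[mu]_x (`|complex.Re (v x)| `^ p + `|complex.Im (v x)| `^ p)%:E)%E ->
  (r%:E * Lpnorm p u <= ((2 `^ p * C * 2) `^ p^-1)%:E * Lpnorm p v)%E.
Proof.
move=> p1 C0 r0 mu_ mv lu lv H; have p0 : 0 < p by exact: lt_trans p1.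
have mmu := measurable_modulus mu_; have mmv := measurable_modulus mv.
have [U [U0 EU IU]] := Lnorm_le_fin p0 mmu mmu (fun x => lexx _) lu.
have [V [V0 EV IV]] := Lnorm_le_fin p0 mmv mmv (fun x => lexx _) lv.
have h : U `^ p <= 2 `^ p * C * 2 * r^-1 `^ p * V `^ p.
  rewrite -lee_fin IU; apply: (le_trans (integral_modulus_le p0 mu_)).
  rewrite (_ : _ * _ * V `^ p = 2 `^ p * (C * r^-1 `^ p * (2 * V `^ p))); last by ring.
  rewrite EFinM lee_wpmul2l ?lee_fin ?powR_ge0//; apply: (le_trans H).
  rewrite [leRHS]EFinM; apply: lee_wpmul2l; last by rewrite EFinM IV; exact: integral_ReIm_le.
  by rewrite lee_fin ?mulr_ge0 ?powR_ge0 ?(ltW C0).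
have X0 : 0 < 2 `^ p * C * 2 by rewrite !mulr_gt0// powR_gt0.
rewrite [Lpnorm p u]EU [Lpnorm p v]EV -!EFinM lee_fin.
move: h X0; move: (2 `^ p * C * 2) => X h X0.
have Xp : X = (X `^ p^-1) `^ p by rewrite -powRrM mulVf ?gt_eqF// powRr1// ltW.
have {}h : U `^ p <= (X `^ p^-1 * r^-1 * V) `^ p.
  by rewrite !powRM ?mulr_ge0 ?powR_ge0 ?invr_ge0 ?(ltW r0)// -Xp.
have {}h : U <= X `^ p^-1 * r^-1 * V.
  have W0 : 0 <= X `^ p^-1 * r^-1 * V by rewrite !mulr_ge0 ?powR_ge0 ?invr_ge0 ?(ltW r0).
  have := @ge0_ler_powR _ p^-1 _ (U `^ p) ((X `^ p^-1 * r^-1 * V) `^ p) (powR_ge0 _ _) (powR_ge0 _ _) h.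
  by rewrite -!powRrM mulfV ?gt_eqF// !powRr1//; apply; rewrite invr_ge0 ltW.
by rewrite -ler_pdivlMl// mulrCA mulrA.
Qed.

Lemma normc_polar (r theta : R) : 0 <= r -> Normc.normc (r%:C * (cos theta +i* sin theta))%C = r.
Proof.
move=> r0 /=; rewrite !mul0r subr0 addr0 !exprMn -mulrDr cos2Dsin2 mulr1.
by rewrite sqrtr_sqr ger0_norm.
Qed.

End global.

Local Open Scope complex_scope.

Theorem theorem1 (R : realType) (N : nat) (p c : R) :
  (1 <= N)%N -> 1 < p -> 0 < c ->
  exists rp C : R, 0 < rp /\
    forall a : 'rV[R]_N -> R,
      Ck 1 a ->
      (forall x, 0 < a x) ->
      (forall x, grad_norm a x <= c * a x `^ (1 / 2)) ->
      forall r theta : R, rp < r -> - (pi / 2) <= theta <= pi / 2 ->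
      forall u : 'rV[R]_N -> R[i], domA a p u ->
        let lambda : R[i] := r%:C * (cos theta +i* sin theta) in
        ((Normc.normc lambda)%:E * Lpnorm p u <=
         C%:E * Lpnorm p (fun x => lambda * u x - opA a u x)%R)%E.
Proof.
move=> _ p1 c0; have p0 : 0 < p by exact: lt_trans p1.
have [C [rp [C0 rp0 H]]] := @global_estimate R N p c p1 c0.
have X0 : 0 < 2 `^ p * C * 2 by rewrite !mulr_gt0// powR_gt0.
exists rp, ((2 `^ p * C * 2) `^ p^-1); split; first exact: rp0.
move=> a a1 a0 Da r theta rr hth u du; have [su [mu_ lu] _] := du.
cbv zeta; set lambda := (X in Normc.normc X).
have r0 : 0 < r by exact: lt_trans rr.
rewrite (normc_polar theta (ltW r0)); set f := fun x => _.
have [wr wi] := sobolev_weak_bilap su.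
have {}H := H a a1 a0 Da r theta rr hth _ _ _ _ wr wi.
have ReE x : complex.Re (f x) = r * (cos theta * complex.Re (u x) - sin theta * complex.Im (u x)) + a x ^+ 2 * complex.Re (bilaplacian u x).
  rewrite /f /opA /lambda; case: (u x) (bilaplacian u x) => [ux uy] [bx by_] /=; ring.
have ImE x : complex.Im (f x) = r * (cos theta * complex.Im (u x) + sin theta * complex.Re (u x)) + a x ^+ 2 * complex.Im (bilaplacian u x).
  rewrite /f /opA /lambda; case: (u x) (bilaplacian u x) => [ux uy] [bx by_] /=; ring.
have ReE' := funext ReE; have ImE' := funext ImE.
have [mur mbr _ _ _] := wr; have [mui mbi _ _ _] := wi.
have ma2 : measurable_fun setT (fun x => a x ^+ 2) by apply: measurable_funX; exact: (measurable_coef a1).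
have mf : cmeasurable f.
  split.
    rewrite ReE'; apply: measurable_funD; last exact: measurable_funM.
    by apply: measurable_funM => //; apply: measurable_funB; exact: measurable_funM.
  rewrite ImE'; apply: measurable_funD; last exact: measurable_funM.
  by apply: measurable_funM => //; apply: measurable_funD; exact: measurable_funM.
(* [global_estimate] assumes a finite norm of the right-hand side; if it is infinite, the positive
   constant makes the bound trivial. *)
have [fl|] := ltP (Lpnorm p f) +oo%E; last first.
  by rewrite leye_eq => /eqP ->; rewrite gt0_muley ?leey// lte_fin powR_gt0.
have [mfr mfi] := mf.
have Nur := Lnorm_modulus_lt p0 mu_ lu mur (fun x => Re_le_normc (u x)).
have Nui := Lnorm_modulus_lt p0 mu_ lu mui (fun x => Im_le_normc (u x)).
have Nfr := Lnorm_modulus_lt p0 mf fl mfr (fun x => Re_le_normc (f x)).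
have Nfi := Lnorm_modulus_lt p0 mf fl mfi (fun x => Im_le_normc (f x)).
apply: (Lpnorm_le_integral p1 C0 r0 mu_ mf lu fl).
rewrite ReE' in Nfr; rewrite ImE' in Nfi.
have := H Nur Nui Nfr Nfi.
by under [X in (_ <= _ * X)%E -> _]eq_integral do rewrite -ReE -ImE.
Qed.
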